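(* There is a constant $C>0$ such that for every $u\in W$, every $x\in\Gamma$ and every $r>0$ such that $Tu=0$ $\sigma$-a.e. on $\Gamma\cap B(x,r)$, $$\frac1{|B(x,r)|}\int_{B(x,r)}|u(y)|\,dy\ \le\ C\,r^{-d}\int_{B(x,r)}|\nabla u(y)|\,w(y)\,dy ,$$ where $C$ is independent of $u$, $x$ and $r$.
   Context: Let $n\ge2$ and let $0<d<n-1$ be a real number. $\Gamma\subset\mathbb R^n$ is a nonempty closed set which is Ahlfors regular of dimension $d$: there is $C_0\ge1$ with $C_0^{-1}r^d\le\mathcal H^d(\Gamma\cap B(x,r))\le C_0r^d$ for all $x\in\Gamma$, $r>0$. Set $\Omega=\mathbb R^n\setminus\Gamma$, $\sigma=\mathcal H^d|_\Gamma$, $\delta(z)=\operatorname{dist}(z,\Gamma)$ and $w(z)=\delta(z)^{d+1-n}$. $W=\{u\in L^1_{loc}(\Omega):\nabla u\in L^2(\Omega,w)\}$, where $\nabla u$ is the distributional gradient in $\Omega$ and $L^2(\Omega,w)=L^2(\Omega,w\,dz)$. Every $u\in W$ belongs to $L^1_{loc}(\mathbb R^n)$. For $u\in W$ the trace $Tu$ on $\Gamma$ is defined by $Tu(x)=\lim_{r\to0}\frac1{|B(x,r)|}\int_{B(x,r)}u(y)\,dy$, a limit which exists for $\sigma$-almost every $x\in\Gamma$. *)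

(* Defs.v *)
From HB Require Import structures.
From mathcomp Require Import all_boot all_order all_algebra.
From mathcomp Require Import all_classical all_reals all_analysis.

Set Implicit Arguments.
Unset Strict Implicit.
Unset Printing Implicit Defensive.

Import Order.TTheory GRing.Theory Num.Theory.
Import numFieldNormedType.Exports.

Local Open Scope classical_set_scope.
Local Open Scope ring_scope.

(** * Lebesgue measure on R^n *)

Definition measure_rV_display : measure_display -> measure_display.
Proof. exact. Qed.

(* The product sigma-algebra, as for n.-tuple T in the library; for T = R it is
   the Borel sigma-algebra of R^n. *)
Section measurable_rV.
Context {d} {T : sigmaRingType d}.
Variable n : nat.

Let coors : 'I_n -> 'rV[T]_n -> T := fun i x => x ord0 i.

Let rV_set0 : g_sigma_preimage coors set0.
Proof. exact: sigma_algebra0. Qed.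

Let rV_setC A : g_sigma_preimage coors A -> g_sigma_preimage coors (~` A).
Proof. exact: sigma_algebraC. Qed.

Let rV_bigcup (F : _^nat) : (forall i, g_sigma_preimage coors (F i)) ->
  g_sigma_preimage coors (\bigcup_i (F i)).
Proof. exact: sigma_algebra_bigcup. Qed.

HB.instance Definition _ := @isMeasurable.Build (measure_rV_display d)
  ('rV[T]_n) (g_sigma_preimage coors) rV_set0 rV_setC rV_bigcup.

End measurable_rV.

Section measurable_rV_fun.
Context d1 d2 (T1 : measurableType d1) (T2 : measurableType d2).

Lemma measurable_coord n (i : 'I_n) :
  measurable_fun [set: 'rV[T2]_n] (fun v : 'rV[T2]_n => v ord0 i).
Proof.
move=> _ Y mY; rewrite setTI; apply: sub_sigma_algebra => /=.
rewrite -bigcup_seq/=; exists i => /=; first by rewrite mem_index_enum.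
by exists Y => //; rewrite setTI.
Qed.

Lemma measurable_fun_coordP n (f : T1 -> 'rV[T2]_n) :
  measurable_fun [set: T1] f <->
  forall i, measurable_fun [set: T1] (fun x => f x ord0 i).
Proof.
split=> [mf i|mf].
  exact: (measurableT_comp (measurable_coord i) mf).
move=> _; apply: measurability => //.
move=> _ [A + <-]; rewrite -bigcup_seq => -[i _ [B mB <-]].
by rewrite !setTI -[X in measurable X]setTI; exact: mf.
Qed.

End measurable_rV_fun.

Section lebesgue_rV.
Context {R : realType}.

Definition row_cons n (p : R * 'rV[R]_n) : 'rV[R]_n.+1 :=
  row_mx (p.1)%:M p.2 : 'rV[R]_(1 + n).

Definition row_uncons n (v : 'rV[R]_n.+1) : R * 'rV[R]_n :=
  (v ord0 ord0, \row_i v ord0 (lift ord0 i)).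

Lemma row_cons0 n (p : R * 'rV[R]_n) : row_cons p ord0 ord0 = p.1.
Proof.
by rewrite /row_cons mxE; case: splitP => // j _; rewrite !ord1 mxE eqxx mulr1n.
Qed.

Lemma row_consS n (p : R * 'rV[R]_n) i :
  row_cons p ord0 (lift ord0 i) = p.2 ord0 i.
Proof.
rewrite /row_cons mxE; case: splitP => [j|j]; first by rewrite ord1.
by rewrite lift0 add1n => -[] /val_inj ->.
Qed.

Lemma row_consK n : cancel (@row_cons n) (@row_uncons n).
Proof.
move=> [x v]; rewrite /row_uncons row_cons0; congr pair.
by apply/rowP => i; rewrite mxE row_consS.
Qed.

Lemma row_unconsK n : cancel (@row_uncons n) (@row_cons n).
Proof.
move=> v; apply/rowP => i; case: (unliftP ord0 i) => [j|] ->.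
  by rewrite row_consS mxE.
by rewrite row_cons0.
Qed.

Lemma measurable_row_cons n : measurable_fun setT (@row_cons n).
Proof.
apply/measurable_fun_coordP => i; case: (unliftP ord0 i) => [j|] ->.
  under eq_fun do rewrite row_consS.
  exact: measurableT_comp (measurable_coord j) measurable_snd.
under eq_fun do rewrite row_cons0.
exact: measurable_fst.
Qed.

Lemma measurable_row_uncons n : measurable_fun setT (@row_uncons n).
Proof.
apply: measurable_fun_pair; first exact: measurable_coord.
apply/measurable_fun_coordP => i.
under eq_fun do rewrite mxE.
exact: measurable_coord.
Qed.

Section step.
Variables (n : nat) (m : {sigma_finite_measure set 'rV[R]_n -> \bar R}).

Definition lebesgue_step : set 'rV[R]_n.+1 -> \bar R :=
  pushforward (@lebesgue_measure R \x m)%E (@row_cons n).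

Let step0 : lebesgue_step set0 = 0%E.
Proof. by rewrite /lebesgue_step /pushforward preimage_set0 measure0. Qed.

Let step_ge0 A : (0 <= lebesgue_step A)%E.
Proof. by rewrite /lebesgue_step /pushforward; exact: measure_ge0. Qed.

Let step_sigma_additive : semi_sigma_additive lebesgue_step.
Proof.
move=> F mF tF mUF; rewrite /lebesgue_step /pushforward preimage_bigcup.
have mc A : measurable A -> measurable (@row_cons n @^-1` A).
  by move=> mA; rewrite -[X in measurable X]setTI; exact: measurable_row_cons.
apply: measure_semi_sigma_additive.
- by move=> k; apply: mc; exact: mF.
- apply/trivIsetP => /= i j _ _ ij; rewrite -preimage_setI.
  by move/trivIsetP : tF => /(_ _ _ _ _ ij) ->//; rewrite preimage_set0.
- by rewrite -preimage_bigcup; exact: mc.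
Qed.

HB.instance Definition _ := isMeasure.Build _ _ _ lebesgue_step
  step0 step_ge0 step_sigma_additive.

Let step_sigma_finite : sigma_finite setT lebesgue_step.
Proof.
have /sigma_finiteP[F [TF ndF Foo]] := sigma_finiteT (@lebesgue_measure R).
have /sigma_finiteP[G [TG ndG Goo]] := sigma_finiteT m.
exists (fun k => @row_uncons n @^-1` (F k `*` G k)).
  apply/esym/seteqP; split => // v _.
  have [i _ Fi] : (\bigcup_i F i) (row_uncons v).1 by rewrite -TF.
  have [j _ Gj] : (\bigcup_i G i) (row_uncons v).2 by rewrite -TG.
  exists (maxn i j) => //; split.
    by move: Fi; exact/subsetPset/ndF/leq_maxl.
  by move: Gj; exact/subsetPset/ndG/leq_maxr.
move=> k; have [mF Fk] := Foo k; have [mG Gk] := Goo k; split.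
  rewrite -[X in measurable X]setTI; apply: measurable_row_uncons => //.
  exact: measurableX.
rewrite /lebesgue_step /pushforward.
rewrite (_ : _ @^-1` _ = F k `*` G k); last first.
  by rewrite -comp_preimage; apply/funext => x;
    rewrite /preimage/= -[LHS]/((F k `*` G k) (row_uncons (row_cons x))) row_consK.
by rewrite product_measure1E// lte_mul_pinfty// ge0_fin_numE.
Qed.

HB.instance Definition _ := Measure_isSigmaFinite.Build _ _ _
  lebesgue_step step_sigma_finite.

End step.

Fixpoint lebesgue_rec n : {sigma_finite_measure set 'rV[R]_n -> \bar R} :=
  match n with
  | 0 => [the {sigma_finite_measure set 'rV[R]_0 -> \bar R} of \d_(0 : 'rV[R]_0)]
  | n'.+1 => [the {sigma_finite_measure set 'rV[R]_n'.+1 -> \bar R}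
               of lebesgue_step (lebesgue_rec n')]
  end.

Definition lebesgue_rV n : set 'rV[R]_n -> \bar R := lebesgue_rec n.

HB.instance Definition _ n := SigmaFiniteMeasure.on (@lebesgue_rV n).

(* The value on boxes, which characterizes the Lebesgue measure of R^n *)
Lemma lebesgue_rV_box n (a b : 'I_n -> R) : (forall i, a i <= b i) ->
  lebesgue_rV [set v : 'rV[R]_n | forall i, v ord0 i \in `]a i, b i]] =
  (\prod_(i < n) (b i - a i))%:E.
Proof.
elim: n a b => [|n IH] a b ab.
  rewrite big_ord0 /lebesgue_rV/= diracE mem_set//=.
  by move=> -[].
set A := [set v : 'rV[R]_n.+1 | _].
have AE : @row_cons n @^-1` A = `]a ord0, b ord0]%classic `*`
    [set v : 'rV[R]_n | forall i, v ord0 i \in `]a (lift ord0 i), b (lift ord0 i)]].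
  apply/seteqP; split => -[x v] /=.
    move=> H; split; first by have := H ord0; rewrite row_cons0.
    by move=> i; have := H (lift ord0 i); rewrite row_consS.
  move=> [H1 H2] i; case: (unliftP ord0 i) => [j|] ->.
    by rewrite row_consS.
  by rewrite row_cons0.
rewrite -[LHS]/((@lebesgue_measure R \x lebesgue_rec n)%E (@row_cons n @^-1` A)).
rewrite AE product_measure1E//; last first.
  rewrite [X in measurable X](_ : _ = \bigcap_(i in [set: 'I_n])
     ((fun v : 'rV[R]_n => v ord0 i) @^-1`
       `]a (lift ord0 i), b (lift ord0 i)]%classic)).
    apply: fin_bigcap_measurable => // i _.
    by rewrite -[X in measurable X]setTI; exact: measurable_coord.
  by apply/seteqP; split => v /= H i; [move=> _|]; exact: H.
rewrite big_ord_recl EFinM; congr (_ * _)%E.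
  rewrite /= lebesgue_measure_itv/= lte_fin.
  have := ab ord0; rewrite le_eqVlt => /predU1P[->|->]; last by rewrite EFinB.
  by rewrite ltxx subrr.
exact: IH.
Qed.

End lebesgue_rV.

Section euclidean.
Context {R : realType} {n : nat}.
Implicit Types (x y z : 'rV[R]_n) (E : set 'rV[R]_n).

(* The library norm `|x| on 'rV[R]_n is the sup norm, with the same topology. *)
Definition enorm x : R := Num.sqrt (\sum_(i < n) x ord0 i ^+ 2).

Definition eball x (r : R) : set 'rV[R]_n := [set y | enorm (y - x) < r].

Definition dist_to E z : R := inf [set enorm (z - y) | y in E].

(* The maximum makes the diameter of the empty set 0. *)
Definition ediam E : \bar R :=
  maxe 0%E (ereal_sup [set (enorm (x - y))%:E | x in E & y in E]).

End euclidean.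

Section hausdorff.
Context {R : realType} {n : nat}.
Local Open Scope ereal_scope.

Definition hausdorff_pre (d eps : R) (A : set 'rV[R]_n) : \bar R :=
  ereal_inf [set \sum_(k <oo) (ediam (E k) `^ d) | E in
    [set E : (set 'rV[R]_n)^nat |
      A `<=` \bigcup_k E k /\ forall k, ediam (E k) <= eps%:E]].

(* Hausdorff (outer) measure H^d, without the normalizing factor
   |B^d(0, 1/2)|; a constant factor affects neither Ahlfors regularity nor
   null sets. *)
Definition hausdorff (d : R) (A : set 'rV[R]_n) : \bar R :=
  ereal_sup [set hausdorff_pre d eps A | eps in [set eps : R | (0 < eps)%R]].

(* P holds H^d-almost everywhere on A. The exceptional set need not be assumed
   measurable: sets of outer measure 0 are. *)
Definition hausdorff_ae (d : R) (A P : set 'rV[R]_n) : Prop :=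
  hausdorff d (A `\` P) = 0.

Definition ahlfors_regular (d : R) (Gam : set 'rV[R]_n) : Prop :=
  exists2 C0 : R, (1 <= C0)%R & forall x (r : R), Gam x -> (0 < r)%R ->
    (C0^-1 * r `^ d)%:E <= hausdorff d (Gam `&` eball x r) <= (C0 * r `^ d)%:E.

End hausdorff.

Section sobolev.
Context {R : realType} {n : nat}.
Implicit Types (Omega Gam : set 'rV[R]_n) (u phi : 'rV[R]_n -> R)
  (g : 'rV[R]_n -> 'rV[R]_n) (i : 'I_n).

Local Notation mu := (@lebesgue_rV R n).

(* Elements of L^1_loc are given by Borel representatives; their values outside
   Omega are irrelevant. Compare locally_integrable in the library, for R. *)
Definition locally_integrable_rV Omega u : Prop :=
  [/\ measurable_fun Omega u, open Omega & forall K, K `<=` Omega ->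
    compact K -> (\int[mu]_(x in K) `|u x|%:E < +oo)%E].

Definition partial i phi : 'rV[R]_n -> R := 'D_(delta_mx ord0 i) phi.

Definition smooth phi : Prop := forall s : seq 'I_n,
  let psi := foldr partial phi s in
  continuous psi /\ forall i x, derivable psi x (delta_mx ord0 i).

Definition test_function Omega phi : Prop :=
  smooth phi /\ exists K : set 'rV[R]_n,
    [/\ compact K, K `<=` Omega & forall x, ~ K x -> phi x = 0].

(* The distributional gradient of u in Omega is (represented by) g. *)
Definition weak_gradient Omega u g : Prop :=
  (forall i, locally_integrable_rV Omega (fun x => g x ord0 i)) /\
  forall phi, test_function Omega phi -> forall i,
    (\int[mu]_(x in Omega) (u x * partial i phi x)%:E =
     - \int[mu]_(x in Omega) (g x ord0 i * phi x)%:E)%E.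

Definition weight (d : R) Gam (z : 'rV[R]_n) : R :=
  dist_to Gam z `^ (d + 1 - n%:R).

Definition inW (d : R) Gam u : Prop :=
  locally_integrable_rV (~` Gam) u /\
  exists2 g, weak_gradient (~` Gam) u g &
    (\int[mu]_(z in ~` Gam) (enorm (g z) ^+ 2 * weight d Gam z)%:E < +oo)%E.

(* Average over B(x, r) of an extended-real function defined on the complement
   of Gam. The integral ranges over B(x, r) minus Gam: the sets Gam considered
   are Lebesgue-null, being Ahlfors regular of dimension d < n. *)
Definition ball_mean Gam (f : 'rV[R]_n -> \bar R) x (r : R) : \bar R :=
  ((fine (mu (eball x r)))^-1%:E * \int[mu]_(y in eball x r `\` Gam) f y)%E.

(* Tu(x) exists and equals l *)
Definition trace Gam u x (l : R) : Prop :=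
  ball_mean Gam (EFin \o u) x r @[r --> 0^'+] --> l%:E.

End sobolev.

(* Main.v *)
(** Since d < n - 1, for each h almost every segment [z, z + h] avoids Gam. Testing
the weak gradient g against translated tensor products of bumps therefore gives
u(z + h) - u(z) = int_0^1 g(z + t h) . h dt for almost every z, as if Gam were
absent, and integrating over h yields the L^1 Poincare inequality on every ball.
At a point y of Gam with zero trace, telescoping the averages of u over the balls
B(y, s_k), s_k = 2^-k r/2, bounds the average of |u| over B(x, r) by
s^(1-n) int_B(y, s) |g| summed over s = s_k, plus the same term for B(x, r).
Average this over y in B(x, r/2) for H^d on Gam and exchange the integrals: the
coefficient of |g(z)| is at most a multiple of the sum of s_k^(1-n) s_k^d over the
k with s_k > dist(z, Gam), a geometric series comparable to its last term, which
is at most the weight w(z). *)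

From HB Require Import structures.
Require Import Defs.
From mathcomp Require Import all_boot all_order all_algebra.
From mathcomp Require Import all_classical all_reals all_analysis.
From mathcomp Require Import measurable_realfun.
From mathcomp Require Import ring lra.

Set Implicit Arguments.
Unset Strict Implicit.
Unset Printing Implicit Defensive.

Import Order.TTheory GRing.Theory Num.Theory.
Import numFieldNormedType.Exports.

Local Open Scope classical_set_scope.
Local Open Scope ring_scope.

(** * Euclidean balls and Lebesgue measure *)

(** The obstacle is that [u] is only known to be integrable on compact sets away from [Gam], while
    the averages and the trace live on balls centred on [Gam]. Integrability there is produced by
    the Poincare inequality itself, once the gradient has finite L^1 norm on the ball. That norm is
    finite as soon as the right-hand side is, because w >= r^-p on B(x, r), with p = n - 1 - d; an
    infinite right-hand side leaves nothing to prove. The same p > 0 makes the set of segments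
    meeting [Gam] null (order e^p at scale e) and the sums of s_k^-p geometric. Regularization of
    [u] across [Gam] is avoided: differences of [u] are tested only on compact sets swept by boxes
    whose segments miss [Gam], and the null set of bad segments is discarded before anything is
    integrated over a ball. Exchanging an integral in H^d with one in Lebesgue measure needs a
    finite Borel measure: H^d is a metric outer measure, hence additive on Borel sets, and its
    restriction to [Gam] inside a ball is finite by regularity. *)

Section enorm_theory.
Context {R : realType} {n : nat}.
Implicit Types (x y z : 'rV[R]_n) (E : set 'rV[R]_n).

Lemma enorm_ge0 x : 0 <= enorm x.
Proof. exact: sqrtr_ge0. Qed.

Lemma sqr_enorm x : enorm x ^+ 2 = \sum_(i < n) x ord0 i ^+ 2.
Proof. by rewrite sqr_sqrtr// sumr_ge0// => i _; exact: sqr_ge0. Qed.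

Lemma enormZ (a : R) x : enorm (a *: x) = `|a| * enorm x.
Proof.
rewrite /enorm -sqrtr_sqr -sqrtrM ?sqr_ge0// mulr_sumr; congr Num.sqrt.
by apply: eq_bigr => i _; rewrite mxE exprMn.
Qed.

Lemma enormN x : enorm (- x) = enorm x.
Proof. by rewrite -scaleN1r enormZ normrN1 mul1r. Qed.

Lemma enormB x y : enorm (x - y) = enorm (y - x).
Proof. by rewrite -opprB enormN. Qed.

Lemma enorm0 : enorm (0 : 'rV[R]_n) = 0.
Proof. by rewrite -(scale0r 0) enormZ normr0 mul0r. Qed.

Lemma coord_le_enorm x i : `|x ord0 i| <= enorm x.
Proof.
rewrite -sqrtr_sqr ler_sqrt ?sumr_ge0//; last by move=> j _; exact: sqr_ge0.
by rewrite (bigD1 i)//= lerDl sumr_ge0// => j _; exact: sqr_ge0.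
Qed.

Lemma dot_le_enorm x y : \sum_(i < n) x ord0 i * y ord0 i <= enorm x * enorm y.
Proof.
have [/eqP x0|x0] := boolP (enorm x == 0).
  rewrite x0 mul0r big1// => i _.
  have := coord_le_enorm x i; rewrite x0 normr_le0 => /eqP ->.
  by rewrite mul0r.
have [/eqP y0|y0] := boolP (enorm y == 0).
  rewrite y0 mulr0 big1// => i _.
  have := coord_le_enorm y i; rewrite y0 normr_le0 => /eqP ->.
  by rewrite mulr0.
have {}x0 : 0 < enorm x by rewrite lt_def x0 enorm_ge0.
have {}y0 : 0 < enorm y by rewrite lt_def y0 enorm_ge0.
set a := enorm x; set b := enorm y.
(* Cauchy-Schwarz from the square of |y| x - |x| y; the expansion is divided by the positive product
   [a * b] at the end. *)
have : 0 <= \sum_(i < n) (b * x ord0 i - a * y ord0 i) ^+ 2.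
  by apply: sumr_ge0 => i _; exact: sqr_ge0.
have -> : \sum_(i < n) (b * x ord0 i - a * y ord0 i) ^+ 2 =
   b ^+ 2 * \sum_i x ord0 i ^+ 2 + a ^+ 2 * \sum_i y ord0 i ^+ 2 -
   2 * a * b * \sum_i x ord0 i * y ord0 i.
  rewrite !mulr_sumr -big_split/= -sumrB; apply: eq_bigr => i _.
  by ring.
rewrite -!sqr_enorm -/a -/b.
have ab : 0 < a * b by exact: mulr_gt0.
nra.
Qed.

Lemma abs_dot_le_enorm x y :
  `|\sum_(i < n) x ord0 i * y ord0 i| <= enorm x * enorm y.
Proof.
rewrite ler_norml dot_le_enorm andbT lerNl -sumrN.
apply: le_trans (_ : \sum_i (- x) ord0 i * y ord0 i <= _).
  by apply: ler_sum => i _; rewrite mxE mulNr.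
by rewrite -(enormN x) dot_le_enorm.
Qed.

Lemma ler_enormD x y : enorm (x + y) <= enorm x + enorm y.
Proof.
rewrite -(ler_pXn2r (n := 2))// ?nnegrE ?enorm_ge0 ?addr_ge0 ?enorm_ge0//.
rewrite sqrrD !sqr_enorm.
have -> : \sum_i (x + y) ord0 i ^+ 2 = \sum_i x ord0 i ^+ 2 +
    2 * (\sum_i x ord0 i * y ord0 i) + \sum_i y ord0 i ^+ 2.
  rewrite mulr_sumr -!big_split/=; apply: eq_bigr => i _.
  by rewrite mxE; ring.
by rewrite lerD2r lerD2l -[leRHS]mulr_natl ler_wpM2l// dot_le_enorm.
Qed.

Lemma ler_enormBD z x y : enorm (x - y) <= enorm (x - z) + enorm (z - y).
Proof. by apply: le_trans (ler_enormD _ _); rewrite addrA subrK. Qed.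

Lemma enorm_le_sum x : enorm x <= \sum_(i < n) `|x ord0 i|.
Proof.
have S0 : 0 <= \sum_(i < n) `|x ord0 i| by apply: sumr_ge0.
rewrite -(ler_pXn2r (n := 2))// ?nnegrE ?enorm_ge0// sqr_enorm.
rewrite expr2 mulr_suml; apply: ler_sum => i _.
rewrite -[_ ^+ 2]ger0_norm ?sqr_ge0// normrX expr2 ler_wpM2l//.
by rewrite (bigD1 i)//= lerDl sumr_ge0.
Qed.

Lemma coord_le_norm x i : `|x ord0 i| <= `|x|.
Proof.
rewrite [in leRHS]/Num.norm/= mx_normrE.
exact: (le_bigmax 0 (fun ij => `|x ij.1 ij.2|) (ord0, i)).
Qed.

Lemma enorm_le_norm x : enorm x <= n%:R * `|x|.
Proof.
apply: le_trans (enorm_le_sum x) _.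
rewrite -[n in n%:R]card_ord -mulr_natl mulr1 mulr_natl -sumr_const.
by apply: ler_sum => i _; exact: coord_le_norm.
Qed.

Lemma eball_triangle x y z (r s : R) : eball x r y -> eball y s z ->
  eball x (r + s) z.
Proof.
rewrite /eball/= => xy yz; apply: le_lt_trans (ler_enormBD y _ _) _.
by rewrite addrC ltrD.
Qed.

Lemma eball_center x (r : R) : 0 < r -> eball x r x.
Proof. by rewrite /eball/= subrr enorm0. Qed.

Lemma eball_sym x y (r : R) : eball x r y -> eball y r x.
Proof. by rewrite /eball/= enormB. Qed.

Lemma eball_sub x y (r s t : R) : eball x s y -> s + r <= t ->
  eball y r `<=` eball x t.
Proof.
move=> xy st z /(eball_triangle xy); rewrite /eball/= => h.
exact: lt_le_trans st.
Qed.

Lemma le_eball x (r s : R) : r <= s -> eball x r `<=` eball x s.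
Proof. by move=> rs y; rewrite /eball/= => h; exact: lt_le_trans rs. Qed.

Lemma eball_convex x (r t : R) y z : 0 <= t <= 1 -> eball x r y ->
  eball x r (y + z) -> eball x r (y + t *: z).
Proof.
rewrite /eball/= => /andP[t0 t1] xy xz.
have -> : y + t *: z - x = (1 - t) *: (y - x) + t *: (y + z - x).
  by apply/rowP => i; rewrite !mxE; ring.
apply: le_lt_trans (ler_enormD _ _) _.
rewrite !enormZ !ger0_norm ?subr_ge0//.
have [->|tn0] := eqVneq t 0; first by rewrite subr0 mul1r mul0r addr0.
have {}t0 : 0 < t by rewrite lt_def tn0.
have := enorm_ge0 (y - x); nra.
Qed.

Lemma eball_open x (r : R) : open (eball x r).
Proof.
rewrite openE => y; rewrite /eball/= => xy.
rewrite /interior; apply/nbhs_ballP.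
exists ((r - enorm (y - x)) / (n%:R + 1)) => /=.
  by rewrite divr_gt0 ?subr_gt0// ltr_pwDr.
move=> z; rewrite -ball_normE/= => yz.
apply: le_lt_trans (ler_enormBD y _ _) _.
rewrite -ltrBrDr enormB; apply: le_lt_trans (enorm_le_norm _) _.
apply: le_lt_trans (_ : (n%:R + 1) * `|y - z| < _).
  by rewrite ler_wpM2r// lerDl.
by rewrite mulrC -ltr_pdivlMr// ltr_pwDr.
Qed.

Lemma continuous_lipschitz_enorm (f : 'rV[R]_n -> R) (k : R) : 0 <= k ->
  (forall x y, `|f x - f y| <= k * enorm (x - y)) -> continuous f.
Proof.
move=> k0 fk x; apply/(@cvgrPdist_lt _ _ _ _ (nbhs_filter x)) => e e0.
have e1 : 0 < e / (k + 1) by rewrite divr_gt0// ltr_pwDr.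
have : nbhs x (eball x (e / (k + 1))).
  by apply: open_nbhs_nbhs; split; [exact: eball_open|exact: eball_center].
apply: filterS => y; rewrite /eball/= enormB => h.
apply: le_lt_trans (fk _ _) _.
apply: le_lt_trans (_ : (k + 1) * enorm (x - y) < _).
  by rewrite ler_wpM2r ?enorm_ge0// lerDl.
by rewrite mulrC -ltr_pdivlMr// ltr_pwDr.
Qed.

Lemma ler_dist_enorm x y : `|enorm x - enorm y| <= enorm (x - y).
Proof.
rewrite ler_norml; apply/andP; split.
  rewrite lerNl opprB lerBlDr enormB -{1}(subrK x y); exact: ler_enormD.
rewrite lerBlDr -{1}(subrK y x); exact: ler_enormD.
Qed.

Lemma enorm_continuous : continuous (@enorm R n).
Proof.
apply: (@continuous_lipschitz_enorm _ 1) => // x y; rewrite mul1r.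
exact: ler_dist_enorm.
Qed.

End enorm_theory.

(** * Open boxes and the Borel sigma-algebra of R^n *)

Section measurable_rV_theory.
Context {R : realType} {n : nat}.
Implicit Types (x y z : 'rV[R]_n) (a b : 'I_n -> R) (U : set 'rV[R]_n).

Definition obox a b : set 'rV[R]_n := [set v | forall i, v ord0 i \in `]a i, b i[].

Lemma measurable_obox a b : measurable (obox a b).
Proof.
rewrite [X in measurable X](_ : _ = \bigcap_(i in [set: 'I_n])
   ((fun v : 'rV[R]_n => v ord0 i) @^-1` `]a i, b i[%classic)).
  apply: fin_bigcap_measurable => // i _.
  by rewrite -[X in measurable X]setTI; exact: measurable_coord.
by apply/seteqP; split => v /= H i; [move=> _|]; exact: H.
Qed.

Lemma oboxI a b a' b' : obox a b `&` obox a' b' =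
  obox (fun i => Num.max (a i) (a' i)) (fun i => Num.min (b i) (b' i)).
Proof.
apply/seteqP; split => v /=.
  move=> [H H'] i; have := H i; have := H' i.
  rewrite !in_itv/= gt_max lt_min => /andP[h1 h2] /andP[h3 h4].
  by rewrite h1 h2 h3 h4.
move=> H; split => i; have := H i;
by rewrite !in_itv/= gt_max lt_min => /andP[/andP[h1 h2] /andP[h3 h4]];
  apply/andP.
Qed.

Lemma nbhs_obox x U : nbhs x U -> exists2 e : R, 0 < e &
  obox (fun i => x ord0 i - e) (fun i => x ord0 i + e) `<=` U.
Proof.
move=> /nbhs_ballP[e /= e0 eU]; exists e => // v vx; apply: eU; split => // i j.
rewrite ord1 /ball/= distrC; have := vx j; rewrite in_itv/= => /andP[h1 h2].
by rewrite ltr_norml; apply/andP; split; lra.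
Qed.

Definition cbox a b : set 'rV[R]_n := [set v | forall i, v ord0 i \in `[a i, b i]].

(** The closed boxes are required to lie in [U] because sweeping a closed box along a segment later
    gives a compact set, on which [u] is integrable. Centres are rational and half-sides are
    1/(m+1), so that [pickle] enumerates the boxes; codes of boxes that leave [U] give the empty
    set. *)
Lemma open_obox_cover U : open U -> exists F : nat -> set 'rV[R]_n,
  U = \bigcup_k F k /\
  forall k, F k = set0 \/ exists a b, F k = obox a b /\ cbox a b `<=` U.
Proof.
move=> oU.
pose a (p : 'rV[rat]_n * nat) i : R := ratr (p.1 ord0 i) - p.2.+1%:R^-1.
pose b (p : 'rV[rat]_n * nat) i : R := ratr (p.1 ord0 i) + p.2.+1%:R^-1.
pose F k := if unpickle k is Some p then
  if pselect (cbox (a p) (b p) `<=` U) then obox (a p) (b p) else set0 else set0.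
exists F; split; last first.
  move=> k; rewrite /F; case: unpickle => [p|]; last by left.
  by case: pselect => BU /=; [right; exists (a p), (b p)|left].
have oc p : obox (a p) (b p) `<=` cbox (a p) (b p).
  by move=> v H i; have := H i; rewrite !in_itv/= => /andP[/ltW -> /ltW ->].
apply/seteqP; split=> [x Ux|x [k _]]; last first.
  by rewrite /F; case: unpickle => //= p; case: pselect => //= h /oc /h.
have /nbhs_obox[e e0 eU] : nbhs x U by apply: open_nbhs_nbhs.
(* The half-side is below [e / 2] and the rational centre is within one half-side of [x], so the
   whole closed box stays within [e] of [x]. *)
have [m me] : exists m : nat, m.+1%:R^-1 < e / 2.
  have [m _ h] := near_infty_natSinv_lt (PosNum (divr_gt0 e0 (ltr0n R 2))).
  by exists m; exact: (h m (leqnn m)).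
have [q Hq] : {q : 'I_n -> rat & forall i,
    ratr (q i) \in `]x ord0 i - m.+1%:R^-1, x ord0 i + m.+1%:R^-1[}.
  apply: (@choice _ _ (fun i (q : rat) =>
    ratr q \in `]x ord0 i - m.+1%:R^-1, x ord0 i + m.+1%:R^-1[)) => i.
  by apply: rat_in_itvoo; rewrite ltrBlDr -addrA ltrDl addr_gt0 ?invr_gt0.
exists (pickle (\row_i q i : 'rV[rat]_n, m)) => //.
rewrite /F pickleK; case: pselect => [BU|[]].
  move=> i; have := Hq i; rewrite /a /b /= !mxE !in_itv/= => /andP[h1 h2].
  by rewrite ltrBlDr h2 -ltrBlDr h1.
move=> v Bv; apply: eU => i; have := Bv i; have := Hq i.
rewrite /a /b !mxE !in_itv/= => /andP[h1 h2] /andP[h3 h4].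
move: me h1 h2 h3 h4; move: (_^-1) (ratr _) => c t me h1 h2 h3 h4.
by apply/andP; split; lra.
Qed.

Lemma open_measurable_rV U : open U -> measurable U.
Proof.
move=> /open_obox_cover[F [-> HF]]; apply: bigcupT_measurable => k.
by have [->|[a [b [-> _]]]] := HF k; [exact: measurable0|exact: measurable_obox].
Qed.

Lemma closed_measurable_rV U : closed U -> measurable U.
Proof.
move=> cU; rewrite -(setCK U); apply: measurableC; apply: open_measurable_rV.
exact: closed_openC.
Qed.

Lemma continuous_measurable_rV (f : 'rV[R]_n -> R) :
  continuous f -> measurable_fun setT f.
Proof.
move=> /continuousP cf; apply: (measurability _ (measurable_realfun.RGenOpens.measurableE R)).
move=> _ [_ [a [b ->] <-]]; rewrite setTI; apply: open_measurable_rV.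
exact/cf/interval_open.
Qed.

Lemma measurable_eball x (r : R) : measurable (eball x r).
Proof. by apply: open_measurable_rV; exact: eball_open. Qed.

Lemma measurable_rV_obox :
  @measurable _ 'rV[R]_n = <<s [set A | exists a b, A = obox a b] >>.
Proof.
apply/seteqP; split; last first.
  apply: smallest_sub; first exact: sigma_algebra_measurable.
  by move=> _ [a [b ->]]; exact: measurable_obox.
apply: smallest_sub; first exact: smallest_sigma_algebra.
rewrite -bigcup_seq => A [i _] [B mB <-]; rewrite setTI.
move: B mB; apply: smallest_sub.
  have := @smallest_sigma_algebra _ [set: 'rV[R]_n] [set A | exists a b, A = obox a b].
  move=> [h0 hC hU]; split => //=.
  - by move=> B hB; rewrite setTD preimage_setC -setTD; exact: hC.
  - by move=> F hF; rewrite preimage_bigcup; exact: hU.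
move=> X [[u v] _ <-] /=.
have H i0 (c : R) : <<s [set A | exists a b, A = obox a b] >>
    ((fun x : 'rV[R]_n => x ord0 i0) @^-1` `]c, +oo[).
  rewrite [X in _ X](_ : _ = \bigcup_k obox
      (fun j => if j == i0 then c else - k%:R) (fun j => k%:R)).
    have := @smallest_sigma_algebra _ [set: 'rV[R]_n] [set A | exists a b, A = obox a b].
    move=> [_ _]; apply => k; apply: sub_sigma_algebra.
    by exists (fun j => if j == i0 then c else - k%:R), (fun j => k%:R).
  apply/seteqP; split => [x /=|x [k _ /(_ i0)]]; rewrite in_itv/= ?andbT.
    move=> cx; exists (Num.truncn `|x|).+1 => // j; rewrite in_itv/=.
    have xk : `|x| < (Num.truncn `|x|).+1%:R by exact: truncnS_gt.
    have := le_lt_trans (coord_le_norm x j) xk.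
    rewrite ltr_norml => /andP[h1 h2]; have [ji|_] := eqVneq j i0.
      by rewrite h2 andbT ji.
    by rewrite h1 h2.
  by rewrite eqxx in_itv/= andbT => /andP[].
have hh := @smallest_sigma_algebra _ [set: 'rV[R]_n] [set A | exists a b, A = obox a b].
case: hh => h0 hC hU.
rewrite (_ : _ @^-1` _ = ((fun x : 'rV[R]_n => x ord0 i) @^-1` `]u, +oo[) `&`
   ~` ((fun x : 'rV[R]_n => x ord0 i) @^-1` `]v, +oo[)).
  have -> (P Q : set 'rV[R]_n) : P `&` Q = ~` (~` P `|` ~` Q).
    by rewrite setCU !setCK.
  rewrite -setTD; apply: (hC); rewrite -bigcup2E; apply: hU => -[|[|k]] //=.
    by rewrite -setTD; apply: hC; exact: H.
  by rewrite setCK; exact: H.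
apply/seteqP; split => x /=; rewrite !in_itv/= !andbT.
  by move=> /andP[-> h]; split => //; apply/negP; rewrite -leNgt.
by move=> [-> /negP]; rewrite -leNgt.
Qed.

Lemma measure_unique_obox (m1 m2 : {measure set 'rV[R]_n -> \bar R}) :
  (forall a b, m1 (obox a b) = m2 (obox a b)) ->
  (forall a b, (m1 (obox a b) < +oo)%E) ->
  forall A, measurable A -> m1 A = m2 A.
Proof.
move=> m12 m1oo; apply: (measure_unique [set A | exists a b, A = obox a b]
  (fun k => obox (fun=> - k%:R) (fun=> k%:R)) measurable_rV_obox) => //=.
- by move=> _ _ [a [b ->]] [a' [b' ->]]; rewrite oboxI; do 2 eexists.
- by move=> k; do 2 eexists.
- apply/seteqP; split => // x _; exists (Num.truncn `|x|).+1 => // j.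
  rewrite in_itv/= -ltr_norml.
  by apply: le_lt_trans (coord_le_norm x j) _; exact: truncnS_gt.
- by move=> _ [a [b ->]].
Qed.

End measurable_rV_theory.

(** * Lebesgue measure of boxes and balls, and its translation invariance *)

Section lebesgue_rV_theory.
Context {R : realType}.
Local Notation mu := (@lebesgue_rV R _).

(** The maximum with 0 accounts for empty boxes, so that the value is known for every pair of
    corners, as [measure_unique_obox] demands. *)
Lemma lebesgue_rV_obox n (a b : 'I_n -> R) :
  mu (obox a b) = (\prod_(i < n) Num.max 0 (b i - a i))%:E.
Proof.
elim: n a b => [|n IH] a b.
  by rewrite big_ord0 /lebesgue_rV/= diracE mem_set// => -[].
rewrite -[LHS]/((@lebesgue_measure R \x lebesgue_rec n)%E (@row_cons R n @^-1` obox a b)).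
rewrite (_ : _ @^-1` _ = `]a ord0, b ord0[%classic `*`
    obox (fun i => a (lift ord0 i)) (fun i => b (lift ord0 i))).
  rewrite product_measure1E//; last exact: measurable_obox.
  rewrite big_ord_recl EFinM; congr (_ * _)%E; last exact: IH.
  rewrite /= lebesgue_measure_itv/= lte_fin.
  by case: ltP => ab; rewrite ?EFinB -?EFinB; congr EFin; [rewrite max_r|rewrite max_l];
    rewrite // ?subr_ge0 ?subr_le0// ltW.
apply/seteqP; split => -[x v] /=.
  move=> H; split; first by have := H ord0; rewrite row_cons0.
  by move=> i; have := H (lift ord0 i); rewrite row_consS.
move=> [H1 H2] i; case: (unliftP ord0 i) => [j|] ->.
  by rewrite row_consS; exact: H2.
by rewrite row_cons0.
Qed.

Variable n : nat.
Implicit Types (h x : 'rV[R]_n).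

Lemma measurable_shift h : measurable_fun setT (fun z : 'rV[R]_n => z + h).
Proof.
apply/measurable_fun_coordP => i; under eq_fun do rewrite mxE.
by apply: measurable_funD => //; exact: measurable_coord.
Qed.

Lemma lebesgue_rV_shift h (A : set 'rV[R]_n) : measurable A ->
  mu [set z | A (z + h)] = mu A.
Proof.
pose m := [the {measure set 'rV[R]_n -> \bar R} of
  pushforward mu (fun z : 'rV[R]_n => z + h)].
move=> mA; rewrite -[LHS]/(m (measurable_shift h) A).
apply: (@measure_unique_obox _ _ (m (measurable_shift h)) (@lebesgue_rV R n)) => // a b.
  rewrite /m/= /pushforward (_ : _ @^-1` _ =
      obox (fun i => a i - h ord0 i) (fun i => b i - h ord0 i)).
    rewrite !lebesgue_rV_obox; congr EFin; apply: eq_bigr => i _.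
    by congr Num.max; rewrite opprB addrA subrK.
  apply/seteqP; split => z /= H i; have := H i.
    by rewrite !in_itv/= !mxE ltrBlDr ltrBrDr.
  by rewrite !in_itv/= !mxE ltrBlDr ltrBrDr.
rewrite /m/= /pushforward (_ : _ @^-1` _ =
      obox (fun i => a i - h ord0 i) (fun i => b i - h ord0 i)).
  by rewrite lebesgue_rV_obox ltry.
apply/seteqP; split => z /= H i; have := H i.
  by rewrite !in_itv/= !mxE ltrBlDr ltrBrDr.
by rewrite !in_itv/= !mxE ltrBlDr ltrBrDr.
Qed.

Lemma ge0_integral_shift h (D : set 'rV[R]_n) (f : 'rV[R]_n -> \bar R) :
  measurable D -> measurable_fun D f -> {in D, forall y, 0 <= f y}%E ->
  (\int[mu]_(z in [set z | D (z + h)%R]) f (z + h)%R = \int[mu]_(z in D) f z)%E.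
Proof.
move=> mD mf f0.
rewrite -[LHS](ge0_integral_pushforward (measurable_shift h) mu mD mf f0).
pose m := [the {measure set 'rV[R]_n -> \bar R} of
  pushforward mu (fun z : 'rV[R]_n => z + h)].
apply: (@eq_measure_integral _ _ _ _ (@lebesgue_rV R n)
  (m (measurable_shift h))) => A mA AD.
exact: lebesgue_rV_shift.
Qed.

Lemma lebesgue_eball_le x (r : R) : 0 <= r ->
  (mu (eball x r) <= ((2 * r) ^+ n)%:E)%E.
Proof.
move=> r0; apply: (@le_trans _ _ (mu (obox (fun i => x ord0 i - r) (fun i => x ord0 i + r)))).
  apply: le_measure; rewrite ?inE; [exact: measurable_eball|exact: measurable_obox|].
  move=> y; rewrite /eball/= => xy i.
  have := le_lt_trans (coord_le_enorm (y - x) i) xy.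
  by rewrite !mxE ltr_norml in_itv/= => /andP[h1 h2]; apply/andP; split; lra.
rewrite lebesgue_rV_obox lee_fin (eq_bigr (fun=> 2 * r)).
  by rewrite prodr_const card_ord.
by move=> i _; rewrite max_r; lra.
Qed.

(** The inscribed cube has half-side r/n because the Euclidean norm is at most the sum of the n
    absolute coordinates. This crude volume is the origin of the powers of n in [poincare_cst]. *)
Lemma lebesgue_eball_ge x (r : R) : (0 < n)%N -> 0 < r ->
  (((2 * r / n%:R) ^+ n)%:E <= mu (eball x r))%E.
Proof.
move=> n0 r0; have rn : 0 < r / n%:R by rewrite divr_gt0// ltr0n.
apply: (@le_trans _ _ (mu (obox (fun i => x ord0 i - r / n%:R)
                                (fun i => x ord0 i + r / n%:R)))).
  rewrite lebesgue_rV_obox lee_fin (eq_bigr (fun=> 2 * r / n%:R)).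
    by rewrite prodr_const card_ord.
  by move=> i _; rewrite max_r; lra.
apply: le_measure; rewrite ?inE; [exact: measurable_obox|exact: measurable_eball|].
move=> y xy; rewrite /eball/=; apply: le_lt_trans (enorm_le_sum _) _.
have -> : r = \sum_(i < n) r / n%:R.
  by rewrite sumr_const card_ord -[RHS]mulr_natr divfK// pnatr_eq0 -lt0n.
apply: ltr_sum; first by apply/hasP; exists (Ordinal n0) => //; exact: mem_index_enum.
move=> i _; rewrite !mxE ltr_norml; have := xy i; rewrite in_itv/= => /andP[h1 h2].
by apply/andP; split; lra.
Qed.

End lebesgue_rV_theory.

(** * Smooth bumps *)

Section smooth1.
Context {R : realType}.
Implicit Types (f g : R -> R) (p : {poly R}).

(** Smoothness is set up by recursion on the order, with the derivative as a witness, so that its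
    stability under sums, products and affine substitutions is an induction on [k]. *)
Fixpoint cdiff k f : Prop := if k is k'.+1 then
  exists2 f' : R -> R, forall x : R, is_derive x (1 : R) f (f' x) & cdiff k' f' else True.

Definition smooth1 f := forall k, cdiff k f.

Lemma cdiffS k f : cdiff k.+1 f -> cdiff k f.
Proof.
elim: k f => [//|k IH] f [f' ff' /IH ?]; by exists f'.
Qed.

Lemma cdiffD k f g : cdiff k f -> cdiff k g -> cdiff k (fun x => f x + g x).
Proof.
elim: k f g => [//|k IH] f g [f' ff' kf'] [g' gg' kg'].
exists (fun x => f' x + g' x); last exact: IH.
by move=> x; exact: is_deriveD.
Qed.

Lemma cdiffM k f g : cdiff k f -> cdiff k g -> cdiff k (fun x => f x * g x).
Proof.
elim: k f g => [//|k IH] f g kf kg; move: (kf) (kg) => [f' ff' kf'] [g' gg' kg'].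
exists (fun x => f x * g' x + g x * f' x); last first.
  by apply: cdiffD; apply: IH => //; exact: cdiffS.
by move=> x; exact: is_deriveM.
Qed.

Lemma smooth1M f g : smooth1 f -> smooth1 g -> smooth1 (fun x => f x * g x).
Proof. by move=> sf sg k; exact: cdiffM. Qed.

Lemma smooth1_is_derive f (x : R) : smooth1 f -> is_derive x (1 : R) f ((derive1 f) x).
Proof.
by move=> /(_ 1%N)[f' /(_ x) ff' _]; rewrite derive1E; apply: derivableP; case: ff'.
Qed.

Lemma smooth1_derive1 f : smooth1 f -> smooth1 (derive1 f).
Proof.
move=> sf k; have [f' ff' kf'] := sf k.+1.
suff -> : (derive1 f) = f' by [].
by apply/funext => x; rewrite derive1E; case: (ff' x).
Qed.

Lemma is_derive1_continuous f (x a : R) : is_derive x (1 : R) f a -> {for x, continuous f}.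
Proof. by move=> [? _]; exact/differentiable_continuous/derivable1_diffP. Qed.

Lemma smooth1_continuous f : smooth1 f -> continuous f.
Proof. by move=> sf x; apply: is_derive1_continuous; exact: smooth1_is_derive. Qed.

Lemma is_derive_affine (k c x : R) : is_derive x (1 : R) (fun t => k * t + c) k.
Proof.
have -> : (fun t => k * t + c) = horner (k%:P * 'X + c%:P).
  by apply/funext => t; rewrite !hornerE.
apply: (is_derive_eq (is_derive_poly _ _)).
by rewrite derivD derivM !derivC derivX mul0r add0r mulr1 addr0 hornerC.
Qed.

Lemma smooth1_affine f (k c : R) : smooth1 f -> smooth1 (fun t => f (k * t + c)).
Proof.
move=> sf m; elim: m f sf => [//|m IH] f sf.
exists (fun t => k * (derive1 f) (k * t + c)).
  move=> x; rewrite mulrC.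
  apply: (@is_derive1_comp _ f (fun t => k * t + c)); last exact: is_derive_affine.
  exact: smooth1_is_derive.
apply: cdiffM; last exact/IH/smooth1_derive1.
case: m {IH} => //= m; exists (fun=> 0); first by move=> x; exact: is_derive_cst.
elim: m => //= m IH; exists (fun=> 0) => //; by move=> x; exact: is_derive_cst.
Qed.

(* Differentiation maps this family into itself: the derivative of
   p(1/x) exp(-1/x) is q(1/x) exp(-1/x) with q = X^2 (p - p'). *)
Definition pexp p (x : R) := if 0 < x then p.[x^-1] * expR (- x^-1) else 0.

Lemma horner_le p : exists2 C, 0 <= C &
  forall y, 1 <= y -> `|p.[y]| <= C * y ^+ size p.
Proof.
exists (\sum_(i < size p) `|p`_i|); first exact: sumr_ge0.
move=> y y1; rewrite horner_coef mulr_suml.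
apply: le_trans (ler_norm_sum _ _ _) _; apply: ler_sum => i _.
rewrite normrM ler_wpM2l// normrX ger0_norm ?(le_trans ler01)//.
by apply: ler_weXn2l => //; exact: ltnW.
Qed.

(** With m the size of p, the term of degree m + 2 of the exponential series gives exp(1/x) >=
    x^-(m+2) / (m+2)!, while |p(1/x)| is at most C x^-m. What remains is quadratic at 0, enough for
    a zero derivative there. *)
Lemma pexp_le p : exists2 C, 0 <= C &
  forall x, `|x| <= 1 -> `|pexp p x| <= C * `|x| ^+ 2.
Proof.
have [C C0 pC] := horner_le p.
exists (C * (size p).+2`!%:R); first by rewrite mulr_ge0.
move=> x; rewrite /pexp; case: ifPn => [x0|]; last first.
  by rewrite normr0 => _ _; rewrite mulr_ge0// mulr_ge0.
rewrite gtr0_norm// => x1.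
have y1 : 1 <= x^-1 by rewrite invf_ge1.
have y0 : 0 < x^-1 by rewrite invr_gt0.
rewrite normrM (ger0_norm (expR_ge0 _)) expRN.
have H := expR_ge1Dxn (size p).+1 (ltW y0).
set m := size p in H pC *.
have F0 : 0 < m.+2`!%:R :> R by rewrite ltr0n fact_gt0.
have H' : x^-1 ^+ m.+2 / m.+2`!%:R <= expR x^-1 by apply: le_trans H; rewrite lerDr.
rewrite ler_pdivrMr ?expR_gt0//.
apply: le_trans (pC _ y1) _.
have -> : C * x^-1 ^+ m = C * m.+2`!%:R * x ^+ 2 * (x^-1 ^+ m.+2 / m.+2`!%:R).
  rewrite -addn2 exprD exprVn; field.
  by rewrite addn2 gt_eqF//= gt_eqF//= expf_neq0// gt_eqF.
by rewrite ler_wpM2l// !mulr_ge0// ltW.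
Qed.

Lemma is_derive_pexp p (x : R) : is_derive x (1 : R) (pexp p) (pexp ('X^2 * (p - p^`())) x).
Proof.
have [x0|x0|->] := ltgtP x 0.
- have -> q : pexp q x = 0 by rewrite /pexp ltNge (ltW x0).
  apply: (@near_eq_is_derive _ _ _ (cst 0)).
  near=> y; rewrite /pexp ltNge (_ : y <= 0)//; apply: ltW.
  by near: y; apply: open_nbhs_nbhs; split => //; exact: open_lt.
- have -> q : pexp q x = q.[x^-1] * expR (- x^-1) by rewrite /pexp x0.
  have xn0 : x != 0 by rewrite gt_eqF.
  have dV : is_derive x (1 : R) (fun y : R => y^-1) (- x ^- 2).
    rewrite -[X in is_derive _ _ _ X]mulr1.
    by apply: (@is_deriveV _ id) => //; exact: is_derive_id.
  have d1 := @is_derive1_comp _ (horner p) (fun y => y^-1) x _ _ (is_derive_poly p _) dV.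
  have d2 := @is_derive1_comp _ expR (fun y => - y^-1) x _ _ (is_derive_expR _) (is_deriveN dV).
  have d3 := is_deriveM d1 d2.
  apply: (near_eq_is_derive _ (is_derive_eq d3 _)); last first.
    by rewrite /= !hornerE /GRing.scale/= -exprVn; ring.
  near=> y; rewrite /pexp (_ : 0 < y)//.
  by near: y; apply: open_nbhs_nbhs; split => //; exact: open_gt.
- have -> q : pexp q 0 = 0 by rewrite /pexp ltxx.
  (* The slope at 0 is [pexp p z / z]; the quadratic bound makes it continuous at 0, where division
     by 0 already gives the expected value 0. *)
  apply/is_derive1_caratheodory.
  exists (fun z => pexp p z / z); split => //.
  + move=> z; rewrite {2}/pexp ltxx !subr0.
    have [->|z0] := eqVneq z 0; first by rewrite /pexp ltxx mulr0.
    by rewrite divfK.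
  + rewrite /prop_for /continuous_at /= invr0 mulr0.
    have [C C0 H] := pexp_le p.
    apply/cvgrPdist_le => e e0; near=> z.
    rewrite sub0r normrN normrM normfV.
    have [->|z0] := eqVneq z 0; first by rewrite normr0 invr0 mulr0 ltW.
    rewrite ler_pdivrMr ?normr_gt0//.
    apply: le_trans (H _ _) _.
      by near: z; exact: (@nbhs0_le R R^o).
    rewrite expr2 mulrA ler_wpM2r//.
    apply: le_trans (_ : (C + 1) * `|z| <= _); first by rewrite ler_wpM2r// lerDl.
    rewrite mulrC -ler_pdivlMr ?ltr_pwDr//.
    by near: z; apply: (@nbhs0_le R R^o); rewrite divr_gt0// ltr_pwDr.
  + by rewrite invr0 mulr0.
Unshelve. all: end_near. Qed.

Lemma smooth1_pexp p : smooth1 (pexp p).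
Proof.
move=> k; elim: k p => [//|k IH] p.
by exists (pexp ('X^2 * (p - p^`()))) => // x; exact: is_derive_pexp.
Qed.

(** For t > 0 the numbers exp(-1/((k+1) t)) tend to 1, so with growing [k] these smooth functions,
    bounded by 1 and vanishing off []a, b[], converge pointwise to the indicator of []a, b[]. *)
Definition bump (k : nat) (a b x : R) : R :=
  pexp 1 (k.+1%:R * (x - a)) * pexp 1 (k.+1%:R * (b - x)).

Lemma smooth1_bump k a b : smooth1 (bump k a b).
Proof.
apply: smooth1M.
  rewrite (_ : (fun x => _) = (fun x => pexp 1 (k.+1%:R * x + - (k.+1%:R * a)))).
    by apply: smooth1_affine; exact: smooth1_pexp.
  by apply/funext => x; rewrite mulrBr.
rewrite (_ : (fun x => _) = (fun x => pexp 1 (- k.+1%:R * x + k.+1%:R * b))).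
  by apply: smooth1_affine; exact: smooth1_pexp.
by apply/funext => x; rewrite mulrBr addrC mulNr.
Qed.

Lemma pexp1_ge0 (x : R) : 0 <= pexp 1 x.
Proof. by rewrite /pexp; case: ifP => //; rewrite hornerE mul1r expR_ge0. Qed.

Lemma pexp1_le1 (x : R) : pexp 1 x <= 1.
Proof.
rewrite /pexp; case: ifP => // x0; rewrite hornerE mul1r -[leRHS]expR0 ler_expR.
by rewrite oppr_le0 invr_ge0 ltW.
Qed.

Lemma bump_ge0 k a b x : 0 <= bump k a b x.
Proof. by rewrite mulr_ge0// pexp1_ge0. Qed.

Lemma bump_le1 k a b x : bump k a b x <= 1.
Proof. by rewrite mulr_ile1 ?pexp1_ge0 ?pexp1_le1. Qed.

Lemma bump_out k a b x : x \notin `]a, b[ -> bump k a b x = 0.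
Proof.
rewrite in_itv/= negb_and -!leNgt => /orP[xa|bx]; rewrite /bump /pexp.
  by rewrite pmulr_rgt0// subr_gt0 ltNge xa mul0r.
by rewrite [X in _ * X]ifF ?mulr0// pmulr_rgt0// subr_gt0 ltNge bx.
Qed.

Lemma pexp1_cvg (x : R) : 0 < x -> pexp 1 (k.+1%:R * x) @[k --> \oo] --> (1 : R).
Proof.
move=> x0; rewrite (_ : (fun k => _) = (fun k => expR (- (x^-1 * k.+1%:R^-1)))).
  rewrite -[X in _ --> X]expR0; apply: continuous_cvg; first exact: continuous_expR.
  rewrite -oppr0; apply: cvgN; rewrite -(mulr0 x^-1); apply: cvgMl_tmp.
  exact: cvg_harmonic.
apply/funext => k; rewrite /pexp pmulr_rgt0// x0 hornerE mul1r invfM.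
by rewrite mulrC.
Qed.

Lemma bump_cvg a b x : bump k a b x @[k --> \oo] --> ((x \in `]a, b[)%:R : R).
Proof.
case: (boolP (x \in `]a, b[)) => xab; last first.
  rewrite (_ : (fun k => _) = cst 0); first exact: cvg_cst.
  by apply/funext => k; rewrite bump_out.
rewrite -[X in _ --> X](mulr1 1).
move: xab; rewrite in_itv/= => /andP[ax xb].
by apply: cvgM; apply: pexp1_cvg; rewrite subr_gt0.
Qed.

End smooth1.

(** * Tensor products of one-variable functions as test functions *)

Section tensor.
Context {R : realType} {n : nat}.
Implicit Types (b : 'I_n -> R -> R) (z h v : 'rV[R]_n).

Definition tens b v : R := \prod_(i < n) b i (v ord0 i).

Definition tens_deriv b (i : 'I_n) : 'I_n -> R -> R :=
  fun j => if j == i then derive1 (b j) else b j.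

Lemma is_derive_prod (I : eqType) (r : seq I) (f : I -> R -> R) (df : I -> R)
    (t : R) : uniq r -> (forall i, is_derive t (1 : R) (f i) (df i)) ->
  is_derive t (1 : R) (fun s => \prod_(i <- r) f i s)
    (\sum_(i <- r) \prod_(j <- r) if j == i then df j else f j t).
Proof.
move=> + fd; elim: r => [_|a r IH /= /andP[ar ur]].
  rewrite big_nil (_ : (fun s => _) = cst 1); first exact: is_derive_cst.
  by apply/funext => s; rewrite big_nil.
rewrite (_ : (fun s => _) = (f a * (fun s => \prod_(i <- r) f i s))); last first.
  by apply/funext => s; rewrite big_cons.
apply: (is_derive_eq (is_deriveM (fd a) (IH ur))).
rewrite /GRing.scale/= big_cons big_cons eqxx addrC; congr (_ + _).
  rewrite mulrC; congr (_ * _); rewrite [LHS]big_seq [RHS]big_seq.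
  apply: eq_bigr => j jr; case: eqP => // ja.
  by move: ar; rewrite -ja jr.
rewrite mulr_sumr [LHS]big_seq [RHS]big_seq; apply: eq_bigr => i ir.
rewrite big_cons; case: eqP => // ai.
by move: ar; rewrite ai ir.
Qed.

Lemma is_derive_tens_line b z h (t : R) : (forall i, smooth1 (b i)) ->
  is_derive t (1 : R) (fun s => tens b (z + s *: h))
    (\sum_(i < n) h ord0 i * tens (tens_deriv b i) (z + t *: h)).
Proof.
move=> sb; rewrite /tens.
have H i : is_derive t (1 : R) (fun s => b i ((z + s *: h) ord0 i))
   (h ord0 i * derive1 (b i) ((z + t *: h) ord0 i)).
  rewrite (_ : (fun s => _) = b i \o (fun s => h ord0 i * s + z ord0 i)).
    have -> : (z + t *: h) ord0 i = h ord0 i * t + z ord0 i.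
      by rewrite !mxE addrC mulrC.
    rewrite mulrC; apply: is_derive1_comp; last exact: is_derive_affine.
    exact: smooth1_is_derive.
  by apply/funext => s; rewrite !mxE /= addrC mulrC.
apply: (is_derive_eq (is_derive_prod (index_enum_uniq _) H)).
apply: eq_bigr => i _; rewrite (bigD1 i)//= eqxx -mulrA; congr (_ * _).
rewrite [RHS](bigD1 i)//= /tens_deriv eqxx; congr (_ * _).
by apply: eq_bigr => j /negbTE ji; rewrite ji.
Qed.

Lemma is_derive_line (f : 'rV[R]_n -> R) v h (a : R) :
  is_derive (0 : R) (1 : R) (fun s : R => f (v + s *: h)) a ->
  derivable f v h /\ 'D_h f v = a.
Proof.
have E : (fun k : R => k^-1 *: ((f \o shift v) (k *: h) - f v)) =
   (fun k : R => k^-1 *: (((fun s : R => f (v + s *: h)) \o shift 0) k%:A -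
      (fun s : R => f (v + s *: h)) 0)).
  apply/funext => k; rewrite /= scale0r !addr0 [_%:A]mulr1.
  by rewrite [k *: h + v]addrC.
move=> [d1 d2]; split; first by rewrite /derivable E.
by rewrite /derive E.
Qed.

Lemma derivable_tens b i v : (forall i, smooth1 (b i)) ->
  derivable (tens b) v (delta_mx ord0 i).
Proof. by move=> sb; have [] := is_derive_line (is_derive_tens_line v (delta_mx ord0 i) 0 sb). Qed.

Lemma partial_tens b i : (forall i, smooth1 (b i)) ->
  partial i (tens b) = tens (tens_deriv b i).
Proof.
move=> sb; apply/funext => v; rewrite /partial.
have [_ ->] := is_derive_line (is_derive_tens_line v (delta_mx ord0 i) 0 sb).
rewrite (bigD1 i)//= mxE !eqxx mul1r scale0r addr0 big1 ?addr0// => j ji.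
by rewrite mxE (negbTE ji) mul0r.
Qed.

Lemma smooth1_tens_deriv b i : (forall i, smooth1 (b i)) ->
  forall j, smooth1 (tens_deriv b i j).
Proof. by move=> sb j; rewrite /tens_deriv; case: eqP => // _; exact: smooth1_derive1. Qed.

Lemma continuous_tens b : (forall i, smooth1 (b i)) -> continuous (tens b).
Proof.
move=> sb; rewrite /tens; elim: (index_enum _) => [|i r IH].
  rewrite (_ : (fun s => _) = cst 1); first exact: cst_continuous.
  by apply/funext => s; rewrite big_nil.
rewrite (_ : (fun s => _) = (fun v => b i (v ord0 i) * (\prod_(i <- r) b i (v ord0 i)))).
  move=> v; apply: continuousM; last exact: IH.
  apply: (@continuous_comp _ _ _ (fun v : 'rV[R]_n => v ord0 i) (b i)).
    exact: coord_continuous.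
  exact: smooth1_continuous.
by apply/funext => s; rewrite big_cons.
Qed.

(** A partial derivative of a tensor product is again a tensor product, so iterated partials never
    leave the class, and only continuity and differentiability of its members remain to be
    checked. *)
Lemma smooth_tens b : (forall i, smooth1 (b i)) -> smooth (tens b).
Proof.
move=> sb s; have [b' sb' ->] : exists2 b', forall i, smooth1 (b' i) &
    foldr partial (tens b) s = tens b'.
  elim: s => [|i s [b' sb' /= ->]]; first by exists b.
  by exists (tens_deriv b' i); [exact: smooth1_tens_deriv|rewrite partial_tens].
by split; [exact: continuous_tens|move=> i v; exact: derivable_tens].
Qed.

Lemma compact_cbox (a b : 'I_n -> R) : compact (cbox a b).
Proof.
apply: (@rV_compact R n (fun i => `[a i, b i]%classic)) => i.
exact: segment_compact.
Qed.

End tensor.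

Section supported.
Context {R : realType}.
Implicit Types (f : R -> R).

(** The interval is closed so that its complement is open and the derivative vanishes there as
    well. *)
Definition supported (a b : R) f := smooth1 f /\ forall x, x \notin `[a, b] -> f x = 0.

Lemma supported_derive1 a b f : supported a b f -> supported a b (derive1 f).
Proof.
move=> [sf f0]; split; first exact: smooth1_derive1.
move=> x xab; rewrite derive1E (@near_eq_derive _ _ _ f (cst 0)) ?derive_cst//.
have oC : open (~` `[a, b]%classic) by apply: closed_openC; exact: interval_closed.
have : nbhs x (~` `[a, b]%classic) by apply: open_nbhs_nbhs; split => //=; apply/negP.
by apply: filterS => y /= /negP yab; exact: f0.
Qed.

Lemma supported_bounded a b f : supported a b f -> exists2 M, 0 <= M & forall x, `|f x| <= M.
Proof.
move=> [/smooth1_continuous cf f0].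
have : compact [set f x | x in `[a, b]].
  apply: continuous_compact; last exact: segment_compact.
  exact: continuous_subspaceT.
move=> /compact_bounded[M [Mr HM]].
exists (`|M| + 1); first by rewrite addr_ge0.
move=> x; case: (boolP (x \in `[a, b])) => xab; last by rewrite f0// normr0 addr_ge0.
apply: HM; first by rewrite (le_lt_trans (ler_norm _))// ltrDl.
by exists x.
Qed.

Lemma supported_bump k a b : supported a b (bump k a b).
Proof.
split; first exact: smooth1_bump.
move=> x xab; apply: bump_out; apply: contra xab.
by rewrite !in_itv/= => /andP[/ltW -> /ltW ->].
Qed.

End supported.

Section tens_supported.
Context {R : realType} {n : nat}.
Variables (A B : 'I_n -> R) (b : 'I_n -> R -> R).
Hypothesis sb : forall i, supported (A i) (B i) (b i).
Implicit Types (z h v : 'rV[R]_n).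

Lemma supported_tens_deriv i j : supported (A j) (B j) (tens_deriv b i j).
Proof. by rewrite /tens_deriv; case: eqP => // _; exact: supported_derive1. Qed.

Lemma tens_bounded : exists2 M, 0 <= M & forall v, `|tens b v| <= M.
Proof.
have [M HM] : {M : 'I_n -> R & forall i, 0 <= M i /\ forall x, `|b i x| <= M i}.
  apply: (@choice _ _ (fun i M => 0 <= M /\ forall x, `|b i x| <= M)) => i.
  by have [M M0 H] := supported_bounded (sb i); exists M.
exists (\prod_i M i); first by apply: prodr_ge0 => i _; have [] := HM i.
move=> v; rewrite normr_prod; apply: ler_prod => i _.
by rewrite normr_ge0/=; have [_] := HM i; exact.
Qed.

Lemma tens_out v : ~ cbox A B v -> tens b v = 0.
Proof.
move=> /existsNP[i /negP vi]; rewrite /tens (bigD1 i)//= (sb i).2 ?mul0r//.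
Qed.

End tens_supported.

Section dtens.
Context {R : realType} {n : nat}.
Implicit Types (A B : 'I_n -> R) (b : 'I_n -> R -> R) (z h v : 'rV[R]_n).

(** The derivative of [tens b] at [v] in the direction [h]. *)
Definition dtens b h v : R := \sum_(i < n) h ord0 i * tens (tens_deriv b i) v.

Lemma dtens_bounded A B b h : (forall i, supported (A i) (B i) (b i)) ->
  exists2 M, 0 <= M & forall v, `|dtens b h v| <= M.
Proof.
move=> sb.
have [M HM] : {M : 'I_n -> R & forall i, 0 <= M i /\ forall x, `|tens (tens_deriv b i) x| <= M i}.
  apply: (@choice _ _ (fun i M => 0 <= M /\ forall x, `|tens (tens_deriv b i) x| <= M)) => i.
  by have [M M0 H] := tens_bounded (supported_tens_deriv sb i); exists M.
exists (\sum_i `|h ord0 i| * M i).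
  by apply: sumr_ge0 => i _; rewrite mulr_ge0//; have [] := HM i.
move=> v; apply: le_trans (ler_norm_sum _ _ _) _; apply: ler_sum => i _.
by rewrite normrM ler_wpM2l//; have [_] := HM i; exact.
Qed.

Lemma continuous_dtens b h : (forall i, smooth1 (b i)) -> continuous (dtens b h).
Proof.
move=> sb; rewrite /dtens; elim: (index_enum _) => [|i r IH].
  rewrite (_ : (fun s => _) = cst 0); first exact: cst_continuous.
  by apply/funext => s; rewrite big_nil.
rewrite (_ : (fun s => _) = (fun v => h ord0 i * tens (tens_deriv b i) v) +
   (fun v => \sum_(i <- r) h ord0 i * tens (tens_deriv b i) v)).
  move=> v; apply: continuousD; last exact: IH.
  apply: continuousM; first exact: cst_continuous.
  by apply: continuous_tens; exact: smooth1_tens_deriv.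
by apply/funext => s; rewrite big_cons.
Qed.

Definition shift_line h (p : R * 'rV[R]_n) : 'rV[R]_n := p.2 + p.1 *: h.

Lemma measurable_shift_line h : measurable_fun setT (shift_line h).
Proof.
apply/measurable_fun_coordP => i; under eq_fun do rewrite !mxE.
apply: measurable_funD.
  exact: measurableT_comp (measurable_coord i) measurable_snd.
by apply: measurable_funM => //; exact: measurable_fst.
Qed.

Lemma integral_shift h (f : 'rV[R]_n -> \bar R) : measurable_fun setT f ->
  (\int[@lebesgue_rV R n]_z f (z + h)%R = \int[@lebesgue_rV R n]_z f z)%E.
Proof.
move=> mf; rewrite integralE [RHS]integralE; congr (_ - _)%E.
  rewrite -[RHS](ge0_integral_shift h measurableT (measurable_funepos mf))//.
  by apply: eq_integral => z _; rewrite !funeposE.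
rewrite -[RHS](ge0_integral_shift h measurableT (measurable_funeneg mf))//.
by apply: eq_integral => z _; rewrite !funenegE.
Qed.

Lemma tens_line_FTC b z h (c : R) : (forall i, smooth1 (b i)) ->
  (\int[@lebesgue_measure R]_(t in `[0%R, 1%R]) (c * - dtens b h (z - t *: h))%:E =
   (c * (tens b (z - h) - tens b z))%:E)%E.
Proof.
move=> sb; pose F t := c * tens b (z + t *: (- h)).
have dF (t : R) : is_derive t (1 : R) F (c * - dtens b h (z - t *: h)).
  have := is_derive_tens_line z (- h) t sb => dl.
  have -> : F = c \*: (fun s => tens b (z + s *: - h)) by [].
  apply: (is_derive_eq (is_deriveZ c dl)).
  rewrite scalerN; congr (c * _); rewrite -sumrN; apply: eq_bigr => i _.
  by rewrite mxE mulNr.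
have cf : continuous (fun t : R => c * - dtens b h (z - t *: h)).
  move=> t; apply: (@continuousM _ _ (cst c) (fun t : R => - dtens b h (z - t *: h))).
    exact: cst_continuous.
  apply: (@continuousN _ _ _ (fun t : R => dtens b h (z - t *: h))).
  apply: (@continuous_comp _ _ _ (fun t : R => z - t *: h) (dtens b h)); last exact: continuous_dtens.
  apply: (@continuousB _ _ _ (cst z) (fun t : R => t *: h)); first exact: cst_continuous.
  by apply: continuousZ; [exact: cvg_id | exact: cst_continuous].
rewrite (@continuous_FTC2 _ (fun t : R => c * - dtens b h (z - t *: h)) F 0 1)//.
- by rewrite /F -EFinB -mulrBr !scale1r scale0r addr0.
- exact: continuous_subspaceT.
- split; first by move=> t _; case: (dF t).
  + by apply: cvg_at_right_filter; exact: is_derive1_continuous (dF _).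
  + by apply: cvg_at_left_filter; exact: is_derive1_continuous (dF _).
- by move=> t _; rewrite derive1E; case: (dF t).
Qed.

End dtens.

(** * Integrability on the strip [0, 1] x R^n *)

Section translation_test.
Context {R : realType} {n : nat}.
Implicit Types (b : 'I_n -> R -> R) (z h v : 'rV[R]_n) (U G : 'rV[R]_n -> R).
Local Notation mu := (@lebesgue_rV R n).
Local Notation la := (@lebesgue_measure R).

Definition unit_indic (t : R) : R := \1_(`[0, 1]%classic : set R) t.

Lemma unit_indic_ge0 t : 0 <= unit_indic t.
Proof. by rewrite /unit_indic indicE. Qed.

Lemma measurable_unit_indic : measurable_fun setT unit_indic.
Proof. exact: measurable_indic. Qed.

Lemma integral_unit_indic (f : R -> R) :
  (\int[la]_t (unit_indic t * f t)%:E = \int[la]_(t in `[0%R, 1%R]) (f t)%:E)%E.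
Proof.
rewrite [RHS]integral_mkcond; apply: eq_integral => t _.
rewrite patchE /unit_indic indicE; case: ifPn => _; first by rewrite mul1r.
by rewrite mul0r.
Qed.

Lemma measurable_EFin_fun (d : measure_display) (T : measurableType d) (f : T -> R) :
  measurable_fun setT f -> measurable_fun setT (fun x => (f x)%:E).
Proof. by move=> mf; exact/measurable_EFinP. Qed.

(** Only slices with t in [0, 1] contribute, so an L^1 bound on the slices that is uniform in t is
    enough for Fubini on the product. *)
Lemma integrable_strip (W : R * 'rV[R]_n -> R) (C : R) : measurable_fun setT W ->
  (forall t, \int[mu]_z `|W (t, z)|%:E <= (unit_indic t * C)%:E)%E ->
  (la \x mu)%E.-integrable setT (EFin \o W).
Proof.
move=> mW WC.
have mEW : measurable_fun setT (EFin \o W) by exact/measurable_EFinP.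
apply/(integrable12ltyP la mu mEW).
apply: (@le_lt_trans _ _ (\int[la]_t (unit_indic t * C)%:E)%E).
  apply: ge0_le_integral => //.
  - by move=> t _; exact: integral_ge0.
  - apply: (measurable_fun_fubini_tonelli_F (abse \o (EFin \o W))).
      exact: measurableT_comp.
    by move=> x; rewrite /= lee_fin.
  - by apply: measurable_EFin_fun; apply: measurable_funM => //; exact: measurable_unit_indic.
  - by move=> t _; exact: WC.
have /= -> := integral_unit_indic (cst C); rewrite integral_cst//= lebesgue_measure_itv/=.
by rewrite lte_fin ltr01 -EFinB -EFinM ltry.
Qed.

Lemma measurable_shift_comp h (d : measure_display) (T : measurableType d)
  (f : 'rV[R]_n -> T) : measurable_fun setT f ->
  measurable_fun setT (fun p : R * 'rV[R]_n => f (p.2 + p.1 *: h)).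
Proof. by move=> mf; exact: measurableT_comp mf (measurable_shift_line h). Qed.

Lemma measurable_snd_comp (d : measure_display) (T : measurableType d)
  (f : 'rV[R]_n -> T) : measurable_fun setT f ->
  measurable_fun setT (fun p : R * 'rV[R]_n => f p.2).
Proof. by move=> mf; exact: measurableT_comp mf measurable_snd. Qed.

Lemma measurable_fst_unit : measurable_fun setT (fun p : R * 'rV[R]_n => unit_indic p.1).
Proof. exact: measurableT_comp measurable_unit_indic measurable_fst. Qed.

Section strip.
Variables (F P : 'rV[R]_n -> R) (h : 'rV[R]_n) (M : R).
Hypotheses (mF : measurable_fun setT F) (mP : measurable_fun setT P).
Hypotheses (iF : mu.-integrable setT (EFin \o F)).
Hypotheses (M0 : 0 <= M) (PM : forall v, `|P v| <= M).

Let C := M * fine (\int[mu]_z `|F z|%:E).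

Let CE (c : R) : 0 <= c ->
  ((c * C)%:E = \int[mu]_z (c * (M * `|F z|))%:E)%E.
Proof.
move=> c0; rewrite /C mulrA EFinM fineK; last first.
  by have := integrable_fin_num measurableT (integrable_norm iF).
rewrite -ge0_integralZl_EFin ?mulr_ge0//.
  by apply: eq_integral => z _; rewrite -EFinM mulrA.
by apply: measurable_EFin_fun; exact: measurableT_comp.
Qed.

Lemma integrable_strip_shiftr : (la \x mu)%E.-integrable setT
  (fun p => (unit_indic p.1 * (F p.2 * P (p.2 + p.1 *: h)))%:E).
Proof.
apply: (@integrable_strip _ C).
  apply: measurable_funM; first exact: measurable_fst_unit.
  by apply: measurable_funM; [exact: measurable_snd_comp|exact: measurable_shift_comp].
move=> t /=; rewrite CE ?unit_indic_ge0//.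
apply: ge0_le_integral => //.
- apply: measurable_EFin_fun; apply: measurableT_comp => //.
  apply: measurable_funM => //; apply: measurable_funM => //.
  exact: measurableT_comp mP (measurable_shift _).
- apply: measurable_EFin_fun; apply: measurable_funM => //.
  by apply: measurable_funM => //; exact: measurableT_comp.
- move=> z _; rewrite lee_fin !normrM ger0_norm ?unit_indic_ge0//.
  by rewrite ler_wpM2l ?unit_indic_ge0// mulrC ler_wpM2r.
Qed.

Lemma integrable_strip_shiftl : (la \x mu)%E.-integrable setT
  (fun p => (unit_indic p.1 * (F (p.2 + p.1 *: h) * P p.2))%:E).
Proof.
apply: (@integrable_strip _ C).
  apply: measurable_funM; first exact: measurable_fst_unit.
  by apply: measurable_funM; [exact: measurable_shift_comp|exact: measurable_snd_comp].
move=> t /=; rewrite CE ?unit_indic_ge0//.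
rewrite -(integral_shift (t *: h)); last first.
  apply: measurable_EFin_fun; apply: measurable_funM => //.
  by apply: measurable_funM => //; exact: measurableT_comp.
apply: ge0_le_integral => //.
- apply: measurable_EFin_fun; apply: measurableT_comp => //.
  apply: measurable_funM => //; apply: measurable_funM => //.
  exact: measurableT_comp mF (measurable_shift _).
- apply: measurable_EFin_fun; apply: measurable_funM => //.
  apply: measurable_funM => //; apply: measurableT_comp => //.
  exact: measurableT_comp mF (measurable_shift _).
- move=> z _; rewrite lee_fin !normrM ger0_norm ?unit_indic_ge0//.
  by rewrite ler_wpM2l ?unit_indic_ge0// mulrC ler_wpM2r.
Qed.

Lemma integrable_mul_bounded : mu.-integrable setT (fun z => (F z * P z)%:E).
Proof.
apply: (le_integrable _ _ _ (integrableZl measurableT M (integrable_norm iF))) => //.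
  by apply: measurable_EFin_fun; exact: measurable_funM.
move=> z _; rewrite /= lee_fin normrM [leRHS]ger0_norm ?mulr_ge0//.
by rewrite mulrC ler_wpM2r.
Qed.

End strip.
End translation_test.

(** * Translation formula for weakly differentiable functions *)

Section translation_formula.
Context {R : realType} {n : nat}.
Implicit Types (b : 'I_n -> R -> R) (A B : 'I_n -> R) (z h v : 'rV[R]_n).
Local Notation mu := (@lebesgue_rV R n).
Local Notation la := (@lebesgue_measure R).

Section test.
Variables (U G : 'rV[R]_n -> R) (h : 'rV[R]_n) (A B : 'I_n -> R).
Hypotheses (mU : measurable_fun setT U) (mG : measurable_fun setT G).
Hypotheses (iU : mu.-integrable setT (EFin \o U)) (iG : mu.-integrable setT (EFin \o G)).
Variable b : 'I_n -> R -> R.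
Hypothesis sb : forall i, supported (A i) (B i) (b i).
Hypothesis weak : forall t : R, 0 <= t <= 1 ->
  (\int[mu]_z (U z * dtens b h (z - t *: h))%:E =
   - \int[mu]_z (G z * tens b (z - t *: h))%:E)%E.

Let sm i : smooth1 (b i). Proof. exact: (sb i).1. Qed.

Let mtens : measurable_fun setT (tens b).
Proof. by apply: continuous_measurable_rV; exact: continuous_tens. Qed.

Let mdtens : measurable_fun setT (dtens b h).
Proof. by apply: continuous_measurable_rV; exact: continuous_dtens. Qed.

Let mu_integrable_dtens (t : R) :
  mu.-integrable setT (fun z => (U z * dtens b h (z - t *: h))%:E).
Proof.
have [M M0 HM] := dtens_bounded h sb.
apply: (integrable_mul_bounded (M := M)) => //.
exact: measurableT_comp mdtens (measurable_shift _).
Qed.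

Let step1 : (\int[mu]_y (U (y + h) * tens b y - U y * tens b y)%:E =
  \int[mu]_z (U z * (tens b (z - h) - tens b z))%:E)%E.
Proof.
have [M M0 HM] := tens_bounded sb.
have i1 : mu.-integrable setT (fun y => (U (y + h) * tens b y)%:E).
  apply/integrableP; split.
    apply: measurable_EFin_fun; apply: measurable_funM => //.
    exact: measurableT_comp mU (measurable_shift _).
  have i2 : mu.-integrable setT (fun z => (U z * tens b (z - h))%:E).
    apply: (integrable_mul_bounded (M := M)) => //.
    exact: measurableT_comp mtens (measurable_shift _).
  have /integrableP[m2 i2'] := i2.
  rewrite -(integral_shift h) in i2'; last exact: measurableT_comp.
  by under eq_integral do rewrite -[X in _ * tens b X](addrK h).
have i0 : mu.-integrable setT (fun y => (U y * tens b y)%:E).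
  exact: (integrable_mul_bounded (M := M)).
have i3 : mu.-integrable setT (fun z => (U z * tens b (z - h))%:E).
  apply: (integrable_mul_bounded (M := M)) => //.
  exact: measurableT_comp mtens (measurable_shift _).
rewrite integralB_EFin//.
under [RHS]eq_integral do rewrite mulrBr.
rewrite integralB_EFin//; congr (_ - _)%E.
rewrite -[RHS](integral_shift h); last exact: measurable_int i3.
by apply: eq_integral => z _; rewrite addrK.
Qed.

(** Moving the translation onto the test function turns the difference of [U] into U(z) times
    [tens b (z - h) - tens b z], which is the integral of a derivative along the segment from z to z
    - h. For each fixed t the weak identity trades this derivative for [G]; the translation by t h
    is then undone. Fubini is used once on each side. *)
Lemma translation_test :
  (\int[mu]_y (U (y + h) * tens b y - U y * tens b y)%:E =
   \int[mu]_y \int[la]_t (unit_indic t * (G (y + t *: h) * tens b y))%:E)%E.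
Proof.
have [M M0 HM] := tens_bounded sb.
have [N N0 HN] := dtens_bounded h sb.
rewrite step1.
have iL : (la \x mu)%E.-integrable setT
    (fun p => (unit_indic p.1 * (U p.2 * - dtens b h (p.2 + p.1 *: - h)))%:E).
  apply: (@integrable_strip_shiftr _ _ U (fun v => - dtens b h v) (- h) N) => //.
    exact: measurableT_comp.
  by move=> v; rewrite normrN.
have iR : (la \x mu)%E.-integrable setT
    (fun p => (unit_indic p.1 * (G (p.2 + p.1 *: h) * tens b p.2))%:E).
  exact: (@integrable_strip_shiftl _ _ G (tens b) h M).
transitivity (\int[mu]_z \int[la]_t
    (unit_indic t * (U z * - dtens b h (z + t *: - h)))%:E)%E.
  apply: eq_integral => z _; rewrite -tens_line_FTC// -integral_unit_indic.
  by under [RHS]eq_integral do rewrite scalerN.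
rewrite -(Fubini iL) -(Fubini iR); apply: eq_integral => t _ /=.
have [t01|t01] := boolP (t \in `[0, 1]); last first.
  have t0 : unit_indic t = 0 by rewrite /unit_indic indicE memNset//; exact/negP.
  by under eq_integral do rewrite t0 mul0r; under [RHS]eq_integral do rewrite t0 mul0r.
have t1 : unit_indic t = 1 by rewrite /unit_indic indicE mem_set.
transitivity (\int[mu]_z (G z * tens b (z - t *: h))%:E)%E.
  under eq_integral do rewrite t1 mul1r scalerN mulrN -mulN1r EFinM.
  rewrite (integralZl measurableT (mu_integrable_dtens t)).
  rewrite weak; first by rewrite EFinN mulN1e oppeK.
  by move: t01; rewrite in_itv.
rewrite -[LHS](integral_shift (t *: h)).
  by apply: eq_integral => z _; rewrite addrK t1 mul1r.
apply: measurable_EFin_fun; apply: measurable_funM => //.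
exact: measurableT_comp mtens (measurable_shift _).
Qed.

End test.
End translation_formula.

(** * Distance to a closed set and segments that miss it *)

Section dist_to_theory.
Context {R : realType} {n : nat}.
Implicit Types (x y z h : 'rV[R]_n) (E : set 'rV[R]_n).

Let dist_lbound E z : has_lbound [set enorm (z - y) | y in E].
Proof. by exists 0 => _ [y _ <-]; exact: enorm_ge0. Qed.

Lemma dist_to_le E z y : E y -> dist_to E z <= enorm (z - y).
Proof. by move=> Ey; apply: ge_inf => //; exists y. Qed.

Lemma dist_to_ge E z (c : R) : E !=set0 -> (forall y, E y -> c <= enorm (z - y)) ->
  c <= dist_to E z.
Proof.
move=> [y Ey] H; apply: lb_le_inf; first by exists (enorm (z - y)), y.
by move=> _ [w Ew <-]; exact: H.
Qed.

Lemma dist_to_lipschitz E x y : E !=set0 -> dist_to E x <= dist_to E y + enorm (x - y).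
Proof.
move=> E0; rewrite -lerBlDr; apply: dist_to_ge => // w Ew.
rewrite lerBlDr addrC; apply: le_trans (dist_to_le x Ew) _; exact: ler_enormBD.
Qed.

Lemma continuous_dist_to E : E !=set0 -> continuous (dist_to E).
Proof.
move=> E0; apply: (@continuous_lipschitz_enorm _ _ _ 1) => // x y.
rewrite mul1r ler_norml; apply/andP; split.
  by rewrite lerNl opprB lerBlDl enormB dist_to_lipschitz.
by rewrite lerBlDl dist_to_lipschitz.
Qed.

Lemma dist_to_gt0 E z : E !=set0 -> closed E -> ~ E z -> 0 < dist_to E z.
Proof.
move=> E0 cE Ez; have : nbhs z (~` E).
  by apply: open_nbhs_nbhs; split => //; exact: closed_openC.
move=> /nbhs_obox[e e0 eE]; apply: (lt_le_trans e0).
apply: dist_to_ge => // y Ey; rewrite leNgt; apply/negP => zy.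
apply: (eE y) => // i; have := le_lt_trans (coord_le_enorm (z - y) i) zy.
by rewrite !mxE ltr_norml in_itv/= => /andP[h1 h2]; apply/andP; split; lra.
Qed.

Definition seg_free E h := [set z | forall t : R, 0 <= t <= 1 -> ~ E (z + t *: h)].

Lemma continuous_line z h : continuous (fun t : R => z + t *: h).
Proof.
move=> t; apply: (@continuousD _ _ _ (cst z) (fun t : R => t *: h)).
  exact: cst_continuous.
by apply: continuousZ; [exact: cvg_id | exact: cst_continuous].
Qed.

(** The distance to [E] attains a positive minimum along the compact segment, and moving the segment
    by less than this minimum keeps it off [E]. *)
Lemma open_seg_free E h : E !=set0 -> closed E -> open (seg_free E h).
Proof.
move=> E0 cE; rewrite openE => z zE; rewrite /interior.
have cf : continuous (fun t : R => dist_to E (z + t *: h)).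
  move=> t; apply: (@continuous_comp _ _ _ (fun t : R => z + t *: h) (dist_to E)).
    exact: continuous_line.
  exact: continuous_dist_to.
have [c c01 Hc] := EVT_min (@ler01 R) (continuous_subspaceT cf).
have : nbhs z (eball z (dist_to E (z + c *: h))).
  apply: open_nbhs_nbhs; split; first exact: eball_open.
  apply: eball_center; apply: dist_to_gt0 => //; apply: zE.
  by move: c01; rewrite in_itv.
apply: filterS => y; rewrite /eball/= => yz t t01 Et.
have := dist_to_le (z + t *: h) Et.
rewrite opprD addrACA subrr addr0 enormB leNgt => /negP; apply.
by apply: (lt_le_trans yz); apply: Hc; rewrite in_itv.
Qed.

(** All translates by t h, t in [0, 1], of a test function supported in the box live here. Cutting
    [u] and [g] off outside this compact set changes none of the tested integrals and makes them
    integrable on the whole space, where translations preserve integrals. *)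
Definition sweep (A B : 'I_n -> R) h :=
  [set y + t *: h | y in cbox A B & t in `[0, 1]%classic].

Lemma compact_sweep A B h : compact (sweep A B h).
Proof.
rewrite (_ : sweep A B h = [set shift_line h p | p in `[0, 1]%classic `*` cbox A B]).
  apply: continuous_compact; last first.
    by apply: compact_setX; [exact: segment_compact|exact: compact_cbox].
  apply: continuous_subspaceT => -[t z].
  apply: (@continuousD _ _ _ snd (fun p : R * 'rV[R]_n => p.1 *: h)).
    exact: cvg_snd.
  by apply: continuousZ; [exact: cvg_fst | exact: cst_continuous].
apply/seteqP; split => [_ [y By [t t01 <-]]|_ [[t y] [/= t01 By] <-]].
  by exists (t, y).
by exists y => //; exists t.
Qed.

Lemma sweep_sub E A B h : cbox A B `<=` seg_free E h -> sweep A B h `<=` ~` E.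
Proof. by move=> AB _ [y By [t /= t01 <-]]; apply: (AB _ By); rewrite in_itv in t01. Qed.

End dist_to_theory.

Section supported_more.
Context {R : realType} {n : nat}.

Lemma supportedW (a b a' b' : R) f : a' <= a -> b <= b' -> supported a b f ->
  supported a' b' f.
Proof.
move=> aa bb [sf f0]; split => // x xab; apply: f0; apply: contra xab.
by rewrite !in_itv/= => /andP[h1 h2]; rewrite (le_trans aa)// (le_trans h2).
Qed.

Lemma derive1_shift (f : R -> R) (c : R) : smooth1 f ->
  derive1 (fun s => f (s + c)) = (fun s => derive1 f (s + c)).
Proof.
move=> sf; apply/funext => x; rewrite derive1E.
have d1 := is_derive_affine 1 c x.
have d2 := @is_derive1_comp _ f (fun t => 1 * t + c) x _ _ (smooth1_is_derive _ sf) d1.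
have -> : (fun s => f (s + c)) = f \o (fun t => 1 * t + c).
  by apply/funext => s; rewrite /= mul1r.
by case: d2 => _ ->; rewrite mulr1 mul1r.
Qed.

Definition shift_fam (b : 'I_n -> R -> R) (v : 'rV[R]_n) : 'I_n -> R -> R :=
  fun i s => b i (s + v ord0 i).

Lemma smooth1_shift_fam b v : (forall i, smooth1 (b i)) ->
  forall i, smooth1 (shift_fam b v i).
Proof.
move=> sb i; rewrite /shift_fam (_ : (fun s => _) = (fun s => b i (1 * s + v ord0 i))).
  exact: smooth1_affine.
by apply/funext => s; rewrite mul1r.
Qed.

Lemma tens_shift b v z : tens (shift_fam b v) z = tens b (z + v).
Proof. by apply: eq_bigr => i _; rewrite mxE. Qed.

Lemma tens_deriv_shift b v i : (forall i, smooth1 (b i)) ->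
  tens_deriv (shift_fam b v) i = shift_fam (tens_deriv b i) v.
Proof.
move=> sb; apply/funext => j; rewrite /tens_deriv /shift_fam; case: eqP => // _.
exact: derive1_shift.
Qed.

Lemma tens_bump_cvg (a b : 'I_n -> R) (v : 'rV[R]_n) :
  tens (fun i => bump k (a i) (b i)) v @[k --> \oo] --> (\1_(obox a b) v : R).
Proof.
have -> : \1_(obox a b) v = \prod_(i < n) (v ord0 i \in `]a i, b i[)%:R :> R.
  rewrite indicE; have [/set_mem H|/negP H] := boolP (v \in obox a b).
    by rewrite big1// => i _; rewrite H.
  have /existsNP[i Hi] : ~ obox a b v by move=> h; apply: H; rewrite inE.
  by rewrite (bigD1 i)//= (negbTE (introN idP Hi)) mul0r.
rewrite /tens; elim: (index_enum _) => [|i r IH].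
  rewrite big_nil (_ : (fun k => _) = cst 1); first exact: cvg_cst.
  by apply/funext => k; rewrite big_nil.
rewrite big_cons (_ : (fun k => _) = (fun k => bump k (a i) (b i) (v ord0 i) *
    \prod_(j <- r) bump k (a j) (b j) (v ord0 j))).
  by apply: cvgM => //; exact: bump_cvg.
by apply/funext => k; rewrite big_cons.
Qed.

Lemma tens_bump_le1 (a b : 'I_n -> R) k (v : 'rV[R]_n) :
  `|tens (fun i => bump k (a i) (b i)) v| <= 1.
Proof.
rewrite normr_prod; apply: prodr_ile1 => i _.
by rewrite normr_ge0/= ger0_norm ?bump_ge0// bump_le1.
Qed.

End supported_more.

Section vanishing.
Context {R : realType} {n : nat}.
Local Notation mu := (@lebesgue_rV R n).
Implicit Types (A B a b : 'I_n -> R).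

(** The Borel sets over whose trace on the fixed box [f] has integral 0 form a Dynkin system; it
    contains the boxes, which are stable under intersection and generate. *)
Lemma ae_eq0_obox (f : 'rV[R]_n -> R) A B : mu.-integrable setT (EFin \o f) ->
  (forall a b, \int[mu]_(z in obox a b `&` obox A B) (f z)%:E = 0)%E ->
  {ae mu, forall z, obox A B z -> f z = 0}.
Proof.
move=> iF f0; set Q := obox A B.
have mQ : measurable Q by exact: measurable_obox.
have iX X : measurable X -> mu.-integrable X (EFin \o f).
  by move=> mX; apply: (integrableS measurableT mX).
have H : forall X, measurable X -> (\int[mu]_(z in X `&` Q) (f z)%:E = 0)%E.
  move=> X mX; move: (mX); rewrite measurable_rV_obox.
  move: X {mX}.
  apply: (dynkin_induction measurable_rV_obox).
  - by move=> _ _ [a [b ->]] [a' [b' ->]]; rewrite oboxI; do 2 eexists.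
  - by rewrite setTI -[Q]setIid; exact: f0.
  - by move=> _ [a [b ->]]; exact: f0.
  - move=> S mS S0.
    have : (\int[mu]_(z in (S `&` Q) `|` (~` S `&` Q)) (f z)%:E = 0)%E.
      by rewrite -setIUl setUv setTI -[Q]setIid; exact: f0.
    rewrite integral_setU ?S0 ?add0e//.
    + exact: measurableI.
    + by apply: measurableI => //; exact: measurableC.
    + by apply: measurable_funTS; exact: measurable_int iF.
    + by apply/disj_setPLR => z [Sz _] [/(_ Sz)].
  - move=> F mF tF F0; rewrite setI_bigcupl integral_bigcup.
    + by rewrite eseries0// => i _ _; exact: F0.
    + exact: trivIset_setIr.
    + by move=> k; exact: measurableI.
    + by apply: iX; apply: bigcupT_measurable => k; exact: measurableI.
have ae0 : ae_eq mu Q (EFin \o f) (cst 0%E).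
  apply: integral_ae_eq => //; first exact: iX.
  move=> E EQ mE; rewrite integral0 -(H E mE); congr integral.
  by rewrite setIidl.
apply: filterS ae0 => z /= zH Qz.
by have := zH Qz; move=> [].
Qed.

End vanishing.

Section measurable_enorm_restrict.
Context {R : realType} {n : nat}.

Lemma measurable_enorm_restrict (g : 'rV[R]_n -> 'rV[R]_n) (D : set 'rV[R]_n) :
  measurable D -> (forall i, measurable_fun D (fun z => g z ord0 i)) ->
  measurable_fun setT ((enorm \o g) \_ D).
Proof.
move=> mD mg.
rewrite (_ : _ \_ _ = enorm \o (fun z => \row_i ((fun z => g z ord0 i) \_ D) z)).
  apply: measurableT_comp.
    by apply: continuous_measurable_rV; exact: enorm_continuous.
  apply/measurable_fun_coordP => i; under eq_fun do rewrite mxE.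
  exact: (measurable_restrictT _ mD).1.
apply/funext => z; rewrite /= patchE; case: ifPn => zD.
  by congr enorm; apply/rowP => i; rewrite mxE patchE zD.
rewrite (_ : \row_i _ = 0) ?enorm0//.
by apply/rowP => i; rewrite !mxE patchE (negbTE zD).
Qed.

End measurable_enorm_restrict.

(** * The translation formula on a box whose segments miss the closed set *)

Section box_formula.
Context {R : realType} {n : nat}.
Local Notation mu := (@lebesgue_rV R n).
Local Notation la := (@lebesgue_measure R).
Variables (Gam : set 'rV[R]_n) (u : 'rV[R]_n -> R) (g : 'rV[R]_n -> 'rV[R]_n).
Variables (h : 'rV[R]_n) (A B : 'I_n -> R).
Hypothesis lu : locally_integrable_rV (~` Gam) u.
Hypothesis wg : weak_gradient (~` Gam) u g.
Hypothesis AB : cbox A B `<=` seg_free Gam h.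

Let K := sweep A B h.

Let KG : K `<=` ~` Gam. Proof. exact: sweep_sub. Qed.

Let mK : measurable K.
Proof.
apply: closed_measurable_rV; apply: compact_closed; first exact: norm_hausdorff.
exact: compact_sweep.
Qed.

Let U := u \_ K.
Let gh z := \sum_(i < n) h ord0 i * g z ord0 i.
Let G := gh \_ K.

Let loc_restrict (f : 'rV[R]_n -> R) : locally_integrable_rV (~` Gam) f ->
  measurable_fun setT (f \_ K) /\ mu.-integrable setT (EFin \o (f \_ K)).
Proof.
move=> [mf oG lf]; have mfK : measurable_fun K f.
  by apply: measurable_funS mf => //; exact: open_measurable_rV.
have iK : mu.-integrable K (EFin \o f).
  apply/integrableP; split; first exact/measurable_EFinP.
  by have /= := lf K KG (@compact_sweep _ _ _ _ _).
split; first exact: (measurable_restrictT f mK).1.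
by rewrite -restrict_EFin; exact: (integrable_mkcond _ mK).1.
Qed.

Let mU : measurable_fun setT U. Proof. exact: (loc_restrict lu).1. Qed.
Let iU : mu.-integrable setT (EFin \o U). Proof. exact: (loc_restrict lu).2. Qed.

Let GE z : G z = \sum_(i < n) h ord0 i * ((fun z => g z ord0 i) \_ K) z.
Proof.
rewrite /G patchE; case: ifPn => zK.
  by apply: eq_bigr => i _; rewrite patchE zK.
by rewrite big1// => i _; rewrite patchE (negbTE zK) mulr0.
Qed.

Let mG : measurable_fun setT G.
Proof.
rewrite (_ : G = fun z => \sum_(i < n) h ord0 i * ((fun z => g z ord0 i) \_ K) z).
  apply: measurable_sum => i; apply: measurable_funM => //.
  exact: (loc_restrict (wg.1 i)).1.
exact/funext.
Qed.

Let iG : mu.-integrable setT (EFin \o G).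
Proof.
rewrite (_ : EFin \o G = fun z => (\sum_(i < n)
    ((h ord0 i)%:E * (EFin \o ((fun z => g z ord0 i) \_ K)) z))%E).
  apply: integrable_sum => // i _; apply: integrableZl => //.
  exact: (loc_restrict (wg.1 i)).2.
by apply/funext => z; rewrite /= GE sumEFin.
Qed.

Section weak.
Variable b : 'I_n -> R -> R.
Hypothesis sb : forall i, supported (A i) (B i) (b i).

Let sm i : smooth1 (b i). Proof. exact: (sb i).1. Qed.

Let outK (t : R) z : 0 <= t <= 1 -> ~ K z -> ~ cbox A B (z - t *: h).
Proof.
move=> t01 Kz Bz; apply: Kz; exists (z - t *: h) => //.
by exists t; rewrite ?subrK//= in_itv.
Qed.

Let weak_coord (t : R) (i : 'I_n) : 0 <= t <= 1 ->
  (\int[mu]_z (U z * tens (tens_deriv b i) (z - t *: h))%:E =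
   - \int[mu]_z (((fun z => g z ord0 i) \_ K) z * tens b (z - t *: h))%:E)%E.
Proof.
move=> t01.
have sms : forall i, smooth1 (shift_fam b (- (t *: h)) i) by exact: smooth1_shift_fam.
have test : test_function (~` Gam) (tens (shift_fam b (- (t *: h)))).
  split; first exact: smooth_tens.
  exists K; split => //; first exact: compact_sweep.
  move=> z Kz; rewrite tens_shift; apply: (tens_out sb); exact: outK.
have := wg.2 _ test i.
have restr (f : 'rV[R]_n -> R) (c : 'I_n -> R -> R) :
    (forall i, supported (A i) (B i) (c i)) ->
    (\int[mu]_(z in ~` Gam) (f z * tens c (z - t *: h))%:E =
     \int[mu]_z ((f \_ K) z * tens c (z - t *: h))%:E)%E.
  move=> sc; rewrite integral_mkcond; apply: eq_integral => z _.
  rewrite !patchE; have [zK|/negP zK] := boolP (z \in K).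
    by rewrite mem_set//; apply: KG; rewrite inE in zK.
  rewrite mul0r; case: ifPn => // _.
  by rewrite (tens_out sc) ?mulr0//; apply: outK => //; rewrite inE in zK.
rewrite partial_tens//.
under eq_integral do rewrite tens_deriv_shift// tens_shift.
under [X in (_ = - X)%E]eq_integral do rewrite tens_shift.
by rewrite restr ?restr// => j; exact: supported_tens_deriv.
Qed.

Lemma weak_box (t : R) : 0 <= t <= 1 ->
  (\int[mu]_z (U z * dtens b h (z - t *: h))%:E =
   - \int[mu]_z (G z * tens b (z - t *: h))%:E)%E.
Proof.
move=> t01.
have mt c : (forall i, smooth1 (c i)) ->
    measurable_fun setT (fun z : 'rV[R]_n => tens c (z - t *: h)).
  move=> sc; apply: (measurableT_comp _ (measurable_shift _)).
  by apply: continuous_measurable_rV; exact: continuous_tens.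
have iD i : mu.-integrable setT (fun z => (U z * tens (tens_deriv b i) (z - t *: h))%:E).
  have [M M0 HM] := tens_bounded (supported_tens_deriv sb i).
  apply: (integrable_mul_bounded (M := M)) => //.
  by apply: mt; exact: smooth1_tens_deriv.
have iGi i : mu.-integrable setT
    (fun z => (((fun z => g z ord0 i) \_ K) z * tens b (z - t *: h))%:E).
  have [M M0 HM] := tens_bounded sb.
  have [mg ig] := loc_restrict (wg.1 i).
  by apply: (integrable_mul_bounded (M := M)) => //; exact: mt.
transitivity (\sum_(i < n) (h ord0 i)%:E *
    \int[mu]_z (U z * tens (tens_deriv b i) (z - t *: h))%:E)%E.
  under eq_bigr do rewrite -integralZl//.
  rewrite -integral_sum//; last by move=> i; exact: integrableZl.
  apply: eq_integral => z _; rewrite sumEFin; congr EFin.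
  by rewrite /dtens mulr_sumr; apply: eq_bigr => i _; ring.
have iGt : mu.-integrable setT (fun z => (G z * tens b (z - t *: h))%:E).
  have [M M0 HM] := tens_bounded sb.
  by apply: (integrable_mul_bounded (M := M)) => //; exact: mt.
under eq_bigr do rewrite weak_coord// muleN -mulNe -EFinN -(integralZl measurableT (iGi _)).
rewrite -integral_sum//; last by move=> i; exact: integrableZl.
rewrite -mulN1e -EFinN -(integralZl measurableT iGt); apply: eq_integral => z _.
rewrite sumEFin -EFinM; congr EFin; rewrite GE mulr_suml mulr_sumr.
by apply: eq_bigr => i _; ring.
Qed.

End weak.

Let iGp : (la \x mu)%E.-integrable setT
  (fun p => (unit_indic p.1 * (G (p.2 + p.1 *: h) * 1))%:E).
Proof.
by apply: (@integrable_strip_shiftl _ _ G (cst 1) h 1) => // v; rewrite normr1.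
Qed.

(** [fine] only alters inner integrals that are not finite, which by [H_ae] happens on a null set.
    The factor 1 is the bounded factor [cst 1] of [integrable_strip_shiftl]. *)
Let H y : R := fine (\int[la]_t (unit_indic t * (G (y + t *: h) * 1))%:E).

Let H_ae : {ae mu, forall y, la.-integrable setT
  (fun t : R => (unit_indic t * (G (y + t *: h) * 1))%:E)}.
Proof. exact: (ae_integrable2 iGp). Qed.

Let iH : mu.-integrable setT (EFin \o H).
Proof.
have mH : measurable_fun setT H.
  apply: measurableT_comp; first exact: fine_measurable.
  exact: (measurable_fubini_G iGp).
apply/integrableP; split; first exact/measurable_EFinP.
have /(integrable21ltyP la mu (measurable_int _ iGp)) := iGp.
apply: le_lt_trans; apply: ge0_le_integral => //.
- by apply: measurableT_comp => //; exact/measurable_EFinP.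
- have := @measurable_fun_fubini_tonelli_G _ _ _ _ _ la
    (abse \o (fun p : R * 'rV[R]_n => (unit_indic p.1 * (G (p.2 + p.1 *: h) * 1))%:E)).
  apply; first by apply: measurableT_comp => //; exact: measurable_int iGp.
  by move=> p; rewrite /= lee_fin.
- move=> y _; rewrite /comp /H.
  set I := (\int[la]_t _)%E.
  have [If|If] := boolP (I \is a fin_num).
    rewrite fineK//.
    apply: le_abse_integral => //.
    have := measurable_int _ iGp => m.
    exact: (measurableT_comp m (pair2_measurable y)).
  have -> : fine I = 0 by case: (I) If.
  by rewrite abse0; exact: integral_ge0.
Qed.

(** The defect of the translation formula. It integrates to 0 against tensor products of bumps; as
    these tend to indicators of boxes, dominated convergence, with |f| as dominating function, gives
    zero integrals over boxes, and so [f] vanishes almost everywhere on the box. *)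
Let f y := U (y + h) - U y - H y.

Let iUh : mu.-integrable setT (fun y => (U (y + h))%:E).
Proof.
have /integrableP[m1 i1] := iU; apply/integrableP; split.
  exact: (measurableT_comp m1 (measurable_shift h)).
rewrite -(integral_shift h) in i1; last exact: measurableT_comp.
exact: i1.
Qed.

Let if_ : mu.-integrable setT (EFin \o f).
Proof.
rewrite (_ : EFin \o f = fun y => ((U (y + h))%:E - (U y)%:E - (H y)%:E)%E).
  by apply: integrableB => //; exact: integrableB.
by apply/funext => y; rewrite /= !EFinB.
Qed.

Let f_test (b : 'I_n -> R -> R) : (forall i, supported (A i) (B i) (b i)) ->
  (\int[mu]_y (f y * tens b y)%:E = 0)%E.
Proof.
move=> sb; have [M M0 HM] := tens_bounded sb.
have mt : measurable_fun setT (tens b).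
  by apply: continuous_measurable_rV; apply: continuous_tens => i; exact: (sb i).1.
have iHt : mu.-integrable setT (fun y => (H y * tens b y)%:E).
  apply: (integrable_mul_bounded (M := M)) => //.
  by apply/measurable_EFinP; exact: measurable_int iH.
have iUt : mu.-integrable setT (fun y => (U (y + h) * tens b y - U y * tens b y)%:E).
  under eq_fun do rewrite -mulrBl.
  apply: (integrable_mul_bounded (F := fun y => U (y + h) - U y) (M := M)) => //.
    by apply: measurable_funB => //; exact: measurableT_comp mU (measurable_shift h).
  rewrite (_ : EFin \o _ = fun y => ((U (y + h))%:E - (U y)%:E)%E).
    exact: integrableB.
  by apply/funext => y; rewrite /= EFinB.
under eq_integral do rewrite /f mulrBl mulrBl.
rewrite integralB_EFin//.
rewrite (translation_test mU mG iU iG sb); last by move=> t; exact: weak_box.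
have -> : (\int[mu]_y \int[la]_t (unit_indic t * (G (y + t *: h) * tens b y))%:E =
    \int[mu]_y (H y * tens b y)%:E)%E.
  apply: ae_eq_integral => //.
  - have [N N0 HN] := tens_bounded sb.
    apply: (measurable_fubini_G (m1 := la) (m2 := mu)
      (f := fun p => (unit_indic p.1 * (G (p.2 + p.1 *: h) * tens b p.2))%:E)).
    exact: (@integrable_strip_shiftl _ _ G (tens b) h N).
  - exact: measurable_int iHt.
  (* For almost every y the function t -> G(y + t h) is integrable on [0, 1], and only then may the
     constant [tens b y] be taken out of the inner integral. *)
  apply: filterS H_ae => y iy _.
  transitivity (\int[la]_t ((tens b y)%:E * (unit_indic t * (G (y + t *: h) * 1))%:E))%E.
    by apply: eq_integral => t _; rewrite -EFinM; congr EFin; ring.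
  rewrite integralZl// muleC EFinM fineK//.
  exact: integrable_fin_num iy.
by rewrite subee//; exact: integrable_fin_num iHt.
Qed.

Let f_obox a b : (\int[mu]_(z in obox a b `&` obox A B) (f z)%:E = 0)%E.
Proof.
rewrite oboxI; set a' := fun i => _; set b' := fun i => Num.min _ _.
pose F (k : nat) z := (f z * tens (fun i => bump k (a' i) (b' i)) z)%:E.
have mf : measurable_fun setT f by apply/measurable_EFinP; exact: measurable_int if_.
have sk k i : supported (A i) (B i) (bump k (a' i) (b' i)).
  by apply: supportedW (supported_bump _ _ _); rewrite /a' /b' ?le_max ?ge_min lexx orbT.
have F0 k : (\int[mu]_z F k z = 0)%E by apply: f_test.
have mtk k : measurable_fun setT (tens (fun i => bump k (a' i) (b' i))).
  by apply: continuous_measurable_rV; apply: continuous_tens => i; exact: smooth1_bump.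
have h1 k : measurable_fun setT (F k).
  by apply: measurable_EFin_fun; exact: measurable_funM.
have h2 : measurable_fun setT (fun z => (f z * \1_(obox a' b') z)%:E).
  apply: measurable_EFin_fun; apply: measurable_funM => //.
  by apply: measurable_indic; exact: measurable_obox.
have h3 : {ae mu, forall z, setT z -> F ^~ z @ \oo --> (f z * \1_(obox a' b') z)%:E}.
  apply: aeW => z _; apply: cvg_EFin; first exact: nearW.
  by apply: cvgM; [exact: cvg_cst|exact: tens_bump_cvg].
have h5 : {ae mu, forall z k, setT z -> (`|F k z| <= `|(f z)%:E|)%E}.
  apply: aeW => z k _; rewrite lee_fin normrM ler_piMr//.
  exact: tens_bump_le1.
have [_ _] := dominated_convergence measurableT h1 h2 h3 (integrable_abse if_) h5.
rewrite (_ : [sequence _]_k = cst 0%E); last by apply/funext => k; exact: F0.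
move=> /(cvg_unique _ (cvg_cst _))-/(_ _)/esym.
move=> /(_ (@ereal_hausdorff R)) I0; rewrite integral_mkcond -[RHS]I0.
apply: eq_integral => z _; rewrite patchE indicE; case: ifPn => zQ.
  by rewrite mulr1.
by rewrite mulr0.
Qed.

Let gn := (enorm \o g) \_ (~` Gam).

Let mgn : measurable_fun setT gn.
Proof.
have [_ oG _] := lu.
apply: measurable_enorm_restrict; first exact: open_measurable_rV.
by move=> i; have [] := wg.1 i.
Qed.

Lemma translation_ae_obox : {ae mu, forall y, obox A B y ->
  (`|u (y + h) - u y|%:E <=
   \int[la]_t (unit_indic t * (enorm h * gn (y + t *: h)))%:E)%E}.
Proof.
have := ae_eq0_obox if_ f_obox; apply: filterS2 H_ae => y iy f0 Qy.
have cQ : cbox A B y.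
  by move=> i; have := Qy i; rewrite !in_itv/= => /andP[/ltW -> /ltW ->].
(* The whole segment lies in the sweep, so the cut-offs of [u] and [g] are invisible at its ends and
   along it. *)
have Kt (t : R) : t \in `[0, 1] -> K (y + t *: h) by move=> t01; exists y => //; exists t.
have {f0} := f0 Qy; rewrite /f /U !patchE mem_set; last first.
  by have := @Kt 1; rewrite scale1r; apply; rewrite in_itv/= ler01 lexx.
rewrite mem_set; last first.
  by have := @Kt 0; rewrite scale0r addr0; apply; rewrite in_itv/= ler01 lexx.
move=> /eqP; rewrite subr_eq0 => /eqP ->.
have Hfin := integrable_fin_num measurableT iy.
rewrite -[X in (X <= _)%E]/(`|(H y)%:E|)%E /H fineK//.
have mi := measurable_int _ iy.
apply: le_trans (le_abse_integral _ measurableT mi) _.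
apply: ge0_le_integral => //.
- exact: measurableT_comp.
- apply: measurable_EFin_fun; apply: measurable_funM.
    exact: measurable_unit_indic.
  apply: measurable_funM => //.
  have m1 : measurable_fun setT (fun p : R * 'rV[R]_n => gn (p.2 + p.1 *: h)).
    exact: measurable_shift_comp mgn.
  exact: (measurableT_comp m1 (pair2_measurable y)).
move=> t _; rewrite lee_fin /unit_indic indicE.
have [/set_mem t01|_] := boolP (t \in `[0%R, 1%R]%classic); last by rewrite !mul0r normr0.
rewrite !mul1r mulr1 /G /gn !patchE mem_set; last exact: Kt.
rewrite mem_set; last by apply: KG; exact: Kt.
exact: abs_dot_le_enorm.
Qed.

End box_formula.

(** * The L^1 Poincare inequality on balls *)

Section poincare.
Context {R : realType} {n : nat}.
Local Notation mu := (@lebesgue_rV R n).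
Local Notation la := (@lebesgue_measure R).
Variables (Gam : set 'rV[R]_n) (u : 'rV[R]_n -> R) (g : 'rV[R]_n -> 'rV[R]_n).
Hypothesis Gam0 : Gam !=set0.
Hypothesis cGam : closed Gam.
Hypothesis lu : locally_integrable_rV (~` Gam) u.
Hypothesis wg : weak_gradient (~` Gam) u g.

Let gn := (enorm \o g) \_ (~` Gam).
Let u0 := u \_ (~` Gam).

Let mGam : measurable (~` Gam).
Proof. by have [_ oG _] := lu; exact: open_measurable_rV. Qed.

Let mgn : measurable_fun setT gn.
Proof. by apply: measurable_enorm_restrict => // i; have [] := wg.1 i. Qed.

Let mu0 : measurable_fun setT u0.
Proof. by have [mu _ _] := lu; exact: (measurable_restrictT u mGam).1. Qed.

Let gn_ge0 z : 0 <= gn z.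
Proof. by rewrite /gn patchE; case: ifP => // _; exact: enorm_ge0. Qed.

(** The set of admissible y is open, hence a countable union of boxes whose closures are admissible;
    the exceptional null sets of the box formula are countably many. *)
Lemma translation_ae (h : 'rV[R]_n) : {ae mu, forall y, seg_free Gam h y ->
  (`|u (y + h) - u y|%:E <=
   \int[la]_t (unit_indic t * (enorm h * gn (y + t *: h)))%:E)%E}.
Proof.
have [F [FE HF]] := open_obox_cover (@open_seg_free _ _ _ h Gam0 cGam).
have H k : {ae mu, forall y, F k y ->
  (`|u (y + h) - u y|%:E <=
   \int[la]_t (unit_indic t * (enorm h * gn (y + t *: h)))%:E)%E}.
  have [->|[a [b [-> ab]]]] := HF k; first by apply: aeW => y [].

  exact: (translation_ae_obox lu wg ab).
have := ae_foralln H; apply: filterS => y Hy; rewrite FE => -[k _ Fy].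
exact: Hy Fy.
Qed.

Section ball.
Hypothesis shadow : forall h, {ae mu, forall y, seg_free Gam h y}.
Variables (x : 'rV[R]_n) (r : R).
Hypothesis r0 : 0 < r.
Let D := eball x r.
Let mD : measurable D. Proof. exact: measurable_eball. Qed.
Let k z := \1_D z * gn z.

Let mk : measurable_fun setT k.
Proof. by apply: measurable_funM => //; exact: measurable_indic. Qed.

Let k_ge0 z : 0 <= k z. Proof. by rewrite mulr_ge0. Qed.

Let incr (y h : 'rV[R]_n) := \1_D y * \1_D (y + h) * `|u0 (y + h) - u0 y|.

(** A ball is convex: if y and y + h lie in it, so does the segment between them, and the gradient
    is needed only inside the ball. By Tonelli and translation invariance every t in [0, 1]
    contributes the same integral of [k]. *)
Lemma translation_le (h : 'rV[R]_n) :
  (\int[mu]_y (incr y h)%:E <= (enorm h)%:E * \int[mu]_z (k z)%:E)%E.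
Proof.
have kmeas : measurable_fun setT (fun p : R * 'rV[R]_n =>
    unit_indic p.1 * (enorm h * k (p.2 + p.1 *: h))).
  apply: measurable_funM; first exact: measurable_fst_unit.
  by apply: measurable_funM => //; exact: measurable_shift_comp.
pose W (p : R * 'rV[R]_n) := (unit_indic p.1 * (enorm h * k (p.2 + p.1 *: h)))%:E.
have mW : measurable_fun setT W by exact: measurable_EFin_fun.
have W0 p : (0 <= W p)%E by rewrite lee_fin !mulr_ge0// ?unit_indic_ge0 ?enorm_ge0.
apply: (@le_trans _ _ (\int[mu]_y \int[la]_t W (t, y))%E).
  apply: ae_ge0_le_integral => //.
  - by move=> y _; rewrite lee_fin !mulr_ge0.
  - apply: measurable_EFin_fun; apply: measurable_funM.
      apply: measurable_funM; first exact: measurable_indic.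
      by apply: (measurableT_comp _ (measurable_shift h)); exact: measurable_indic.
    apply: measurableT_comp => //; apply: measurable_funB => //.
    exact: measurableT_comp mu0 (measurable_shift h).
  - by move=> y _; exact: integral_ge0.
  - exact: (@measurable_fun_fubini_tonelli_G _ _ _ _ _ la W mW W0).
  apply: filterS2 (translation_ae h) (shadow h) => y Hy sy _.
  rewrite /incr !indicE; have [/set_mem Dy|_] := boolP (y \in D); last first.
    by rewrite !mul0r; exact: integral_ge0.
  have [/set_mem Dyh|_] := boolP (y + h \in D); last first.
    by rewrite mulr0 mul0r; exact: integral_ge0.
  rewrite !mul1r /u0 !patchE mem_set; last by have := sy 1; rewrite scale1r; apply; rewrite ler01 lexx.
  rewrite mem_set; last by have := sy 0; rewrite scale0r addr0; apply; rewrite ler01 lexx.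
  apply: le_trans (Hy sy) _; rewrite le_eqVlt; apply/orP; left; apply/eqP.
  apply: eq_integral => t _; rewrite /W /= /unit_indic indicE.
  have [/set_mem /= t01|_] := boolP (t \in `[0%R, 1%R]%classic); last by rewrite !mul0r.
  rewrite /k indicE mem_set ?mul1r//.
  by apply: eball_convex => //; rewrite in_itv in t01.
rewrite -(@fubini_tonelli _ _ _ _ _ la mu W mW W0) /W /=.
apply: (@le_trans _ _ (\int[la]_t ((unit_indic t * enorm h)%:E * \int[mu]_z (k z)%:E))%E).
  apply: ge0_le_integral => //.
  - by move=> t _; apply: integral_ge0 => y _; exact: (W0 (t, y)).
  - exact: (@measurable_fun_fubini_tonelli_F _ _ _ _ _ mu W mW W0).
  - apply: emeasurable_funM => //; apply: measurable_EFin_fun.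
    by apply: measurable_funM => //; exact: measurable_unit_indic.
  move=> t _; under eq_integral do rewrite mulrA EFinM.
  rewrite ge0_integralZl//; last 3 first.
  - apply: measurable_EFin_fun; exact: measurableT_comp mk (measurable_shift _).
  - by move=> z _; rewrite lee_fin.
  - by rewrite lee_fin mulr_ge0 ?unit_indic_ge0 ?enorm_ge0.
  by rewrite (integral_shift (t *: h) (f := EFin \o k))//; exact/measurable_EFinP.
have I0 : (0 <= \int[mu]_z (k z)%:E)%E by apply: integral_ge0 => z _; rewrite lee_fin.
rewrite ge0_integralZr//; last 2 first.
- by apply: measurable_EFin_fun; apply: measurable_funM => //; exact: measurable_unit_indic.
- by move=> t _; rewrite lee_fin mulr_ge0 ?unit_indic_ge0 ?enorm_ge0.
have /= -> := integral_unit_indic (cst (enorm h)).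
by rewrite integral_cst//= lebesgue_measure_itv/= lte_fin ltr01 -EFinB -EFinM subr0 mulr1.
Qed.

(* Two points of the ball differ by some h with |h| < 2 r; integrate
   translation_le over these h. *)
Lemma poincare : (\int[mu]_a \int[mu]_b (\1_D a * \1_D b * `|u0 b - u0 a|)%:E <=
  (2 * r * (4 * r) ^+ n)%:E * \int[mu]_z (k z)%:E)%E.
Proof.
have madd : measurable_fun setT (fun p : 'rV[R]_n * 'rV[R]_n => p.1 + p.2).
  apply/measurable_fun_coordP => i; under eq_fun do rewrite !mxE.
  apply: measurable_funD.
    exact: measurableT_comp (measurable_coord i) measurable_fst.
  exact: measurableT_comp (measurable_coord i) measurable_snd.
have mI : measurable_fun setT (\1_D : 'rV[R]_n -> R) by exact: measurable_indic.
pose W (p : 'rV[R]_n * 'rV[R]_n) := (incr p.1 p.2)%:E.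
have mW : measurable_fun setT W.
  apply: measurable_EFin_fun; apply: measurable_funM.
    apply: measurable_funM; first exact: (measurableT_comp mI measurable_fst).
    exact: (measurableT_comp mI madd).
  apply: measurableT_comp => //; apply: measurable_funB.
    exact: (measurableT_comp mu0 madd).
  exact: (measurableT_comp mu0 measurable_fst).
have W0 p : (0 <= W p)%E by rewrite lee_fin !mulr_ge0.
have I0 : (0 <= \int[mu]_z (k z)%:E)%E by apply: integral_ge0 => z _; rewrite lee_fin.
rewrite (_ : (\int[mu]_a _)%E = (\int[mu]_a \int[mu]_h W (a, h))%E); last first.
  apply: eq_integral => a _; rewrite -(integral_shift a).
    by apply: eq_integral => h _; rewrite /W /incr /= addrC.
  apply: measurable_EFin_fun; apply: measurable_funM; first exact: measurable_funM.
  by apply: measurableT_comp => //; exact: measurable_funB.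
rewrite (@fubini_tonelli _ _ _ _ _ mu mu W mW W0).
apply: (@le_trans _ _ (\int[mu]_h ((\1_(eball 0 (2 * r)) h * (2 * r))%:E *
    \int[mu]_z (k z)%:E))%E).
  apply: ge0_le_integral => //.
  - by move=> h _; apply: integral_ge0 => y _; exact: (W0 (y, h)).
  - exact: (@measurable_fun_fubini_tonelli_G _ _ _ _ _ mu W mW W0).
  - apply: emeasurable_funM => //; apply: measurable_EFin_fun.
    by apply: measurable_funM => //; apply: measurable_indic; exact: measurable_eball.
  move=> h _; rewrite indicE; have [/set_mem|/negP] := boolP (h \in _).
    rewrite /eball/= subr0 mul1r => h2r; apply: le_trans (translation_le h) _.
    by apply: lee_wpmul2r => //; rewrite lee_fin ltW.
  (* For |h| >= 2 r the points y and y + h cannot both lie in the ball, so the increment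
     vanishes. *)
  rewrite inE => h2r; rewrite mul0r mul0e; under eq_integral => y _.
    rewrite /W /incr /= !indicE.
    have -> : (y \in D)%:R * (y + h \in D)%:R = 0 :> R.
      have [/set_mem Dy|_] := boolP (y \in D); last by rewrite mul0r.
      have [/set_mem Dyh|_] := boolP (y + h \in D); last by rewrite mulr0.
      exfalso; apply: h2r; rewrite /eball/= subr0.
      rewrite (_ : h = (y + h - x) + (x - y)); last by rewrite addrA subrK addrC addKr.
      apply: le_lt_trans (ler_enormD _ _) _; rewrite mulr2n mulrDl mul1r ltrD//.
      by rewrite enormB.
    rewrite mul0r; over.
  by rewrite integral0.
rewrite ge0_integralZr//; last 2 first.
- apply: measurable_EFin_fun.
  by apply: measurable_funM => //; apply: measurable_indic; exact: measurable_eball.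
- by move=> h _; rewrite lee_fin !mulr_ge0// ltW.
apply: lee_wpmul2r => //.
under eq_integral do rewrite EFinM.
rewrite ge0_integralZr//; last 2 first.
- by apply: measurable_EFin_fun; apply: measurable_indic; exact: measurable_eball.
- by rewrite lee_fin mulr_ge0// ltW.
rewrite integral_indic//; last exact: measurable_eball.
rewrite setIT muleC (EFinM (2 * r)); apply: lee_wpmul2l.
  by rewrite lee_fin mulr_ge0// ltW.
(* The admissible h fill a ball of radius 2 r, whose volume is bounded by that of a cube of side 4
   r. *)
rewrite (_ : 4 * r = 2 * (2 * r)); last by rewrite mulrA -natrM.
by apply: lebesgue_eball_le; rewrite mulr_ge0// ltW.
Qed.

End ball.
End poincare.

(** * Hausdorff measure restricted to a regular set *)

Section hausdorff_outer.
Context {R : realType} {n : nat}.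
Variable d : R.
Hypothesis d0 : 0 < d.
Implicit Types (A B X : set 'rV[R]_n) (x y : 'rV[R]_n) (e c : R).
Local Open Scope ereal_scope.

Lemma ediam0 : ediam (@set0 'rV[R]_n) = 0.
Proof.
rewrite /ediam; apply: max_l; apply: ge_ereal_sup => _ [x []].
Qed.

Lemma enorm_le_ediam A x y : A x -> A y -> (enorm (x - y)%R)%:E <= ediam A.
Proof.
move=> Ax Ay; rewrite /ediam le_max; apply/orP; right.
by apply: ereal_sup_ubound; exists x => //; exists y.
Qed.

(* The domain carries the discrete sigma-algebra, so that the measurability
   required of the coverings in mu_ext is void. *)
Definition gauge e (A : set (g_sigma_algebraType [set: set 'rV[R]_n])) : \bar R :=
  if ediam A <= e%:E then ediam A `^ d else +oo.

Lemma gauge_ge0 e A : 0 <= gauge e A.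
Proof. by rewrite /gauge; case: ifP => // _; exact: poweR_ge0. Qed.

Lemma gauge0 e : (0 <= e)%R -> gauge e set0 = 0.
Proof. by move=> e0; rewrite /gauge ediam0 lee_fin e0 poweR0r// gt_eqF. Qed.

(* Coverings by sets of diameter above [e] have infinite gauge, so the
   constraint on diameters may be dropped from the infimum. *)
Lemma hausdorff_preE e A : hausdorff_pre d e A = mu_ext (gauge e) A.
Proof.
apply/eqP; rewrite eq_le; apply/andP; split.
  apply: le_ereal_inf_tmp => _ [F [mF AF] <-].
  have [H|/existsNP[k /negP Hk]] := pselect (forall k, ediam (F k) <= e%:E).
    apply: ereal_inf_lbound; exists F => //.
    by apply: eq_eseriesr => k _; rewrite /gauge H.
  rewrite [leRHS](@eseries_pinfty _ _ _ k) ?leey//.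
    by move=> m _; rewrite gt_eqF// (lt_le_trans _ (gauge_ge0 _ _)).
  by rewrite /gauge (negbTE Hk).
apply: le_ereal_inf_tmp => _ [F [AF H] <-]; apply: ereal_inf_lbound.
exists F; last by apply: eq_eseriesr => k _; rewrite /gauge H.
by split => // k; apply: sub_sigma_algebra.
Qed.

Lemma hausdorff_pre_ge0 e A : 0 <= hausdorff_pre d e A.
Proof. by rewrite hausdorff_preE; apply: mu_ext_ge0 => ?; exact: gauge_ge0. Qed.

Lemma hausdorff_pre0 e : (0 <= e)%R -> hausdorff_pre d e (@set0 'rV[R]_n) = 0.
Proof.
by move=> e0; rewrite hausdorff_preE; apply: mu_ext0; [exact: gauge0|move=> ?; exact: gauge_ge0].
Qed.

Lemma hausdorff_pre_mono e A B : A `<=` B -> hausdorff_pre d e A <= hausdorff_pre d e B.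
Proof. by move=> AB; rewrite !hausdorff_preE; apply: (@le_mu_ext _ _ _ (gauge e)) AB. Qed.

Lemma hausdorff_pre_le e e' A : (e <= e')%R -> hausdorff_pre d e' A <= hausdorff_pre d e A.
Proof.
move=> ee; apply: ereal_inf_le_tmp => _ [F [AF H] <-]; exists F => //; split => // k.
by apply: le_trans (H k) _; rewrite lee_fin.
Qed.

Lemma hausdorff_pre_subadd e (F : nat -> set 'rV[R]_n) :
  hausdorff_pre d e (\bigcup_k F k) <= \sum_(k <oo) hausdorff_pre d e (F k).
Proof.
rewrite hausdorff_preE; under eq_eseriesr do rewrite hausdorff_preE.
by apply: mu_ext_sigma_subadditive => ?; exact: gauge_ge0.
Qed.

Lemma hausdorff_pre_le_hausdorff e A : (0 < e)%R -> hausdorff_pre d e A <= hausdorff d A.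
Proof. by move=> e0; apply: ereal_sup_ubound; exists e. Qed.

Let H0 : hausdorff d (@set0 'rV[R]_n) = 0.
Proof.
apply/eqP; rewrite eq_le; apply/andP; split.
  by apply: ge_ereal_sup => _ [e /= e0 <-]; rewrite hausdorff_pre0// ltW.
by apply: le_trans (hausdorff_pre_ge0 1 _) (hausdorff_pre_le_hausdorff _ _).
Qed.

Let Hge0 A : 0 <= hausdorff d A.
Proof. by apply: le_trans (hausdorff_pre_ge0 1 _) (hausdorff_pre_le_hausdorff _ _). Qed.

Let Hmono : {homo (hausdorff d : set 'rV[R]_n -> \bar R) : A B / A `<=` B >-> A <= B}.
Proof.
move=> A B AB; apply: ge_ereal_sup => _ [e /= e0 <-].
by apply: le_trans (hausdorff_pre_mono e AB) _; exact: hausdorff_pre_le_hausdorff.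
Qed.

Let Hsub : sigma_subadditive (hausdorff d : set 'rV[R]_n -> \bar R).
Proof.
move=> F; apply: ge_ereal_sup => _ [e /= e0 <-].
apply: le_trans (hausdorff_pre_subadd _ _) _; apply: lee_nneseries.
  by move=> k _ _; exact: hausdorff_pre_ge0.
by move=> k _; exact: hausdorff_pre_le_hausdorff.
Qed.

Definition hausdorff_outer : {outer_measure set 'rV[R]_n -> \bar R} :=
  HB.pack (hausdorff d : set 'rV[R]_n -> \bar R)
    (isOuterMeasure.Build _ _ (hausdorff d : set 'rV[R]_n -> \bar R) H0 Hge0 Hmono Hsub).

Local Notation H := hausdorff_outer.

(** A set of diameter at most e < c cannot meet both [A] and [B], so a covering of the union splits
    into coverings of the two parts. Discarded members are replaced by the empty set, which costs
    nothing since d > 0. *)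
Lemma hausdorff_pre_metric e c A B : (0 < e)%R -> (e < c)%R ->
  (forall a b, A a -> B b -> (c <= enorm (a - b))%R) ->
  hausdorff_pre d e A + hausdorff_pre d e B <= hausdorff_pre d e (A `|` B).
Proof.
move=> e0 ec sep; apply: le_ereal_inf_tmp => _ [F [ABF HF] <-].
pose FA k := if pselect (F k `&` A !=set0) then F k else set0.
pose FB k := if pselect (F k `&` B !=set0) then F k else set0.
have le X (FX := fun k => if pselect (F k `&` X !=set0) then F k else set0) :
    X `<=` A `|` B -> hausdorff_pre d e X <= \sum_(k <oo) ediam (FX k) `^ d.
  move=> XAB; apply: ereal_inf_lbound; exists FX => //; split.
    move=> x Xx; have [k _ Fx] := ABF _ (XAB _ Xx); exists k => //.
    by rewrite /FX; case: pselect => // -[]; exists x.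
  move=> k; rewrite /FX; case: pselect => hF /=; first exact: HF.
  by rewrite ediam0 lee_fin ltW.
apply: (@le_trans _ _ (\sum_(k <oo) ediam (FA k) `^ d + \sum_(k <oo) ediam (FB k) `^ d)).
  by apply: leeD; apply: le => x; [left|right].
rewrite -nneseriesD; last 2 first.
- by move=> k _ _; exact: poweR_ge0.
- by move=> k _ _; exact: poweR_ge0.
apply: lee_nneseries.
  by move=> k _ _; apply: adde_ge0; exact: poweR_ge0.
move=> k _; rewrite /FA /FB.
case: pselect => [[a [Fa Aa]]|nA] /=; last first.
  rewrite ediam0 poweR0r ?gt_eqF// add0e.
  by case: pselect => nB //=; rewrite ediam0 poweR0r ?gt_eqF// poweR_ge0.
case: pselect => [[b [Fb Bb]]|nB] /=; last first.
  by rewrite ediam0 poweR0r ?gt_eqF// adde0.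
exfalso; have := le_trans (enorm_le_ediam Fa Fb) (HF k).
by rewrite lee_fin leNgt (lt_le_trans ec)// sep.
Qed.

Lemma hausdorff_metric c A B : (0 < c)%R ->
  (forall a b, A a -> B b -> (c <= enorm (a - b))%R) ->
  H A + H B <= H (A `|` B).
Proof.
move=> c0 sep; have [fin|] := boolP (H (A `|` B) \is a fin_num); last first.
  rewrite ge0_fin_numE ?outer_measure_ge0// -leNgt leye_eq => /eqP ->.
  exact: leey.
(* Two independent scales allow the suprema for [A] and [B] to be taken one after the other; both
   may be lowered to a common scale below [c], as the premeasure grows when the scale shrinks. *)
have key e1 e2 : (0 < e1)%R -> (0 < e2)%R ->
    hausdorff_pre d e1 A + hausdorff_pre d e2 B <= H (A `|` B).
  move=> e10 e20; pose e : R := (Num.min (c / 2) (Num.min e1 e2))%R.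
  have e0 : (0 < e)%R by rewrite !lt_min e10 e20 divr_gt0.
  have ec : (e < c)%R by rewrite gt_min; apply/orP; left; lra.
  apply: (@le_trans _ _ (hausdorff_pre d e A + hausdorff_pre d e B)).
    by apply: leeD; apply: hausdorff_pre_le; rewrite /e !ge_min lexx ?orbT.
  apply: le_trans (hausdorff_pre_metric e0 ec sep) _.
  exact: hausdorff_pre_le_hausdorff.
have finA e : (0 < e)%R -> hausdorff_pre d e A \is a fin_num.
  move=> e0; rewrite ge0_fin_numE ?hausdorff_pre_ge0//.
  apply: (@le_lt_trans _ _ (H (A `|` B))); last by rewrite ltey_eq fin.
  apply: le_trans (key e 1%R e0 ltr01); rewrite leeDl//; exact: hausdorff_pre_ge0.
have HB : H B \is a fin_num.
  rewrite ge0_fin_numE ?outer_measure_ge0//.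
  apply: (@le_lt_trans _ _ (H (A `|` B))); last by rewrite ltey_eq fin.
  by apply: le_outer_measure => x; right.
rewrite -leeBrDr//; apply: ge_ereal_sup => _ [e1 /= e10 <-].
rewrite leeBrDr// addeC -leeBrDr ?finA//; apply: ge_ereal_sup => _ [e2 /= e20 <-].
by rewrite leeBrDr ?finA// addeC key.
Qed.

End hausdorff_outer.

(** * Borel sets are measurable for a metric outer measure *)

Section metric_outer_measure.
Context {R : realType} {n : nat}.
Variable H : {outer_measure set 'rV[R]_n -> \bar R}.
Implicit Types (A B X : set 'rV[R]_n) (c : R).
Local Open Scope ereal_scope.

Hypothesis metric : forall c A B, (0 < c)%R ->
  (forall a b, A a -> B b -> (c <= enorm (a - b))%R) ->
  H A + H B <= H (A `|` B).

Section halfspace.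
Variables (i : 'I_n) (c : R) (X : set 'rV[R]_n).
Let f (v : 'rV[R]_n) := (v ord0 i - c)%R.

Let f_sep (v w : 'rV[R]_n) : (f v - f w <= enorm (v - w))%R.
Proof.
rewrite /f opprB addrA subrK; apply: le_trans (ler_norm _) _.
by have := coord_le_enorm (v - w) i; rewrite !mxE.
Qed.

Let ring_ (k : nat) : set 'rV[R]_n :=
  [set x | X x /\ (k.+2%:R^-1 < f x <= k.+1%:R^-1)%R].

Let rings (e : bool) (N : nat) : set 'rV[R]_n :=
  [set x | exists j, [/\ (j < N)%N, odd j = e & ring_ j x]].

Let rings_le e N : \sum_(j < N | odd j == e) H (ring_ j) <= H (rings e N).
Proof.
elim: N => [|N IH]; first by rewrite big_ord0 outer_measure_ge0.
rewrite big_mkcond big_ord_recr -big_mkcond/=.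
have sub : rings e N `<=` rings e N.+1.
  by move=> x [j [jN je jx]]; exists j; split => //; exact: leqW.
case: eqP => [Ne|_]; last by rewrite adde0; apply: le_trans IH _; exact: le_outer_measure.
apply: (@le_trans _ _ (H (rings e N) + H (ring_ N))); first exact: leeD.
apply: (@le_trans _ _ (H (rings e N `|` ring_ N))); last first.
  by apply: le_outer_measure => x [/sub//|xN]; exists N.
case: N => [|N] in IH sub Ne *.
  rewrite (_ : rings e 0 = set0) ?outer_measure0 ?add0e ?set0U//.
  by apply/seteqP; split => // x [j []].
(* The new ring has index [N.+1]. Equal parity excludes index [N], so on the earlier rings [f]
   exceeds 1/(N+1), while on the new one it is at most 1/(N+2). *)
apply: (metric (c := (N.+1%:R^-1 - N.+2%:R^-1)%R)).
  by rewrite subr_gt0 ltf_pV2 ?posrE ?ltr_nat.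
move=> a b [j [jN je [_ /andP[ja _]]]] [_ /andP[_ bN]].
apply: le_trans (f_sep a b); apply: lerB => //.
apply: le_trans (ltW ja); rewrite lef_pV2 ?posrE ?ltr0n// ler_nat.
move: jN; rewrite ltnS leq_eqVlt => /predU1P[jN|//].
by move: Ne; rewrite -je jN /=; case: (odd N).
Qed.

(* Caratheodory's argument: the rings of X on one side of the hyperplane with
   indices of the same parity are at positive distance from each other, so their
   measures are summable and the rings close to the hyperplane are negligible. *)
Lemma halfspace_caratheodory_le :
  H (X `&` [set v | f v <= 0]%R) + H (X `&` ~` [set v | f v <= 0]%R) <= H X.
Proof.
have [fin|] := boolP (H X \is a fin_num); last first.
  rewrite ge0_fin_numE ?outer_measure_ge0// -leNgt leye_eq => /eqP ->.
  exact: leey.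
have ring_sum : \sum_(0 <= j <oo) H (ring_ j) < +oo.
  apply: (@le_lt_trans _ _ (H X + H X)); last first.
    by rewrite lte_add_pinfty// ltey_eq fin.
  apply: lime_le.
    by apply: is_cvg_nneseries => k _ _; exact: outer_measure_ge0.
  apply: nearW => N; rewrite big_mkord (bigID (fun j : 'I_N => odd j == true))/=.
  apply: leeD.
    apply: le_trans (rings_le true N) _.
    by apply: le_outer_measure => x [j [_ _ []]].
  rewrite (eq_bigl (fun j : 'I_N => odd j == false)); last by move=> j /=; case: odd.
  apply: le_trans (rings_le false N) _.
  by apply: le_outer_measure => x [j [_ _ []]].
apply/lee_addgt0Pr => e e0.
have tail := nneseries_tail_cvg ring_sum (fun k _ => outer_measure_ge0 H (ring_ k)).
have [N HN] : exists N, \sum_(N <= k <oo) H (ring_ k) <= e%:E.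
  move/fine_cvgP : tail => [[M _ finM] /cvgrPdist_le/(_ _ e0)[M' _ HM]].
  exists (maxn M M'); have := HM (maxn M M') (leq_maxr _ _).
  rewrite /= sub0r normrN => h; rewrite -(fineK (finM _ (leq_maxl _ _))) lee_fin.
  exact: le_trans (ler_norm _) h.
(* [Y] is at positive distance from the half-space, so metric additivity applies to it. A remaining
   point with f(x) > 0 lies in the ring of index m - 1, where m > N is the integer part of 1/f(x);
   these rings have total measure at most [e]. *)
pose Y : set 'rV[R]_n := X `&` [set v | N.+1%:R^-1 <= f v]%R.
apply: (@le_trans _ _ (H (X `&` [set v | f v <= 0]%R) +
    (H Y + \sum_(N <= k <oo) H (ring_ k)))).
  apply: leeD2l.
  apply: (@le_trans _ _ (H (Y `|` \bigcup_(k in ~` `I_N) ring_ k))).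
    apply: le_outer_measure => x [Xx /negP]; rewrite -ltNge => fx.
    have [xY|xY] := leP (N.+1%:R^-1)%R (f x); first by left.
    have fx' : (0 < (f x)^-1)%R by rewrite invr_gt0.
    have /andP[m0 m1] := truncn_itv (ltW fx').
    set m := Num.truncn (f x)^-1 in m0 m1.
    have Nm : (N < m)%N.
      rewrite -ltnS -(ltr_nat R); apply: le_lt_trans m1.
      by rewrite -[leLHS]invrK lef_pV2 ?posrE ?invr_gt0// ltW.
    have mE : m.-1.+1 = m by rewrite prednK// (leq_trans _ Nm).
    right; exists m.-1; first by apply/negP; rewrite -leqNgt -ltnS mE.
    split => //; rewrite !mE; apply/andP; split.
      by rewrite -[ltRHS]invrK ltf_pV2 ?posrE.
    by rewrite -[leLHS]invrK lef_pV2 ?posrE// ltr0n (leq_trans _ Nm).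
  apply: le_trans (outer_measureU2 _ _ _) _; apply: leeD2l.
  exact: outer_measure_sigma_subadditive_tail.
rewrite addeA; apply: leeD => //.
apply: (@le_trans _ _ (H ((X `&` [set v | f v <= 0]%R) `|` Y))); last first.
  by apply: le_outer_measure => x [[]|[]].
rewrite addeC setUC; apply: (metric (c := N.+1%:R^-1%R)); first by rewrite invr_gt0.
move=> a b [_ /= fa] [_ /= fb]; apply: le_trans (f_sep a b).
by rewrite -[leLHS]subr0 lerB.
Qed.

End halfspace.

Lemma borel_caratheodory A : measurable A -> H.-caratheodory A.
Proof.
have sC := @sigma_algebra_measurable _ (caratheodory_type H).
apply: smallest_sub; first exact: sC.
rewrite -bigcup_seq => {}A [i _] [B mB <-]; rewrite setTI.
move: B mB; apply: smallest_sub.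
  case: sC => h0 hC hU; split => //=.
  - by move=> B hB; rewrite setTD preimage_setC -setTD; exact: hC.
  - by move=> F hF; rewrite preimage_bigcup; exact: hU.
move=> _ [[a b] _ <-] /=.
(* The generating intervals are of the form []a, b]], so each generator is the difference of two
   half-spaces. *)
pose P (c : R) := [set v : 'rV[R]_n | (v ord0 i - c <= 0)%R].
have mP c : H.-caratheodory (P c).
  by apply: le_caratheodory_measurable => X; exact: halfspace_caratheodory_le.
rewrite (_ : _ @^-1` _ = ~` P a `&` P b).
  by apply: caratheodory_measurable_setI => //; exact: caratheodory_measurable_setC.
apply/seteqP; split => v /=; rewrite in_itv/= /P /= !subr_le0.
  by move=> /andP[av ->]; split => //; apply/negP; rewrite -ltNge.
by move=> [/negP]; rewrite -ltNge => -> ->.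
Qed.

Lemma metric_outer_measure_borel :
  {m : {measure set 'rV[R]_n -> \bar R} | forall A, m A = H A}.
Proof.
have add : semi_sigma_additive (H : set 'rV[R]_n -> \bar R).
  move=> F mF tF mUF; apply: (caratheodory_measure_sigma_additive (mu := H)) => //.
    by move=> k; exact: borel_caratheodory.
  exact: borel_caratheodory.
pose mix := isMeasure.Build _ _ _ (H : set 'rV[R]_n -> \bar R) (outer_measure0 H)
  (outer_measure_ge0 H) add.
pose m : {measure set 'rV[R]_n -> \bar R} :=
  HB.pack (H : set 'rV[R]_n -> \bar R) mix.
by exists m.
Qed.

End metric_outer_measure.

(** * Exchanging the centre and the point of a ball by Tonelli *)

Section ball_swap.
Context {R : realType} {n : nat}.
Local Notation mu := (@lebesgue_rV R n).
Variable s : {finite_measure set 'rV[R]_n -> \bar R}.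
Variables (F : 'rV[R]_n -> R) (r : R).
Hypotheses (mF : measurable_fun setT F) (F0 : forall z, 0 <= F z).

Let near_ball : set ('rV[R]_n * 'rV[R]_n) := [set p | enorm (p.2 - p.1) < r].

Let measurable_near_ball : measurable near_ball.
Proof.
have mB : measurable_fun setT (fun p : 'rV[R]_n * 'rV[R]_n => p.2 - p.1).
  apply/measurable_fun_coordP => i; under eq_fun do rewrite !mxE.
  apply: measurable_funB.
    exact: measurableT_comp (measurable_coord i) measurable_snd.
  exact: measurableT_comp (measurable_coord i) measurable_fst.
have me : measurable_fun setT (fun p : 'rV[R]_n * 'rV[R]_n => enorm (p.2 - p.1)).
  apply: (measurableT_comp _ mB).
  by apply: continuous_measurable_rV; exact: enorm_continuous.
have := me measurableT `]-oo, r[%classic (measurable_itv _).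
by rewrite setTI; congr measurable.
Qed.

Lemma measurable_measure_ball : measurable_fun setT (fun z => s (eball z r)).
Proof.
have mi : measurable_fun setT (EFin \o \1_near_ball : _ -> \bar R).
  by apply/measurable_EFinP; exact: measurable_indic.
have m := @measurable_fun_fubini_tonelli_G _ _ _ _ _ s _ mi.
rewrite (_ : (fun z => _) = (fubini_G s (EFin \o \1_near_ball))).
  by apply: m => p; rewrite /= lee_fin.
apply/funext => z; rewrite /fubini_G -[eball z r]setIT -integral_indic//; last first.
  exact: measurable_eball.
apply: eq_integral => w _; rewrite /= !indicE; congr (_%:R%:E); congr nat_of_bool.
by apply/idP/idP; rewrite !inE => zw; exact: eball_sym.
Qed.

Let W (p : 'rV[R]_n * 'rV[R]_n) := (\1_near_ball p * F p.2)%:E.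

Let mW : measurable_fun setT W.
Proof.
apply: measurable_EFin_fun; apply: measurable_funM.
  exact: measurable_indic.
exact: (measurableT_comp mF measurable_snd).
Qed.

Let W0 p : (0 <= W p)%E. Proof. by rewrite lee_fin mulr_ge0. Qed.

(** The relation |z - w| < r is symmetric. The case [F = 1] serves to estimate the shadows of [Gam],
    the case of a truncated gradient to integrate the telescoped bound. *)
Lemma integral_ball_swap :
  (\int[s]_w \int[mu]_z (\1_(eball w r) z * F z)%:E =
   \int[mu]_z ((F z)%:E * s (eball z r)))%E.
Proof.
transitivity (\int[s]_w \int[mu]_z W (w, z))%E; first by [].
rewrite (@fubini_tonelli _ _ _ _ _ s mu W mW W0).
apply: eq_integral => z _.
rewrite -[X in s X]setIT -integral_indic//; last exact: measurable_eball.
rewrite -ge0_integralZl//; last 2 first.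
- by apply: measurable_EFin_fun; apply: measurable_indic; exact: measurable_eball.
- by rewrite lee_fin.
apply: eq_integral => w _; rewrite /W -EFinM mulrC; congr (_ * _)%:E.
rewrite !indicE; congr (_%:R); congr nat_of_bool.
by apply/idP/idP; rewrite !inE => zw; exact: eball_sym.
Qed.

Lemma measurable_ball_integral :
  measurable_fun setT (fun w => \int[mu]_z (\1_(eball w r) z * F z)%:E)%E.
Proof. exact: (@measurable_fun_fubini_tonelli_F _ _ _ _ _ mu W mW W0). Qed.

End ball_swap.

Section measurable_measure_ball.
Context {R : realType} {n : nat}.
Local Notation mu := (@lebesgue_rV R n).
Variables (s : {finite_measure set 'rV[R]_n -> \bar R}) (r : R).

Lemma integral_measure_ball_le : 0 <= r ->
  (\int[mu]_z s (eball z r) <= ((2 * r) ^+ n)%:E * s setT)%E.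
Proof.
move=> r0; have := @integral_ball_swap _ _ s (cst 1) r (measurable_cst _) (fun=> ler01).
under [X in _ = X -> _]eq_integral do rewrite mul1e.
move=> <-; rewrite -integral_cst//; apply: ge0_le_integral => //.
- by move=> w _; apply: integral_ge0 => z _; rewrite lee_fin mulr_ge0.
- exact: measurable_ball_integral.
move=> w _; under eq_integral do rewrite mulr1.
rewrite integral_indic; last exact: measurable_eball.
  by rewrite setIT; exact: lebesgue_eball_le.
exact: measurableT.
Qed.

End measurable_measure_ball.

Lemma sume_cst {R : realType} m (x : \bar R) : (0 <= x)%E ->
  (\sum_(j < m) x = m%:R%:E * x)%E.
Proof.
move=> x0; elim: m => [|m IH]; first by rewrite big_ord0 mul0e.
by rewrite big_ord_recr IH -natr1 EFinD ge0_muleDl ?mul1e ?lee_fin.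
Qed.

(** * Ahlfors regular sets: mass of balls and null shadows *)

Section regular_set.
Context {R : realType} {n : nat}.
Local Notation mu := (@lebesgue_rV R n).
Variables (d C0 : R) (Gam : set 'rV[R]_n).
Hypotheses (d0 : 0 < d) (cGam : closed Gam) (C1 : 1 <= C0).
Hypothesis reg : forall x (r : R), Gam x -> 0 < r ->
  ((C0^-1 * r `^ d)%:E <= hausdorff d (Gam `&` eball x r) <= (C0 * r `^ d)%:E)%E.
Implicit Types (x y z w h : 'rV[R]_n).

Let C0_gt0 : 0 < C0. Proof. exact: lt_le_trans C1. Qed.

(** The cut-off by a ball makes the measure finite, by the upper regularity bound, as the exchange
    of integrals over balls requires. *)
Lemma regular_restriction x (M : R) : Gam x -> 0 < M ->
  exists s : {finite_measure set 'rV[R]_n -> \bar R},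
    forall A, s A = hausdorff d (A `&` (Gam `&` eball x M)).
Proof.
move=> Gx M0.
have [m mE] := @metric_outer_measure_borel R n (hausdorff_outer d0) (fun c A B => @hausdorff_metric R n d d0 c A B).
have mS : measurable (Gam `&` eball x M).
  by apply: measurableI; [exact: closed_measurable_rV|exact: measurable_eball].
have fin : (m (Gam `&` eball x M) < +oo)%E.
  rewrite mE; have /andP[_ h] := reg Gx M0; apply: le_lt_trans h _; exact: ltry.
exists [the {finite_measure set 'rV[R]_n -> \bar R} of mfrestr mS fin] => A.
by rewrite /= /mfrestr /mrestr mE.
Qed.

(** Regularity speaks only of balls centred on [Gam]: a nonempty [A] provides a point w of [Gam] in
    B(z, s), and B(z, s) lies in B(w, 2 s). This is the origin of the factors 2^d in the
    constants. *)
Lemma hausdorff_ball_le z (s : R) (A : set 'rV[R]_n) : 0 < s ->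
  A `<=` Gam `&` eball z s -> (hausdorff d A <= (C0 * (2 * s) `^ d)%:E)%E.
Proof.
move=> s0 AG; have Hm := @le_outer_measure _ _ (hausdorff_outer d0).
have [[w Aw]|A0] := pselect (A !=set0); last first.
  have -> : A = set0 by apply/seteqP; split => // w Aw; apply: A0; exists w.
  by rewrite [leLHS](outer_measure0 (hausdorff_outer d0)) lee_fin mulr_ge0 ?powR_ge0// ltW.
have [Gw zw] := AG _ Aw.
have s2 : 0 < 2 * s by rewrite mulr_gt0.
have /andP[_] := reg Gw s2; apply: le_trans; apply: Hm => y Ay.
have [Gy zy] := AG _ Ay; split => //.
by rewrite mulr_natl mulr2n; exact: eball_triangle (eball_sym zw) zy.
Qed.

Section shadow.
Hypothesis dn : d < n%:R - 1.
Hypothesis Gam0 : Gam !=set0.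
Variable h : 'rV[R]_n.

Let a := enorm h + 1.
Let a0 : 0 < a. Proof. by rewrite ltr_pwDr// enorm_ge0. Qed.

(* With e = (|h| + 1) / (N + 1), a segment [z, z + h] meeting Gam puts mass
   at least c e^d in one of the N + 2 balls of radius 2 e centred along it,
   whereas the integral over z of the mass of each ball is at most C e^n. Since
   N e is constant, the measure is O(e^(n - 1 - d)). *)
Lemma shadow_measure_le x (M : R) : Gam x -> 0 < M -> exists2 K : R, 0 < K &
  forall N : nat, (mu (~` seg_free Gam h `&` eball x M) <=
    (K * (a / N.+1%:R) `^ (n%:R - 1 - d))%:E)%E.
Proof.
(* Points of a segment starting in B(x, M) are within M + |h| of [x], and the balls around them have
   radius e <= a, so the mass used lies in B(x, M + 2 a). *)
move=> Gx M0; have M2 : 0 < M + 2 * a by rewrite addr_gt0// mulr_gt0.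
have [s sE] := regular_restriction Gx M2.
pose K1 := C0 * (M + 2 * a) `^ d.
have K10 : 0 < K1 by rewrite mulr_gt0// powR_gt0.
have sT : (s setT <= K1%:E)%E by rewrite sE setTI; have /andP[] := reg Gx M2.
exists (C0 * (2 * a) * 4 ^+ n * K1).
  by rewrite !mulr_gt0// powR_gt0.
move=> N; set e := a / N.+1%:R.
have e0 : 0 < e by rewrite divr_gt0.
have ea : e <= a by rewrite ler_pdivrMr// ler_peMr ?ler1n// ltW.
set S := _ `&` _.
have mS : measurable S.
  apply: measurableI; last exact: measurable_eball.
  by apply: measurableC; apply: open_measurable_rV; exact: open_seg_free.
pose c := C0^-1 * e `^ d.
have c0 : 0 < c by rewrite mulr_gt0 ?invr_gt0// powR_gt0.
have pt z : S z -> (c%:E <= \sum_(j < N.+2) s (eball (z + (j%:R / N.+1%:R) *: h) (2 * e)))%E.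
  move=> [/existsNP[t /not_implyP[/andP[t0 t1] /contrapT Gw]] zM].
  set w := z + t *: h in Gw.
  (* The value t = 1 gives j = N + 1, hence [N.+2] centres. The grid point is within |h| / (N + 1) <
     e of w, strictly because of the 1 added in [a], so the ball of radius 2 e around it contains
     B(w, e). *)
  pose j := Num.truncn (t * N.+1%:R).
  have /andP[j0 j1] : j%:R <= t * N.+1%:R < j.+1%:R.
    by apply: truncn_itv; rewrite mulr_ge0.
  have jN : (j < N.+2)%N.
    rewrite ltnS -(ler_nat R); apply: le_trans j0 _.
    by rewrite ler_piMl.
  rewrite (bigD1 (Ordinal jN))//=.
  apply: (@le_trans _ _ (s (eball (z + (j%:R / N.+1%:R) *: h) (2 * e)))); last first.
    by rewrite leeDl// sume_ge0.
  have /andP[lb _] := reg Gw e0; apply: le_trans lb _; rewrite sE.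
  apply: (le_outer_measure (hausdorff_outer d0)) => y [Gy wy].
  split; last split => //.
  - apply: (@eball_sub _ _ _ w e e) => //; last by rewrite -mulr2n mulr_natl.
    rewrite /eball/= /w opprD addrACA subrr add0r -scalerBl enormZ.
    apply: (@le_lt_trans _ _ (N.+1%:R^-1 * enorm h)).
      apply: ler_wpM2r; first exact: enorm_ge0.
      rewrite ler_norml; apply/andP; split.
        rewrite lerBrDr -[leRHS](mulfK (_ : N.+1%:R != 0)) ?pnatr_eq0//.
        rewrite -mulN1r -mulrDl ler_wpM2r ?invr_ge0//.
        by move: j0; rewrite addrC lerBlDr; lra.
      rewrite lerBlDr -[leLHS](mulfK (_ : N.+1%:R != 0)) ?pnatr_eq0//.
      rewrite -[X in X + _]mul1r -mulrDl ler_wpM2r ?invr_ge0//.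
      by move: j1; rewrite -natr1; lra.
    by rewrite mulrC /e ltr_pM2r ?invr_gt0// ltrDl.
  - apply: (@eball_sub _ _ _ w e (M + enorm h)) => //; last first.
      rewrite -addrA lerD2l; apply: le_trans (lerD (lexx _) ea) _.
      by rewrite /a; lra.
    rewrite /eball/= /w addrAC; apply: le_lt_trans (ler_enormD _ _) _.
    rewrite enormZ ger0_norm// ltr_leD//.
    by rewrite ler_piMl// enorm_ge0.
have ms j : measurable_fun setT (fun z => s (eball (z + (j%:R / N.+1%:R) *: h) (2 * e))).
  exact: (measurableT_comp (measurable_measure_ball _ _) (measurable_shift _)).
have I1 : (c%:E * mu S <= (N.+2%:R * ((4 * e) ^+ n * K1))%:E)%E.
  apply: (@le_trans _ _ (\int[mu]_z \sum_(j < N.+2)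
      s (eball (z + (j%:R / N.+1%:R) *: h) (2 * e)))%E).
    rewrite -[S in mu S]setIT -integral_indic// -ge0_integralZl//; last 2 first.
    - by apply: measurable_EFin_fun; exact: measurable_indic.
    - by rewrite lee_fin ltW.
    apply: ge0_le_integral => //.
    - by move=> z _; rewrite -EFinM lee_fin mulr_ge0// ltW.
    - by apply: emeasurable_funM => //; apply: measurable_EFin_fun; exact: measurable_indic.
    - exact: emeasurable_sum.
    move=> z _; rewrite indicE; have [/set_mem Sz|_] := boolP (z \in S).
      by rewrite mule1; exact: pt.
    by rewrite mule0 sume_ge0.
  rewrite ge0_integral_sum//.
  rewrite (eq_bigr (fun=> (\int[mu]_z s (eball z (2 * e)))%E)); last first.
    move=> j _; rewrite (integral_shift _ (f := fun z => s (eball z (2 * e))))//.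
    exact: measurable_measure_ball.
  rewrite sume_cst ?integral_ge0// EFinM; apply: lee_wpmul2l => //.
  have e2 : 0 <= 2 * e by rewrite mulr_ge0// ltW.
  apply: le_trans (integral_measure_ball_le _ e2) _.
  rewrite (_ : 4 * e = 2 * (2 * e)); last by rewrite mulrA -natrM.
  by rewrite EFinM lee_wpmul2l// lee_fin exprn_ge0// mulr_ge0.
rewrite -(@lee_pmul2l _ c%:E) ?lte_fin// -EFinM.
apply: le_trans I1 _; rewrite lee_fin.
(* [c] carries e^d against e^n on the other side, and one more factor e is absorbed by (N + 1) e =
   a; the exponent n - 1 - d is what is left. The factor 2 comes from N + 2 <= 2 (N + 1). *)
have -> : c * (C0 * (2 * a) * 4 ^+ n * K1 * e `^ (n%:R - 1 - d)) =
    (2 * N.+1%:R) * ((4 * e) ^+ n * K1).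
  have eE : e `^ d * e `^ (n%:R - 1 - d) * e = e ^+ n.
    have pD (p q : R) : e `^ p * e `^ q = e `^ (p + q).
      by rewrite powRD// (gt_eqF e0) implybT.
    rewrite -[X in _ * X](powRr1 (ltW e0)) !pD -(powR_mulrn _ (ltW e0)).
    by congr (_ `^ _); ring.
  have Ne : N.+1%:R * e = a by rewrite /e mulrC divfK// pnatr_eq0.
  rewrite exprMn -eE /c -Ne; field.
  by rewrite gt_eqF.
rewrite ler_wpM2r//; first by rewrite mulr_ge0 ?(ltW K10)// exprn_ge0// mulr_ge0// ltW.
by rewrite -natrM ler_nat mul2n -addnn addSn ltnS addnS ltnS leq_addr.
Qed.

Lemma shadow_null : {ae mu, forall y, seg_free Gam h y}.
Proof.
have [x Gx] := Gam0.
have null (M : nat) : (mu (~` seg_free Gam h `&` eball x M.+1%:R) = 0)%E.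
  apply/eqP; rewrite eq_le measure_ge0 andbT.
  have [K K0 HK] := shadow_measure_le Gx (ltr0Sn R M).
  apply/lee_addgt0Pr => e e0; rewrite add0e.
  have p0 : 0 < n%:R - 1 - d by rewrite subr_gt0.
  (* The scale at which the bound K q^(n - 1 - d) equals e; [N] is then taken so large that a / (N +
     1) <= q. *)
  pose q := (e / K) `^ (n%:R - 1 - d)^-1.
  have q0 : 0 < q by rewrite powR_gt0// divr_gt0.
  pose N := Num.truncn (a / q).
  apply: le_trans (HK N) _; rewrite lee_fin -ler_pdivlMl// [leRHS]mulrC.
  have -> : e / K = q `^ (n%:R - 1 - d).
    by rewrite /q -powRrM mulVf ?(gt_eqF p0)// powRr1// divr_ge0// ltW.
  apply: ge0_ler_powR; rewrite ?nnegrE ?divr_ge0 ?(ltW p0) ?(ltW q0) ?(ltW a0)//.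
  rewrite ler_pdivrMr// mulrC -ler_pdivrMr//.
  by apply: ltW; exact: truncnS_gt.
have N0 : mu.-negligible (\bigcup_M (~` seg_free Gam h `&` eball x M.+1%:R)).
  apply: negligible_bigcup => M; apply/negligibleP; last exact: null.
  apply: measurableI; last exact: measurable_eball.
  by apply: measurableC; apply: open_measurable_rV; exact: open_seg_free.
apply: (negligibleS _ N0) => y /= ys.
exists (Num.truncn (enorm (y - x))) => //; split => //.
exact: truncnS_gt.
Qed.

End shadow.
End regular_set.

(** * Averages over balls *)

Section means.
Context {R : realType} {n : nat}.
Local Notation mu := (@lebesgue_rV R n).
Variables (Gam : set 'rV[R]_n) (u : 'rV[R]_n -> R) (g : 'rV[R]_n -> 'rV[R]_n).
Hypothesis Gam0 : Gam !=set0.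
Hypothesis cGam : closed Gam.
Hypothesis lu : locally_integrable_rV (~` Gam) u.
Hypothesis wg : weak_gradient (~` Gam) u g.
Hypothesis shadow : forall h, {ae mu, forall y, seg_free Gam h y}.
Hypothesis n0 : (0 < n)%N.
Implicit Types (x y z a b : 'rV[R]_n) (r s t : R).

Let u0 := u \_ (~` Gam).
Let gn := (enorm \o g) \_ (~` Gam).

Definition ball_energy y s : \bar R :=
  (\int[mu]_z (\1_(eball y s) z * ((enorm \o g) \_ (~` Gam)) z)%:E)%E.

(** Real-valued through [fine]; it is the true average as soon as [u] is integrable on the ball,
    which [ball_integrable] derives from finite energy. *)
Definition mean y s : R := (fine (mu (eball y s)))^-1 *
  fine (\int[mu]_(z in eball y s) ((u \_ (~` Gam)) z)%:E)%E.

Let mu0 : measurable_fun setT u0.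
Proof.
have [mu oG _] := lu; have mG := open_measurable_rV oG.
exact: (measurable_restrictT u mG).1.
Qed.

Let mball y s := measurable_eball y s.

Let ball_fin y s : 0 < s -> mu (eball y s) \is a fin_num.
Proof.
move=> s0; rewrite ge0_fin_numE//; apply: le_lt_trans (lebesgue_eball_le y (ltW s0)) _.
exact: ltry.
Qed.

Let ball_gt0 y s : 0 < s -> 0 < fine (mu (eball y s)).
Proof.
move=> s0; rewrite fine_gt0//; apply/andP; split; last first.
  by rewrite ltey_eq ball_fin.
apply: lt_le_trans (lebesgue_eball_ge y n0 s0).
by rewrite lte_fin exprn_gt0// divr_gt0// ?mulr_gt0// ltr0n.
Qed.

Let osc y s a := (\int[mu]_b (\1_(eball y s) b * `|u0 b - u0 a|)%:E)%E.

Let mdiff a : measurable_fun setT (fun b => u0 b - u0 a).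
Proof. exact: measurable_funB. Qed.

Let mosc_fun y s a : measurable_fun setT (fun b => \1_(eball y s) b * `|u0 b - u0 a|).
Proof.
apply: measurable_funM; first exact: measurable_indic.
exact: measurableT_comp.
Qed.

Let osc_ge0 y s a : (0 <= osc y s a)%E.
Proof. by apply: integral_ge0 => b _; rewrite lee_fin mulr_ge0. Qed.

Let mosc y s : measurable_fun setT (osc y s).
Proof.
pose W (p : 'rV[R]_n * 'rV[R]_n) := (\1_(eball y s) p.2 * `|u0 p.2 - u0 p.1|)%:E.
have mW : measurable_fun setT W.
  apply: measurable_EFin_fun; apply: measurable_funM.
    by apply: (measurableT_comp _ measurable_snd); exact: measurable_indic.
  apply: measurableT_comp => //; apply: measurable_funB.
    exact: (measurableT_comp mu0 measurable_snd).
  exact: (measurableT_comp mu0 measurable_fst).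
have W0 p : (0 <= W p)%E by rewrite lee_fin mulr_ge0.
exact: (@measurable_fun_fubini_tonelli_F _ _ _ _ _ mu W mW W0).
Qed.

Let osc_poincare y s : 0 < s ->
  (\int[mu]_(a in eball y s) osc y s a <=
   (2 * s * (4 * s) ^+ n)%:E * ball_energy y s)%E.
Proof.
move=> s0; apply: le_trans (poincare Gam0 cGam lu wg shadow y s0).
rewrite integral_mkcond le_eqVlt; apply/orP; left; apply/eqP.
apply: eq_integral => a _; rewrite patchE; case: ifPn => aB.
  by apply: eq_integral => b _; rewrite !indicE aB mul1r.
under eq_integral do rewrite !indicE (negbTE aB) !mul0r.
by rewrite integral0.
Qed.

(** The double integral of |u(b) - u(a)| is finite, so the integral in b is finite for some a in the
    ball; since u(a) is a real number, [u] is integrable there, even if the ball meets [Gam]. *)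
Lemma ball_integrable y s : 0 < s -> (ball_energy y s < +oo)%E ->
  mu.-integrable (eball y s) (EFin \o u0).
Proof.
move=> s0 E; have J0 : (0 <= ball_energy y s)%E.
  by apply: integral_ge0 => z _; rewrite lee_fin mulr_ge0// patchE; case: ifP => // _; exact: enorm_ge0.
have I1 : (\int[mu]_(a in eball y s) osc y s a < +oo)%E.
  apply: le_lt_trans (osc_poincare y s0) _; rewrite lte_mul_pinfty//.
  by rewrite lee_fin !mulr_ge0 ?exprn_ge0 ?mulr_ge0// ltW.
have [a [Ba oa]] : exists a, eball y s a /\ (osc y s a < +oo)%E.
  apply: contrapT => /forallNP H.
  have : mu.-integrable (eball y s) (osc y s).
    apply/integrableP; split; first exact: measurable_funTS.
    by under eq_integral do rewrite gee0_abs//.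
  move=> /(integrable_ae (mball y s))[N [mN N0 sN]].
  have : (mu (eball y s) <= mu N)%E.
    apply: le_measure; rewrite ?inE//.
    move=> z Bz; apply: sN => /= /(_ Bz) fz; apply: (H z); split => //.
    by rewrite ltey_eq fz.
  rewrite N0 leNgt -(fineK (ball_fin y s0)) lte_fin ball_gt0//.
apply/integrableP; split; first by apply: measurable_funTS; exact/measurable_EFinP.
apply: (@le_lt_trans _ _ (osc y s a + \int[mu]_(b in eball y s) `|u0 a|%:E)%E).
  rewrite /osc [X in (_ <= X + _)%E](_ : _ = (\int[mu]_(b in eball y s) `|u0 b - u0 a|%:E)%E).
    rewrite -ge0_integralD//; last first.
      by apply: measurable_funTS; apply: measurable_EFin_fun; exact: measurableT_comp.
    apply: ge0_le_integral => //.
    - by apply: measurable_funTS; apply: measurableT_comp => //; exact/measurable_EFinP.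
    - apply: emeasurable_funD => //.
      by apply: measurable_funTS; apply: measurable_EFin_fun; exact: measurableT_comp.
    by move=> b _; rewrite /= -EFinD lee_fin -{1}(subrK (u0 a) (u0 b)) ler_normD.
  rewrite [RHS]integral_mkcond; apply: eq_integral => b _.
  by rewrite patchE indicE; case: ifP; rewrite ?mul1r ?mul0r.
rewrite lte_add_pinfty// integral_cst//=.
by rewrite -(fineK (ball_fin y s0)) -EFinM ltry.
Qed.

Lemma mean_dist_cst_le z t (c : R) : 0 < t -> (ball_energy z t < +oo)%E ->
  (`|c - mean z t|%:E <= (fine (mu (eball z t)))^-1%:E *
     \int[mu]_(b in eball z t) `|u0 b - c|%:E)%E.
Proof.
move=> t0 E; have iu := ball_integrable t0 E.
have e0 := ball_gt0 z t0; set e := fine _ in e0 *.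
have ic : mu.-integrable (eball z t) (EFin \o cst (c)).
  apply/integrableP; split; first by apply/measurable_EFinP; exact: measurable_cst.
  rewrite /= integral_cst//=.
  by rewrite -(fineK (ball_fin z t0)) -EFinM ltry.
have IE : (\int[mu]_(b in eball z t) (u0 b - c)%:E = (e * (mean z t - c))%:E)%E.
  rewrite (integralB_EFin (mball z t) iu ic).
  rewrite /= integral_cst//=.
  have := integrable_fin_num (mball z t) iu => /fineK <-.
  rewrite -(fineK (ball_fin z t0)) -EFinM -EFinB -/e /mean -/e; congr EFin.
  by field; rewrite gt_eqF.
have -> : (`|c - mean z t|%:E = e^-1%:E * `|(e * (mean z t - c))%:E|)%E.
  by rewrite -EFinM normrM gtr0_norm// mulKf ?gt_eqF// distrC.
apply: lee_wpmul2l; first by rewrite lee_fin invr_ge0 ltW.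
rewrite -IE; apply: le_trans (le_abse_integral _ (mball z t) _) _ => //.
by apply: measurable_funTS; apply: measurable_EFin_fun; exact: measurable_funB.
Qed.

Lemma mean_dist_le z t a : 0 < t -> (ball_energy z t < +oo)%E ->
  (`|u0 a - mean z t|%:E <= (fine (mu (eball z t)))^-1%:E * osc z t a)%E.
Proof.
move=> t0 E; apply: le_trans (mean_dist_cst_le _ t0 E) _.
rewrite integral_mkcond le_eqVlt; apply/orP; left; apply/eqP; congr (_ * _)%E.
apply: eq_integral => b _; rewrite patchE indicE.
by case: ifP; rewrite ?mul1r ?mul0r.
Qed.

Lemma ball_energy_ge0 y s : (0 <= ball_energy y s)%E.
Proof.
apply: integral_ge0 => z _; rewrite lee_fin mulr_ge0// patchE.
by case: ifP => // _; exact: enorm_ge0.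
Qed.

Lemma ball_energy_le y s z t : eball z t `<=` eball y s ->
  (ball_energy z t <= ball_energy y s)%E.
Proof.
move=> BB; have mgn : measurable_fun setT gn.
  have [_ oG _] := lu; apply: measurable_enorm_restrict; first exact: open_measurable_rV.
  by move=> i; have [] := wg.1 i.
have gn0 z' : 0 <= gn z' by rewrite /gn patchE; case: ifP => // _; exact: enorm_ge0.
have me y' s' : measurable_fun setT (fun z' => (\1_(eball y' s') z' * gn z')%:E).
  by apply: measurable_EFin_fun; apply: measurable_funM => //; exact: measurable_indic.
apply: ge0_le_integral => //.
  by move=> b _; rewrite lee_fin mulr_ge0//; exact: gn0.
move=> b _; rewrite lee_fin; apply: ler_wpM2r; first exact: gn0.
rewrite !indicE.
by have [/set_mem/BB bB|//] := boolP (b \in eball z t); rewrite mem_set.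
Qed.

(** The distance from u(a) to the mean over B(z, t) is at most the average of |u(b) - u(a)| over b
    in B(z, t); enlarging the range of b to B(y, s) gives the double integral of the Poincare
    inequality. *)
Lemma integral_mean_dist_le y s z t : 0 < s -> 0 < t ->
  eball z t `<=` eball y s -> (ball_energy y s < +oo)%E ->
  (\int[mu]_(a in eball y s) `|u0 a - mean z t|%:E <=
   ((fine (mu (eball z t)))^-1 * (2 * s * (4 * s) ^+ n))%:E * ball_energy y s)%E.
Proof.
move=> s0 t0 BB E.
have E' : (ball_energy z t < +oo)%E.
  exact: le_lt_trans (ball_energy_le BB) E.
apply: (@le_trans _ _ ((fine (mu (eball z t)))^-1%:E *
    \int[mu]_(a in eball y s) osc y s a)%E); last first.
  rewrite EFinM -muleA; apply: lee_wpmul2l; last exact: osc_poincare.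
  by rewrite lee_fin invr_ge0 ltW// ball_gt0.
rewrite -ge0_integralZl//; last 2 first.
- exact: measurable_funTS.
- by rewrite lee_fin invr_ge0 ltW// ball_gt0.
apply: ge0_le_integral => //.
- apply: measurable_funTS; apply: measurable_EFin_fun.
  by apply: measurableT_comp => //; exact: measurable_funB.
- by apply: emeasurable_funM => //; exact: measurable_funTS.
move=> a _; apply: le_trans (mean_dist_le a t0 E') _.
apply: lee_wpmul2l; first by rewrite lee_fin invr_ge0 ltW// ball_gt0.
apply: ge0_le_integral => //.
- exact: measurable_EFin_fun.
- exact: measurable_EFin_fun.
move=> b _; rewrite lee_fin ler_wpM2r// !indicE.
by have [/set_mem/BB bB|//] := boolP (b \in eball z t); rewrite mem_set.
Qed.

Lemma mean_diff_le y s z t : 0 < s -> 0 < t ->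
  eball z t `<=` eball y s -> (ball_energy y s < +oo)%E ->
  (`|mean y s - mean z t|%:E <=
   ((fine (mu (eball y s)))^-1 * ((fine (mu (eball z t)))^-1 *
     (2 * s * (4 * s) ^+ n)))%:E * ball_energy y s)%E.
Proof.
move=> s0 t0 BB E; rewrite distrC; apply: le_trans (mean_dist_cst_le _ s0 E) _.
rewrite EFinM -muleA; apply: lee_wpmul2l; last exact: integral_mean_dist_le.
by rewrite lee_fin invr_ge0 ltW// ball_gt0.
Qed.

End means.

(** * Telescoping at a boundary point *)

Section geometric.
Context {R : realType}.
Variables (p s0 dlt : R).
Hypotheses (p0 : 0 < p) (s00 : 0 < s0) (dlt0 : 0 < dlt).

Let b : R := 2 `^ p.
Let s (k : nat) : R := s0 / 2 ^+ k.

Let b1 : 1 < b.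
Proof.
rewrite -[ltLHS](_ : 1 `^ p = 1); last by rewrite powR1.
by apply: gt0_ltr_powR; rewrite ?nnegrE// ltr1n.
Qed.

Let s_gt0 k : 0 < s k. Proof. by rewrite divr_gt0// exprn_gt0. Qed.

Let sS k : s k.+1 `^ (- p) = b * s k `^ (- p).
Proof.
have -> : s k.+1 = 2^-1 * s k by rewrite /s exprS invfM mulrCA.
rewrite powRM ?invr_ge0 ?(ltW (s_gt0 k))//; congr (_ * _).
by rewrite -powR_inv1// -powRrM mulrNN mul1r.
Qed.

Let geo N : \sum_(k < N) s k `^ (- p) <= (b - 1)^-1 * s N `^ (- p).
Proof.
have b10 : 0 < b - 1 by rewrite subr_gt0.
elim: N => [|N IH]; first by rewrite big_ord0 mulr_ge0 ?powR_ge0// invr_ge0 ltW.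
rewrite big_ord_recr/= sS; apply: le_trans (lerD IH (lexx _)) _.
rewrite le_eqVlt; apply/orP; left; apply/eqP.
by field; rewrite gt_eqF.
Qed.

(** The terms grow with ratio b = 2^p > 1, so the sum up to the last k with s_k > dlt is at most b /
    (b - 1) times its last term, itself at most dlt^-p; all later terms are cut off. *)
Lemma truncated_geometric_sum N :
  \sum_(k < N) (if dlt < s k then s k `^ (- p) else 0) <= b / (b - 1) * dlt `^ (- p).
Proof.
have b10 : 0 < b - 1 by rewrite subr_gt0.
have bb : 0 <= b / (b - 1) by rewrite divr_ge0// ltW// (lt_trans ltr01).
elim: N => [|N IH]; first by rewrite big_ord0 mulr_ge0 ?powR_ge0.
rewrite big_ord_recr/=; case: ifPn => [ds|_]; last by rewrite addr0.
apply: (@le_trans _ _ (\sum_(k < N.+1) s k `^ (- p))).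
  rewrite big_ord_recr/= lerD2r; apply: ler_sum => k _.
  by case: ifP => // _; exact: powR_ge0.
apply: le_trans (geo N.+1) _; rewrite sS mulrA [_ * b]mulrC.
apply: ler_wpM2l => //; rewrite !powRN lef_pV2 ?posrE ?powR_gt0//.
by apply: ge0_ler_powR; rewrite ?nnegrE ltW.
Qed.

End geometric.

Section telescoping.
Context {R : realType} {n : nat}.
Local Notation mu := (@lebesgue_rV R n).
Variables (Gam : set 'rV[R]_n) (u : 'rV[R]_n -> R) (g : 'rV[R]_n -> 'rV[R]_n).
Hypothesis Gam0 : Gam !=set0.
Hypothesis cGam : closed Gam.
Hypothesis lu : locally_integrable_rV (~` Gam) u.
Hypothesis wg : weak_gradient (~` Gam) u g.
Hypothesis shadow : forall h, {ae mu, forall y, seg_free Gam h y}.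
Hypothesis n0 : (0 < n)%N.
Implicit Types (x y z a : 'rV[R]_n) (r s t : R).

Let u0 := u \_ (~` Gam).
Let E := ball_energy Gam g.

(** The Poincare factor 2 s (4 s)^n divided by the lower volume bounds (2 s / n)^n and (s / n)^n of
    balls of radii s and s / 2 equals this constant times s^(1 - n), which is [kappa s]. *)
Definition poincare_cst : R := 2 * 2 ^+ n * n%:R ^+ n * n%:R ^+ n.
Definition kappa s : R := poincare_cst * s / s ^+ n.

Lemma poincare_cst_gt0 : 0 < poincare_cst.
Proof. by rewrite /poincare_cst !mulr_gt0 ?exprn_gt0 ?ltr0n. Qed.

Lemma kappa_ge0 s : 0 <= s -> 0 <= kappa s.
Proof.
move=> s0; rewrite /kappa divr_ge0 ?exprn_ge0// mulr_ge0//.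
exact/ltW/poincare_cst_gt0.
Qed.

Let ball_fin y s : 0 < s -> mu (eball y s) \is a fin_num.
Proof.
move=> s0; rewrite ge0_fin_numE//; apply: le_lt_trans (lebesgue_eball_le y (ltW s0)) _.
exact: ltry.
Qed.

Let ball_ge y s : 0 < s -> (2 * s / n%:R) ^+ n <= fine (mu (eball y s)).
Proof. by move=> s0; rewrite -lee_fin fineK ?ball_fin// lebesgue_eball_ge. Qed.

Let ball_gt0 y s : 0 < s -> 0 < fine (mu (eball y s)).
Proof.
move=> s0; apply: lt_le_trans (ball_ge y s0).
by rewrite exprn_gt0// divr_gt0// ?mulr_gt0// ltr0n.
Qed.

Lemma half_ball_cst y s z : 0 < s ->
  (fine (mu (eball y s)))^-1 * ((fine (mu (eball z (s / 2))))^-1 *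
     (2 * s * (4 * s) ^+ n)) <= kappa s.
Proof.
move=> s0; have s2 : 0 < s / 2 by rewrite divr_gt0.
have nn : 0 < n%:R :> R by rewrite ltr0n.
have i1 : (fine (mu (eball y s)))^-1 <= ((2 * s / n%:R) ^+ n)^-1.
  rewrite lef_pV2 ?posrE ?ball_gt0 ?ball_ge// exprn_gt0// divr_gt0// mulr_gt0//.
have i2 : (fine (mu (eball z (s / 2))))^-1 <= ((s / n%:R) ^+ n)^-1.
  rewrite lef_pV2 ?posrE ?ball_gt0//.
    by have := ball_ge z s2; rewrite mulrCA divff// mulr1.
  by rewrite exprn_gt0// divr_gt0.
apply: (@le_trans _ _ (((2 * s / n%:R) ^+ n)^-1 * (((s / n%:R) ^+ n)^-1 *
    (2 * s * (4 * s) ^+ n)))).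
  have p1 : 0 <= 2 * s * (4 * s) ^+ n by rewrite !mulr_ge0 ?exprn_ge0 ?mulr_ge0// ltW.
  have i0 w t : 0 < t -> 0 <= (fine (mu (eball w t)))^-1.
    by move=> t0; rewrite invr_ge0; exact/ltW/ball_gt0.
  apply: ler_pM => //; [exact: i0|by rewrite mulr_ge0// i0|exact: ler_wpM2r].
rewrite le_eqVlt; apply/orP; left; apply/eqP.
rewrite /kappa /poincare_cst !exprMn !exprVn.
have -> : 4 ^+ n = 2 ^+ n * 2 ^+ n :> R by rewrite -exprMn -natrM.
by field; rewrite ?expf_neq0 ?gt_eqF//.
Qed.

Variables (x : 'rV[R]_n) (r : R).
Hypothesis r0 : 0 < r.
Hypothesis ED : (E x r < +oo)%E.

Let s (k : nat) : R := (r / 2) / 2 ^+ k.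
Let s_gt0 k : 0 < s k. Proof. by rewrite !divr_gt0// exprn_gt0. Qed.

Section at_point.
Variable y : 'rV[R]_n.
Hypothesis xy : eball x (r / 2) y.

Let s_le k : s k <= r / 2.
Proof. by rewrite /s ler_pdivrMr ?exprn_gt0// ler_peMr ?exprn_ege1 ?ler1n// divr_ge0// ltW. Qed.

Let sub k : eball y (s k) `<=` eball x r.
Proof.
apply: (eball_sub xy); apply: le_trans (lerD (lexx _) (s_le k)) _.
by rewrite -splitr.
Qed.

Let Ek k : (E y (s k) < +oo)%E.
Proof. by apply: le_lt_trans ED; exact: (ball_energy_le lu wg (@sub k)). Qed.

Let step k : (`|mean Gam u y (s k) - mean Gam u y (s k.+1)|%:E <=
  (kappa (s k))%:E * E y (s k))%E.
Proof.
have sS : s k.+1 = s k / 2 by rewrite /s exprSr invfM mulrA.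
have sub' : eball y (s k / 2) `<=` eball y (s k).
  by apply: le_eball; rewrite ler_pdivrMr// ler_peMr ?ler1n// ltW.
have h2 : 0 < s k / 2 by rewrite divr_gt0.
rewrite sS; apply: le_trans (mean_diff_le Gam0 cGam lu wg shadow n0 (s_gt0 k) h2 sub' (Ek k)) _.
by apply: lee_wpmul2r; [exact: ball_energy_ge0|rewrite lee_fin half_ball_cst].
Qed.

Let partial_sum N : (`|mean Gam u y (s 0)|%:E <=
  \sum_(k < N) (kappa (s k))%:E * E y (s k) + `|mean Gam u y (s N)|%:E)%E.
Proof.
elim: N => [|N IH]; first by rewrite big_ord0 add0e.
apply: le_trans IH _; rewrite big_ord_recr/= -addeA; apply: leeD2l.
apply: (@le_trans _ _ (`|mean Gam u y (s N) - mean Gam u y (s N.+1)|%:E +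
    `|mean Gam u y (s N.+1)|%:E)%E).
  by rewrite -EFinD lee_fin -{1}(subrK (mean Gam u y (s N.+1)) (mean Gam u y (s N))) ler_normD.
exact: leeD2r (step N).
Qed.

Let mean_small (e : R) : 0 < e -> trace Gam u y 0 ->
  exists N, `|mean Gam u y (s N)| <= e.
Proof.
move=> e0 /fine_cvgP[_ /cvgrPdist_le/(_ _ e0)].
rewrite near_withinE => -[dl /= dl0 Hd].
(* Then s_N = r / 2^(N+1) < dl, because 2^(N+1) > N + 1 > r / dl. *)
pose N := Num.truncn (r / dl); exists N.
have sN : s N < dl.
  rewrite /s -mulrA -invfM -exprS ltr_pdivrMr ?exprn_gt0//.
  have : r / dl < N.+1%:R by exact: truncnS_gt.
  rewrite ltr_pdivrMr// => h; apply: lt_le_trans h _; rewrite mulrC ler_pM2l//.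
  by rewrite -natrX ler_nat ltnW// ltn_expl.
have := Hd (s N); rewrite /= sub0r normrN gtr0_norm// => /(_ sN (s_gt0 N)).
rewrite sub0r normrN; apply: le_trans; rewrite le_eqVlt; apply/orP; left; apply/eqP.
congr (`|_|); rewrite /ball_mean /mean.
have -> : (\int[mu]_(z in eball y (s N) `\` Gam) (EFin \o u) z =
    \int[mu]_(z in eball y (s N)) (u0 z)%:E)%E.
  rewrite [LHS]integral_mkcond [RHS]integral_mkcond; apply: eq_integral => z _.
  rewrite /u0 !patchE in_setD in_setC; case: (z \in eball y (s N)) => //=.
  by case: (z \in Gam).
(* Integrability makes the integral finite, so that [fine] commutes with the product and the average
   in the trace is [mean]. *)
have iu := ball_integrable Gam0 cGam lu wg shadow n0 (s_gt0 N) (Ek N).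
by rewrite -[X in fine (_ * X)%E]fineK ?(integrable_fin_num _ iu)//; exact: measurable_eball.
Qed.

Lemma mean_telescope : trace Gam u y 0 ->
  (`|mean Gam u y (r / 2)|%:E <= \sum_(k <oo) (kappa (s k))%:E * E y (s k))%E.
Proof.
move=> ty; have -> : r / 2 = s 0 by rewrite /s expr0 divr1.
apply/lee_addgt0Pr => e e0; have [N HN] := mean_small e0 ty.
apply: le_trans (partial_sum N) _; apply: leeD; last by rewrite lee_fin.
have := @nneseries_lim_ge R (fun k => (kappa (s k))%:E * E y (s k))%E xpredT 0 N.
rewrite big_mkord; apply => k _ _.
by rewrite mule_ge0 ?ball_energy_ge0// lee_fin kappa_ge0// ltW.
Qed.

(** |u| <= |u - m| + |m|, where m is the mean over B(y, r/2), a ball inside B(x, r). The first part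
    is the Poincare inequality on B(x, r); the second is telescoped down to the zero trace at y. *)
Lemma ball_mean_le : trace Gam u y 0 ->
  (ball_mean Gam (fun z => `|u z|%:E) x r <= (kappa r)%:E * E x r +
   \sum_(k <oo) (kappa (s k))%:E * E y (s k))%E.
Proof.
move=> ty; have e0 := ball_gt0 x r0; rewrite /ball_mean; set e := fine _ in e0 *.
have mu0 : measurable_fun setT u0.
  have [mu oG _] := lu; have mG := open_measurable_rV oG.
  exact: (measurable_restrictT u mG).1.
have mB := measurable_eball x r.
have -> : (\int[mu]_(z in eball x r `\` Gam) `|u z|%:E =
    \int[mu]_(z in eball x r) `|u0 z|%:E)%E.
  rewrite [LHS]integral_mkcond [RHS]integral_mkcond; apply: eq_integral => z _.
  rewrite /u0 !patchE in_setD in_setC; case: (z \in eball x r) => //=.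
  by case: (z \in Gam); rewrite //= normr0.
have r2 : 0 < r / 2 by rewrite divr_gt0.
have sub0 : eball y (r / 2) `<=` eball x r.
  by apply: (eball_sub xy); rewrite -splitr.
set m := mean Gam u y (r / 2).
have mm : measurable_fun (eball x r) (fun z => `|u0 z - m|%:E).
  apply: measurable_funTS; apply: measurable_EFin_fun.
  by apply: measurableT_comp => //; exact: measurable_funB.
apply: (@le_trans _ _ (e^-1%:E * (\int[mu]_(z in eball x r) `|u0 z - m|%:E +
    \int[mu]_(z in eball x r) (cst `|m|%:E) z)))%E.
  apply: lee_wpmul2l; first by rewrite lee_fin invr_ge0 ltW.
  rewrite -ge0_integralD//.
  apply: (@ge0_le_integral _ _ R mu (eball x r)) => //.
  - by apply: measurable_funTS; apply: measurable_EFin_fun; exact: measurableT_comp.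
  - exact: emeasurable_funD.
  - by move=> z _; rewrite /= -EFinD lee_fin -{1}(subrK m (u0 z)) ler_normD.
  by move=> z _; rewrite /= lee_fin.
rewrite integral_cst//= ge0_muleDr; last 2 first.
- by apply: integral_ge0 => z _; rewrite lee_fin.
- by rewrite mule_ge0// lee_fin.
apply: leeD.
  apply: (@le_trans _ _ (e^-1%:E * (((fine (mu (eball y (r / 2))))^-1 *
      (2 * r * (4 * r) ^+ n))%:E * E x r))%E).
    apply: lee_wpmul2l; first by rewrite lee_fin invr_ge0 ltW.
    exact: (integral_mean_dist_le Gam0 cGam lu wg shadow n0).
  rewrite muleA -EFinM; apply: lee_wpmul2r; first exact: ball_energy_ge0.
  by rewrite lee_fin half_ball_cst.
apply: le_trans (mean_telescope ty).
rewrite -(fineK (ball_fin x r0)) -/e -!EFinM lee_fin mulrCA mulVf ?gt_eqF//.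
by rewrite mulr1.
Qed.

End at_point.
End telescoping.

(** * Averaging over boundary points *)

Section boundary_poincare.
Context {R : realType} {n : nat}.
Local Notation mu := (@lebesgue_rV R n).
Local Notation poincare_cst := (@poincare_cst R n).
Local Notation kappa := (@kappa R n).
Variables (d C0 : R) (Gam : set 'rV[R]_n).
Hypothesis n0 : (0 < n)%N.
Hypothesis d0 : 0 < d.
Hypothesis dn : d < n%:R - 1.
Hypothesis Gam0 : Gam !=set0.
Hypothesis cGam : closed Gam.
Hypothesis C1 : 1 <= C0.
Hypothesis reg : forall x r, Gam x -> 0 < r ->
  ((C0^-1 * r `^ d)%:E <= hausdorff d (Gam `&` eball x r) <= (C0 * r `^ d)%:E)%E.

Let p := n%:R - 1 - d.
Let p0 : 0 < p. Proof. by rewrite /p subr_gt0. Qed.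
Let C00 : 0 < C0. Proof. exact: lt_le_trans C1. Qed.

Lemma weightE z : weight d Gam z = dist_to Gam z `^ (- p).
Proof. by rewrite /weight /p; rewrite !opprB addrA. Qed.

Lemma measurable_weight : measurable_fun setT (weight d Gam).
Proof.
apply: (measurableT_comp (@measurable_powR R (d + 1 - n%:R))).
by apply: continuous_measurable_rV; exact: continuous_dist_to.
Qed.

(** The Poincare constant, the mass bound C0 2^d for balls not centred on [Gam], and the constant of
    the geometric sum. *)
Definition potential_cst : R :=
  poincare_cst * C0 * 2 `^ d * (2 `^ p / (2 `^ p - 1)).

Lemma potential_cst_gt0 : 0 < potential_cst.
Proof.
have h : 1 < 2 `^ p :> R.
  rewrite -[ltLHS](_ : 1 `^ p = 1); last by rewrite powR1.
  by apply: gt0_ltr_powR; rewrite ?nnegrE// ltr1n.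
rewrite /potential_cst mulr_gt0//; last by rewrite divr_gt0 ?subr_gt0// powR_gt0.
rewrite mulr_gt0 ?powR_gt0// mulr_gt0//; exact: poincare_cst_gt0.
Qed.

Lemma kappa_powR s : 0 < s -> kappa s * s `^ d = poincare_cst * s `^ (- p).
Proof.
move=> s0; have -> : - p = 1 + d - n%:R by rewrite /p !opprB addrA [d + 1]addrC.
have nz : s != 0 by rewrite gt_eqF.
rewrite powRB ?nz ?implybT// powRD ?nz ?implybT// powRr1 ?(ltW s0)//.
by rewrite powR_mulrn ?(ltW s0)// /kappa; ring.
Qed.

(** If dist(z, Gam) >= t then B(z, t) misses [Gam] and has no mass; this is what truncates the
    series over scales at the distance to [Gam]. *)
Lemma kappa_measure_ball_le (s : {finite_measure set 'rV[R]_n -> \bar R}) x M z t :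
  (forall A, s A = hausdorff d (A `&` (Gam `&` eball x M))) -> 0 < t ->
  ((kappa t)%:E * s (eball z t) <=
   (poincare_cst * C0 * 2 `^ d * if dist_to Gam z < t then t `^ (- p) else 0)%:E)%E.
Proof.
move=> sE t0; case: ifPn => [_|]; last rewrite -leNgt => tz.
  apply: (@le_trans _ _ ((kappa t)%:E * (C0 * (2 * t) `^ d)%:E)%E).
    apply: lee_wpmul2l; first by rewrite lee_fin kappa_ge0// ltW.
    by rewrite sE; apply: (@hausdorff_ball_le _ _ _ _ _ d0 C1 reg z) => // y [zy [Gy _]].
  rewrite -EFinM lee_fin powRM ?(ltW t0)//.
  rewrite (_ : kappa t * _ = C0 * 2 `^ d * (kappa t * t `^ d)); last by ring.
  by rewrite kappa_powR// le_eqVlt; apply/orP; left; apply/eqP; ring.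
rewrite (_ : s _ = 0%E) ?mule0 ?mulr0// sE.
rewrite (_ : _ `&` _ = set0); first exact: (outer_measure0 (hausdorff_outer d0)).
rewrite -subset0 => y [zy [Gy _]]; have := dist_to_le z Gy.
by rewrite leNgt -enormN opprB (lt_le_trans zy tz).
Qed.

Variables (u : 'rV[R]_n -> R) (g : 'rV[R]_n -> 'rV[R]_n).
Hypothesis lu : locally_integrable_rV (~` Gam) u.
Hypothesis wg : weak_gradient (~` Gam) u g.
Variables (x : 'rV[R]_n) (r : R).
Hypotheses (Gx : Gam x) (r0 : 0 < r).

Let E := ball_energy Gam g.
Let J : \bar R :=
  (\int[mu]_(y in eball x r `\` Gam) (enorm (g y) * weight d Gam y)%:E)%E.
Let F (z : 'rV[R]_n) : R := \1_(eball x r) z * ((enorm \o g) \_ (~` Gam)) z.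

Let mG : measurable (~` Gam).
Proof. by apply: open_measurable_rV; case: lu. Qed.

Let F0 z : 0 <= F z.
Proof. by rewrite mulr_ge0// patchE; case: ifP => //= _; exact: enorm_ge0. Qed.

Let mF : measurable_fun setT F.
Proof.
apply: measurable_funM; first by apply: measurable_indic; exact: measurable_eball.
by apply: measurable_enorm_restrict => // i; case: wg => /(_ i)[].
Qed.

Let J_E : J = (\int[mu]_z (F z * weight d Gam z)%:E)%E.
Proof.
rewrite /J integral_mkcond; apply: eq_integral => z _.
rewrite /F indicE !patchE in_setD in_setC.
by case: (z \in eball x r); case: (z \in Gam); rewrite ?(mul0r, mulr0, mul1r).
Qed.

Let F_dist z : F z != 0 -> 0 < dist_to Gam z < r.
Proof.
rewrite /F indicE patchE; case: (boolP (z \in eball x r)); last by rewrite mul0r eqxx.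
case: ifPn; last by rewrite mulr0 eqxx.
rewrite !inE => Gz xz _; rewrite dist_to_gt0//=.
exact: le_lt_trans (dist_to_le z Gx) xz.
Qed.

(** As x lies on [Gam], the distance to [Gam] is below r on B(x, r), so the weight is at least r^-p
    there. The bound both gives finite energy when [J] is finite and absorbs the Poincare term of
    B(x, r). *)
Lemma energy_le : (E x r <= (r `^ p)%:E * J)%E.
Proof.
have mW : measurable_fun setT (fun z => (F z * weight d Gam z)%:E).
  by apply: measurable_EFin_fun; apply: measurable_funM => //; exact: measurable_weight.
rewrite J_E -ge0_integralZl//; last 2 first.
- by move=> z _; rewrite lee_fin mulr_ge0// powR_ge0.
- by rewrite lee_fin powR_ge0.
rewrite -[E x r]/(\int[mu]_z (F z)%:E)%E; apply: ge0_le_integral => //.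
- by move=> z _; rewrite lee_fin.
- exact: measurable_EFin_fun.
- by apply: emeasurable_funM => //; exact: measurable_cst.
move=> z _; rewrite -EFinM lee_fin.
have [->|/F_dist/andP[z0 zr]] := eqVneq (F z) 0; first by rewrite mul0r mulr0.
rewrite mulrCA -[leLHS]mulr1; apply: ler_wpM2l => //.
rewrite weightE powRN ler_pdivlMr ?powR_gt0// mul1r.
by apply: ge0_ler_powR; rewrite ?nnegrE ltW.
Qed.

Let s (k : nat) : R := (r / 2) / 2 ^+ k.
Let s_gt0 k : 0 < s k. Proof. by rewrite !divr_gt0// exprn_gt0. Qed.
Let kappa_s k : (0 <= (kappa (s k))%:E)%E.
Proof. by rewrite lee_fin kappa_ge0// ltW. Qed.

(** For y in B(x, r/2) the ball B(y, s_k) lies in B(x, r), so the cut-off in [F] changes nothing;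
    for other y it keeps the integrand controlled by the gradient on B(x, r), and Tonelli applies
    without restricting y. *)
Let ball_F y k : eball x (r / 2) y ->
  E y (s k) = (\int[mu]_z (\1_(eball y (s k)) z * F z)%:E)%E.
Proof.
move=> xy; apply: eq_integral => z _; rewrite /F !indicE.
case: (boolP (z \in eball y (s k))); last by rewrite !mul0r.
rewrite inE => yz; rewrite mem_set ?mul1r//.
apply: (eball_sub xy) yz; rewrite [leRHS]splitr lerD2l.
by rewrite ler_pdivrMr ?exprn_gt0// ler_peMr ?exprn_ege1 ?ler1n// divr_ge0// ltW.
Qed.

Lemma integral_potential_le (sg : {finite_measure set 'rV[R]_n -> \bar R}) M :
  (forall A, sg A = hausdorff d (A `&` (Gam `&` eball x M))) ->
  (\int[sg]_y \sum_(k <oo) (kappa (s k))%:E * \int[mu]_z (\1_(eball y (s k)) z * F z)%:E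
   <= potential_cst%:E * J)%E.
Proof.
move=> sgE; have Fi y k : (0 <= \int[mu]_z (\1_(eball y (s k)) z * F z)%:E)%E.
  by apply: integral_ge0 => z _; rewrite lee_fin mulr_ge0.
have mFi k := measurable_ball_integral (s k) mF F0.
have mFE : measurable_fun setT (fun z => (F z)%:E) by exact: measurable_EFin_fun.
have mS k : measurable_fun setT (fun z => (F z)%:E * sg (eball z (s k)))%E.
  by apply: emeasurable_funM => //; exact: measurable_measure_ball.
have S0 k z : (0 <= (F z)%:E * sg (eball z (s k)))%E by rewrite mule_ge0// lee_fin.
rewrite integral_nneseries//; last 2 first.
- by move=> k; apply: emeasurable_funM => //; exact: measurable_cst.
- by move=> k y _; rewrite mule_ge0.
under eq_eseriesr => k _.
  rewrite ge0_integralZl// integral_ball_swap// -ge0_integralZl//.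
  over.
rewrite -integral_nneseries//; last 2 first.
- by move=> k; apply: emeasurable_funM => //; exact: measurable_cst.
- by move=> k y _; rewrite mule_ge0.
rewrite J_E -ge0_integralZl//; last 3 first.
- by apply: measurable_EFin_fun; apply: measurable_funM => //; exact: measurable_weight.
- by move=> z _; rewrite lee_fin mulr_ge0// powR_ge0.
- by rewrite lee_fin ltW// potential_cst_gt0.
apply: ge0_le_integral => //.
- by move=> z _; apply: nneseries_ge0 => k _ _; rewrite mule_ge0.
- apply: ge0_emeasurable_sum => [k z _ _|k _]; first by rewrite mule_ge0.
  by apply: emeasurable_funM => //; exact: measurable_cst.
- apply: emeasurable_funM; first exact: measurable_cst.
  by apply: measurable_EFin_fun; apply: measurable_funM => //; exact: measurable_weight.
(* Where [F] vanishes both sides are 0; elsewhere dist(z, Gam) > 0, as the geometric sum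
   requires. *)
move=> z _; have [Fz|/F_dist/andP[z0 zr]] := eqVneq (F z) 0.
  rewrite Fz mul0r mule0 eseries0// => k _ _; rewrite mul0e mule0//.
apply: lime_le; first by apply: is_cvg_nneseries => k _ _; rewrite mule_ge0.
apply: nearW => N; rewrite big_mkord.
apply: (@le_trans _ _ (\sum_(k < N) (F z * (poincare_cst * C0 * 2 `^ d *
    if dist_to Gam z < s k then s k `^ (- p) else 0))%:E)%E).
  apply: lee_sum => k _; rewrite muleCA [leRHS]EFinM; apply: lee_wpmul2l; first by rewrite lee_fin.
  exact: (kappa_measure_ball_le _ sgE).
rewrite sumEFin lee_fin -mulr_sumr mulrCA; apply: ler_wpM2l => //.
rewrite -mulr_sumr weightE /potential_cst -[leRHS]mulrA; apply: ler_wpM2l.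
  rewrite mulr_ge0 ?powR_ge0// mulr_ge0 ?(ltW C00)//; exact/ltW/poincare_cst_gt0.
by apply: truncated_geometric_sum => //; rewrite divr_gt0.
Qed.

(** The mass of B(x, r/2) lies between (r/2)^d / C0 and C0 (r/2)^d. Comparing the upper with the
    lower bound in the Poincare term gives C0^2; dividing the integrated series by the lower bound
    gives C0 2^d r^-d. *)
Definition boundary_cst : R :=
  C0 ^+ 2 * poincare_cst + C0 * 2 `^ d * potential_cst.

Lemma boundary_cst_gt0 : 0 < boundary_cst.
Proof.
apply: addr_gt0; first by rewrite mulr_gt0 ?exprn_gt0//; exact: poincare_cst_gt0.
by rewrite mulr_gt0 ?potential_cst_gt0// mulr_gt0// powR_gt0.
Qed.

Let T := ball_mean Gam (fun y => `|u y|%:E) x r.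

Let T0 : (0 <= T)%E.
Proof.
rewrite /T /ball_mean mule_ge0//; last by apply: integral_ge0 => z _; rewrite lee_fin.
by rewrite lee_fin invr_ge0 fine_ge0// measure_ge0.
Qed.

Let J0 : (0 <= J)%E.
Proof.
by apply: integral_ge0 => z _; rewrite lee_fin mulr_ge0 ?enorm_ge0// powR_ge0.
Qed.

Hypothesis zero_trace : hausdorff_ae d (Gam `&` eball x r) [set y | trace Gam u y 0].

Let mean_mass_le (sg : {finite_measure set 'rV[R]_n -> \bar R}) :
  (forall A, sg A = hausdorff d (A `&` (Gam `&` eball x (r / 2)))) ->
  (J < +oo)%E ->
  (T * sg setT <= (kappa r)%:E * E x r * sg setT + potential_cst%:E * J)%E.
Proof.
move=> sgE Jfin.
have Efin : (E x r < +oo)%E.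
  apply: le_lt_trans energy_le _; rewrite -(fineK (_ : J \is a fin_num)) ?ge0_fin_numE//.
  by rewrite -EFinM ltry.
have shadow := shadow_null d0 cGam C1 reg dn Gam0.
pose f y := (\sum_(k <oo) (kappa (s k))%:E * \int[mu]_z (\1_(eball y (s k)) z * F z)%:E)%E.
pose c := ((kappa r)%:E * E x r)%E.
have c0 : (0 <= c)%E by rewrite mule_ge0 ?ball_energy_ge0// lee_fin kappa_ge0// ltW.
have Fi y k : (0 <= \int[mu]_z (\1_(eball y (s k)) z * F z)%:E)%E.
  by apply: integral_ge0 => z _; rewrite lee_fin mulr_ge0.
have f0 y : (0 <= f y)%E by apply: nneseries_ge0 => k _ _; rewrite mule_ge0.
have mf : measurable_fun setT f.
  apply: ge0_emeasurable_sum => [k y _ _|k _]; first by rewrite mule_ge0.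
  apply: emeasurable_funM; first exact: measurable_cst.
  exact: measurable_ball_integral.
have mcf : measurable_fun setT (fun y => c + f y)%E.
  by apply: emeasurable_funD => //; exact: measurable_cst.
have le_f y : eball x (r / 2) y -> trace Gam u y 0 -> (T <= c + f y)%E.
  move=> xy ty; apply: le_trans (ball_mean_le Gam0 cGam lu wg shadow n0 r0 Efin xy ty) _.
  apply: leeD2l; rewrite le_eqVlt; apply/orP; left; apply/eqP.
  by apply: eq_eseriesr => k _; rewrite -(ball_F _ xy).
apply: (@le_trans _ _ (\int[sg]_y (c + f y))%E).
  rewrite -integral_cst//; apply: ae_ge0_le_integral => //.
  - by move=> y _; rewrite adde_ge0.
  (* The points of zero trace are not shown to form a measurable set. The set where the estimate
     fails is measurable, and its part in [Gam] and B(x, r/2) contains no point of zero trace, hence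
     is null. *)
  exists [set y | c + f y < T]%E; split.
  - rewrite -[X in measurable X]setTI.
    exact: emeasurable_fun_infty_o.
  - rewrite [LHS]sgE; apply/eqP; rewrite eq_le (outer_measure_ge0 (hausdorff_outer d0)) andbT -zero_trace.
    apply: (le_outer_measure (hausdorff_outer d0)) => y [/= lt_f [Gy xy]].
    split.
      split => //; apply: le_eball xy; rewrite ler_pdivrMr// ler_peMr ?ler1n//.
      exact: ltW.
    by move=> ty; move: lt_f; rewrite ltNge (le_f _ xy ty).
  by move=> y /= /not_implyP[_ /negP]; rewrite -ltNge.
rewrite ge0_integralD// integral_cst//; apply: leeD2l.
exact: (integral_potential_le sgE).
Qed.

Lemma ball_mean_boundary_le :
  (T <= (boundary_cst * r `^ (- d))%:E * J)%E.
Proof.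
have rd : 0 < r `^ (- d) by exact: powR_gt0.
have [Jfin|] := boolP (J \is a fin_num); last first.
  rewrite ge0_fin_numE// -leNgt leye_eq => /eqP ->.
  by rewrite gt0_muley ?leey// lte_fin mulr_gt0// boundary_cst_gt0.
have Jlt : (J < +oo)%E by rewrite -ge0_fin_numE.
have r20 : 0 < r / 2 by rewrite divr_gt0.
have [sg sgE] := regular_restriction d0 cGam reg Gx r20.
have /andP[m1 m2] := reg Gx r20.
have mE : sg setT = hausdorff d (Gam `&` eball x (r / 2)) by rewrite sgE setTI.
rewrite -mE in m1 m2.
have := mean_mass_le sgE Jlt.
have := energy_le; rewrite -/E.
have := ball_energy_ge0 Gam g x r; rewrite -/E.
have Mfin : sg setT \is a fin_num by exact: fin_num_measure.
move: m1 m2; rewrite -(fineK Mfin) -(fineK Jfin) !lee_fin.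
set m := fine (sg _); set j := fine J => m1 m2.
have j0 : 0 <= j by rewrite fine_ge0.
case: (E x r) => [e||]//; rewrite -EFinM !lee_fin => e0 ej.
have c0 : 0 < C0^-1 * (r / 2) `^ d by rewrite mulr_gt0 ?invr_gt0// powR_gt0.
have m0 : 0 < m by exact: lt_le_trans m1.
rewrite -!EFinM -EFinD.
move: T0; case: T => [t||]//; last by rewrite gt0_mulye// leye_eq.
rewrite -EFinM !lee_fin => t0 tm.
(* Multiplying by the lower bound of the mass, which is at most [m], reduces the claim to the
   integrated estimate [tm]. *)
rewrite -(ler_pM2r c0); apply: (@le_trans _ _ (t * m)); first exact: ler_wpM2l.
apply: (le_trans tm).
apply: (@le_trans _ _ (kappa r * (r `^ p * j) * (C0 * (r / 2) `^ d) + potential_cst * j)).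
  rewrite lerD2r; apply: ler_pM => //; first by rewrite mulr_ge0// kappa_ge0// ltW.
    exact: ltW.
  by apply: ler_wpM2l => //; rewrite kappa_ge0// ltW.
have q0 : r `^ d != 0 by rewrite gt_eqF// powR_gt0.
have h0 : 2 `^ d != 0 :> R by rewrite gt_eqF// powR_gt0.
have rh : (r / 2) `^ d = r `^ d / 2 `^ d.
  rewrite powRM ?invr_ge0 ?(ltW r0)//; congr (_ * _).
  by rewrite -powR_inv1// -powRrM mulN1r powRN.
have kp : kappa r * r `^ p = poincare_cst / r `^ d.
  apply: (mulIf q0); rewrite divfK// mulrAC kappa_powR// powRN divfK//.
  by rewrite gt_eqF// powR_gt0.
rewrite [kappa r * _]mulrA kp rh powRN /boundary_cst le_eqVlt; apply/orP; left; apply/eqP.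
by field; rewrite q0 h0 gt_eqF.
Qed.

End boundary_poincare.

Theorem lemma4p1 (R : realType) (n : nat) (d : R) (Gam : set 'rV[R]_n)
  (hn : (2 <= n)%N) (hd0 : 0 < d) (hdn : d < n%:R - 1)
  (hGam0 : Gam !=set0) (hGam : closed Gam) (hreg : ahlfors_regular d Gam) :
  exists2 C : R, 0 < C &
    forall (u : 'rV[R]_n -> R) (g : 'rV[R]_n -> 'rV[R]_n),
      inW d Gam u -> weak_gradient (~` Gam) u g ->
    forall (x : 'rV[R]_n) (r : R), Gam x -> 0 < r ->
      hausdorff_ae d (Gam `&` eball x r) [set y | trace Gam u y 0] ->
      (ball_mean Gam (fun y => `|u y|%:E) x r <=
       (C * r `^ (- d))%:E *
       \int[@lebesgue_rV R n]_(y in eball x r `\` Gam)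
         (enorm (g y) * weight d Gam y)%:E)%E.
Proof.
have n0 : (0 < n)%N by exact: ltnW.
case: hreg => C0 C1 reg.
exists (@boundary_cst R n d C0); first exact: (boundary_cst_gt0 n0 hdn C1).
move=> u g [lu _] wg x r Gx r0 zero_trace.
exact: (ball_mean_boundary_le n0 hd0 hdn hGam0 hGam C1 reg lu wg Gx r0 zero_trace).
Qed.
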